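(* Let $n\ge1$, let $n_1,\dots,n_r$ ($r\ge1$) be positive integers with $m:=n_1+\dots+n_r\le n$, and put $n_0:=n-m$, $d_\ell:=\sum_{s=1}^\ell n_s$. One has isotropic embeddings $$\mathcal{O}^{\mathrm{SO}(2n+1)}:=\frac{\mathrm{SO}(2n+1)}{\mathrm{SO}(2n_0+1)\times\mathrm{U}(n_1)\times\cdots\times\mathrm{U}(n_r)}\hookrightarrow\mathcal{N}^{\mathrm{SO}(2n+1)}=\mathsf{OGr}'_{d_1}\times\mathsf{OGr}'_{d_2}\times\cdots\times\mathsf{OGr}'_{m}\times\mathsf{OGr}'_{m},$$ $$\mathcal{O}^{\mathrm{Sp}(n)}:=\frac{\mathrm{Sp}(n)}{\mathrm{Sp}(n_0)\times\mathrm{U}(n_1)\times\cdots\times\mathrm{U}(n_r)}\hookrightarrow\mathcal{N}^{\mathrm{Sp}(n)}=\mathsf{SGr}_{d_1}\times\mathsf{SGr}_{d_2}\times\cdots\times\mathsf{SGr}_{m}\times\mathsf{SGr}_{m}$$ (each product has $r+1$ factors, indexed by $d_1,\dots,d_r=m$ followed by one more $m$), where the symplectic forms on $\mathcal{N}^{\mathrm{SO}(2n+1)}$ and $\mathcal{N}^{\mathrm{Sp}(n)}$ are the sums of the Kirillov–Kostant–Souriau forms, the $\ell$-th factor being the orbit of, respectively, $$\Lambda_\ell^{\mathrm{SO}(2n+1)}=\mathrm{Diag}(\Upsilon_\ell\otimes\mathcal{J}_2,\,0),\qquad \Lambda_\ell^{\mathrm{Sp}(n)}=\Upsilon_\ell\otimes\sigma_3,\qquad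 \ell=1,\dots,r+1,$$ with $$\Upsilon_\ell=2^{r-\ell}\,\mathrm{Diag}\bigl(-\mathds{1}_{n_1},\dots,-\mathds{1}_{n_{\ell-1}},\mathds{1}_{n_\ell},\mathbf{0}_{n_{\ell+1}},\dots,\mathbf{0}_{n_r},\mathbf{0}_{n-m}\bigr)\quad(\ell=1,\dots,r),$$ $$\Upsilon_{r+1}=\mathrm{Diag}\bigl(-\mathds{1}_{n_1},\dots,-\mathds{1}_{n_r},\mathbf{0}_{n-m}\bigr).$$ In both cases the embedded submanifold is the level set $\mu=0$ of the moment map for the diagonal action of the symmetry group ($\mathrm{SO}(2n+1)$, respectively $\mathrm{Sp}(n)$).
   Context: $\mathcal{J}_2=\begin{pmatrix}0&1\\-1&0\end{pmatrix}$, $\sigma_3=\begin{pmatrix}1&0\\0&-1\end{pmatrix}$; $\mathds{1}_k$, $\mathbf{0}_k$ are the $k\times k$ identity and zero matrices. For diagonal $\Upsilon$, $\Upsilon\otimes A$ is the block-diagonal matrix with blocks $\Upsilon_{ii}A$. $\mathrm{Sp}(n)$ is the compact form of $\mathrm{Sp}(2n,\mathbb{C})$, i.e. the group of unitary $2n\times 2n$ matrices preserving the skew form $u^t\omega v$ with $\omega=\mathds{1}_n\otimes\mathcal{J}_2$; $\mathrm{Sp}(0)$ is the trivial group. $$\mathsf{OGr}'_k:=\frac{\mathrm{SO}(2n+1)}{\mathrm{SO}(2n-2k+1)\times\mathrm{U}(k)},\qquad \mathsf{SGr}_k:=\frac{\mathrm{Sp}(n)}{\mathrm{Sp}(n-k)\times\mathrm{U}(k)}.$$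 The orbit of $\Lambda$ under $\mathrm{G}$ is $\{g\Lambda g^{-1}:g\in \mathrm{G}\}$. In the symplectic case the matrices $\Lambda_\ell^{\mathrm{Sp}(n)}$ are Hermitian, and one identifies $\mathfrak{sp}_n$ with Hermitian matrices through multiplication by $i$ (so that the Lie algebra element is $i\Lambda_\ell^{\mathrm{Sp}(n)}$). The Kirillov–Kostant–Souriau form on the orbit of a Lie algebra element is $\omega_x(\xi,\zeta)=\langle x,[\xi,\zeta]\rangle$, with $\langle X,Y\rangle=\mathrm{Tr}(XY)$ and tangent vectors at $x$ represented by the Lie algebra elements generating them. The moment map for the diagonal action sends $(x_1,\dots,x_{r+1})$ to $\sum_\ell x_\ell$ (the Lie algebra being identified with its dual via $\langle\cdot,\cdot\rangle$). An embedding is isotropic if the symplectic form restricts to zero on the image. *)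

(* Defs.v *)
From HB Require Import structures.
From mathcomp Require Import all_boot all_order all_algebra.
From mathcomp Require Import spectral.
From mathcomp Require Import complex mxtens.
From mathcomp Require Import all_classical all_reals all_analysis.

Set Implicit Arguments.
Unset Strict Implicit.
Unset Printing Implicit Defensive.
Import Order.TTheory GRing.Theory Num.Theory.
Import numFieldNormedType.Exports.
Local Open Scope classical_set_scope.
Local Open Scope ring_scope.
Local Open Scope complex_scope.

(* Real differential geometry in the space of p x p matrices over K, where
   K = R (with iota the identity) or K = R[i] (with iota the inclusion).
   Every manifold below is a closed submanifold of a space of matrices, or of
   tuples of matrices, or a quotient G / H of a compact matrix group by a
   closed subgroup. *)
Section Geometry.
Variables (R : realType) (K : numFieldType) (iota : R -> K) (p : nat).
Local Notation M := 'M[K]_p.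
Implicit Types (G H S : set M) (g x v : M).

Definition is_velocity (c : R -> M) v : Prop :=
  (fun t : R => (iota t)^-1 *: (c t - c 0)) @ (0 : R)^' --> v.

(* For S a submanifold of the space of matrices, this is T_x S. *)
Definition tangent S x v : Prop :=
  exists c : R -> M, [/\ c 0 = x, (forall t, S (c t)) & is_velocity c v].

Definition tangent_tuple q (S : set ('I_q -> M)) (x v : 'I_q -> M) : Prop :=
  exists c : R -> 'I_q -> M,
    [/\ c 0 = x, (forall t, S (c t)) &
        forall l, is_velocity (fun t => c t l) (v l)].

Definition lie G : set M := tangent G 1%:M.

(* Real differentiability class C^k: for K = R[i] the directions v and i v are
   independent, and no holomorphy is required. *)
Fixpoint Ck (k : nat) (F : M -> M) : Prop :=
  continuous F /\
  if k is k'.+1 then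
    forall v, exists DF : M -> M,
      (forall x, is_velocity (fun t => F (x + iota t *: v)) (DF x)) /\ Ck k' DF
  else True.

(* On a closed submanifold, smooth maps are the restrictions of smooth maps
   defined on the whole ambient space. *)
Definition smooth_on S (F : M -> M) : Prop :=
  exists E : M -> M, (forall k, Ck k E) /\ (forall x, S x -> E x = F x).

Definition coset g H : set M := [set g *m h | h in H].

Definition quot G H : set (set M) := [set coset g H | g in G].

Definition quot_open G H (U : set (set M)) : Prop :=
  exists2 O : set M, open O & forall g, G g -> (U (coset g H) <-> O g).

(* Smooth embedding of G / H in the q-tuples of matrices (values outside
   [quot G H] are irrelevant); a product of orbits being a closed submanifold
   of the tuples, an embedding with values in it is the same thing.  The
   projection G -> G / H is a smooth
   submersion and T_(gH) (G / H) = T_g G / T_g (gH), so that smoothness and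
   injectivity of the differential are expressed on G; the last clause says
   that the quotient topology is the one induced by phi. *)
Definition embedding G H q (phi : set M -> 'I_q -> M) : Prop :=
  [/\ set_inj (quot G H) phi,
      forall l, smooth_on G (fun g => phi (coset g H) l),
      forall (c : R -> M) v, (forall t, G (c t)) -> is_velocity c v ->
        (forall l, is_velocity (fun t => phi (coset (c t) H) l) 0) ->
        tangent (coset (c 0) H) (c 0) v
    & forall U : set (set M), U `<=` quot G H ->
        (quot_open G H U <->
         exists2 O : set {ptws 'I_q -> M}, open O &
           forall C, quot G H C -> (U C <-> O (phi C)))].

Definition orbit G x : set M := [set g *m x *m invmx g | g in G].

(* G / H is identified with the orbit of x as a homogeneous manifold. *)
Definition quot_is_orbit G H x : Prop :=
  exists psi : set M -> M,
    [/\ embedding G H (fun C (_ : 'I_1) => psi C),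
        psi @` quot G H = orbit G x
      & forall g C, G g -> quot G H C ->
          psi [set g *m y | y in C] = g *m psi C *m invmx g].

Definition orbit_prod G q (L : 'I_q -> M) : set ('I_q -> M) :=
  [set x | forall l, orbit G (L l) (x l)].

Definition commutator (X Y : M) : M := X *m Y - Y *m X.

Definition generates G xi x v : Prop := lie G xi /\ v = commutator xi x.

(* Points x of an orbit may be given up to a fixed scalar a, the corresponding
   Lie algebra element being a *: x. *)
Variable a : K.

Definition moment q (x : 'I_q -> M) : M := \sum_l a *: x l.

Definition kks x xi zeta : K := \tr ((a *: x) *m commutator xi zeta).

(* The form on a product of orbits is the sum of the forms of the factors;
   xi l and zeta l are any elements of the Lie algebra that represent the l-th
   components of the tangent vectors v and w. *)
Definition isotropic G q (S : set ('I_q -> M)) : Prop :=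
  forall x v w xi zeta : 'I_q -> M, S x ->
    tangent_tuple S x v -> tangent_tuple S x w ->
    (forall l, generates G (xi l) (x l) (v l)) ->
    (forall l, generates G (zeta l) (x l) (w l)) ->
    \sum_l kks (x l) (xi l) (zeta l) = 0.

End Geometry.

Definition J2 {K : pzRingType} : 'M[K]_2 :=
  \matrix_(i, j) ((i < j)%N%:R - (j < i)%N%:R).

Definition sigma3 {K : pzRingType} : 'M[K]_2 :=
  \matrix_(i, j) ((-1) ^+ i *+ (i == j)).

Section Groups.
Variable R : realType.

Definition SO p : set 'M[R]_p := [set g | g *m g^T = 1%:M /\ \det g = 1].

Definition Sp n : set 'M[R[i]]_(n * 2) :=
  [set g | g \is unitarymx /\
           g^T *m ((1%:M : 'M[R[i]]_n) *t J2) *m g = (1%:M : 'M[R[i]]_n) *t J2].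

(* U(k) in SO(2k), i acting as 1 (x) J2. *)
Definition U_SO k (u : 'M[R[i]]_k) : 'M[R]_(k * 2) :=
  map_mx (@complex.Re R) u *t (1%:M : 'M[R]_2) + map_mx (@complex.Im R) u *t J2.

(* U(k) in Sp(k), as the sum of the standard representation (first vector of
   each pair) and of its conjugate (second vector). *)
Definition U_Sp k (u : 'M[R[i]]_k) : 'M[R[i]]_(k * 2) :=
  u *t delta_mx 0 0 + map_mx Num.conj u *t delta_mx 1 1.

(* U(n_1) x ... x U(n_r) x SO(2 n_0 + 1) in SO(2n + 1), n_0 = n - sum n_s;
   e only adjusts the size, and holds whenever sum n_s <= n. *)
Definition SO_sub n r (ns : 'I_r -> nat) : set 'M[R]_(n * 2 + 1) :=
  let n0 := (n - \sum_s ns s)%N in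
  [set g | exists (e : (\sum_s ns s * 2 + (n0 * 2 + 1) = n * 2 + 1)%N)
                  (u : forall s, 'M[R[i]]_(ns s)) (A : 'M[R]_(n0 * 2 + 1)),
     [/\ forall s, u s \is unitarymx, @SO _ A &
         g = castmx (e, e) (block_mx (\mxdiag_s U_SO (u s)) 0 0 A)]].

Definition Sp_sub n r (ns : 'I_r -> nat) : set 'M[R[i]]_(n * 2) :=
  let n0 := (n - \sum_s ns s)%N in
  [set g | exists (e : (\sum_s ns s * 2 + n0 * 2 = n * 2)%N)
                  (u : forall s, 'M[R[i]]_(ns s)) (A : 'M[R[i]]_(n0 * 2)),
     [/\ forall s, u s \is unitarymx, @Sp n0 A &
         g = castmx (e, e) (block_mx (\mxdiag_s U_Sp (u s)) 0 0 A)]].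

End Groups.

(* OGr'_k = SO(2n+1) / OGr_stab R n k and SGr_k = Sp(n) / SGr_stab R n k. *)
Definition OGr_stab (R : realType) n k := @SO_sub R n 1 (fun _ => k).
Definition SGr_stab (R : realType) n k := @Sp_sub R n 1 (fun _ => k).

(* The index l < r + 1 stands for l + 1 in 1, ..., r + 1, and s < r for s + 1
   in 1, ..., r.  Thus dim_sum ns l is d_(l+1) for l < r and m for l = r. *)
Definition dim_sum r (ns : 'I_r -> nat) (l : 'I_r.+1) : nat :=
  (\sum_(s < r | (s <= l)%N) ns s)%N.

(* Coordinate k (counted from 0) is in the block of size n_(s+1) when
   d_s <= k < d_(s+1).  For l = r the truncated exponent r - (r + 1) is 0, and
   no block s < r satisfies s = l. *)
Definition Upsilon (K : pzRingType) n r (ns : 'I_r -> nat) (l : 'I_r.+1) :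
    'M[K]_n :=
  2 ^+ (r - l.+1) *:
  diag_mx (\row_(k < n)
    \sum_(s < r | (\sum_(t < r | (t < s)%N) ns t <= k
                     < \sum_(t < r | (t <= s)%N) ns t)%N)
      (if (s < l)%N then -1 else if s == l :> nat then 1 else 0)).

Definition Lambda_SO (R : realType) n r (ns : 'I_r -> nat) (l : 'I_r.+1) :
    'M[R]_(n * 2 + 1) :=
  block_mx (Upsilon R n ns l *t J2) 0 0 0.

Definition Lambda_Sp (R : realType) n r (ns : 'I_r -> nat) (l : 'I_r.+1) :
    'M[R[i]]_(n * 2) :=
  Upsilon _ n ns l *t sigma3.

(* Main.v *)
Require Import Defs.
From HB Require Import structures.
From mathcomp Require Import all_boot all_order all_algebra.
From mathcomp Require Import spectral.
From mathcomp Require Import complex mxtens ring zify.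
From mathcomp Require Import all_classical all_reals all_analysis.

Set Implicit Arguments.
Unset Strict Implicit.
Unset Printing Implicit Defensive.
Import Order.TTheory GRing.Theory Num.Theory.
Import numFieldNormedType.Exports.
Local Open Scope classical_set_scope.
Local Open Scope ring_scope.
Local Open Scope complex_scope.

(** Write X_l = a x_l for the Lie algebra elements of a point x of the product of
    orbits, where a = 1 for SO(2n+1) and a = i for Sp(n), and count l from 1 to
    r+1 with c_l = 2^(r-l) for l <= r and c_(r+1) = 1.  Then Y_l = X_l / c_l is a
    partial complex structure, that is, it is skew-adjoint and Y_l^3 = - Y_l.  At
    the base point Lambda one has Y_l = J_l - (J_1 + ... + J_(l-1)) for l <= r and
    Y_(r+1) = - (J_1 + ... + J_r), where J_s is the complex structure of the s-th
    block.  As c_s is the sum of the c_l with l > s, the X_l sum to 0.  The J_s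
    and the X_l are linear combinations of one another, so that the stabilizer of
    Lambda is the commutant of the J_s, which is the block diagonal subgroup H:
    the embedding is gH |-> g Lambda g^-1.

    It is an embedding ([orbit_map_embedding]).  Smoothness holds because
    g Lambda g^-1 is a polynomial in g and its adjoint.  A direction killed by the
    differential is g X with X in the Lie algebra commuting with Lambda, and the
    Cayley transform of t X / 2 is a curve in H with velocity X.  The topology is
    the induced one since a continuous map from a compact group is closed.

    Its image is the zero level ([level_set_conj]).  Let the X_l sum to 0.  For v
    in the image of J_1 = Y_1, the vector c_1 Y_1 v is minus the sum of the c_l Y_l v
    with l > 1, each Y_l v has norm at most that of v, and the weights c_l add up to
    c_1; by strict convexity Y_l v = - Y_1 v for every l > 1.  So Y_1 splits off,
    and by induction on l the point has the form above for some orthogonal partial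
    complex structures J_s ([flag_form]).  After conjugation of x_(r+1) to its
    base point, the sum of the J_s is the standard complex structure, hence the J_s
    correspond to orthogonal Hermitian projections of C^n, whose ranks are given by
    the traces of the Y_l^2.  Orthonormal bases of their images form a unitary
    matrix that conjugates all of them to the standard ones ([structures_conj]).

    The image is isotropic ([conj_orbit_isotropic]).  If D_s is the velocity of J_s
    along a curve in the image, Kato's formula gives one matrix Q with
    [Q, J_s] = D_s for all s ([kato]), hence [Q, X_l] is the velocity of X_l for
    all l.  By invariance of the trace the form at two tangent vectors is then the
    trace of Q times the velocity of the sum of the X_l, which is 0.

    Each factor is the orbit of a multiple of a single partial complex structure:
    changing the orientation of the first blocks, which an element of the group
    does, turns the signs of Lambda_l into equal ones ([model_quot_is_orbit]).

    The two groups are treated together.  Both sit in a real *-algebra of matrices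
    ([compact_form]) that contains M_n(C), embedded as u |-> Re u (x) 1 + Im u (x) J
    or as the sum of u and its conjugate ([unitary_model]), and base points are
    images of i times real diagonal matrices. *)

(** * Limits of matrices *)

Section MatrixLimits.
Variable K : numFieldType.

Lemma cvg_mx T (F : set_system T) (FF : Filter F) m n (f : T -> 'M[K]_(m, n)) (A : 'M[K]_(m, n)) :
  (forall i j, (fun x => f x i j) @ F --> A i j) -> f @ F --> A.
Proof.
move=> fA; apply/cvg_mx_entourageP => E entE.
rewrite near_map /=.
have: \forall x \near F, forall ij : 'I_m * 'I_n, (A ij.1 ij.2, f x ij.1 ij.2) \in E.
  apply: (@filter_forall _ _ (fun ij x => (A ij.1 ij.2, f x ij.1 ij.2) \in E)) => -[i j] /=.
  have /cvg_entourageP /(_ _ entE) := fA i j; rewrite near_map => h.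
  by apply: filterS h => x; rewrite inE.
move=> h; apply: filterS h => x h i j; exact: (h (i, j)).
Qed.

Lemma cvg_coord T (F : set_system T) (FF : Filter F) m n (f : T -> 'M[K]_(m, n)) (A : 'M[K]_(m, n)) i j :
  f @ F --> A -> (fun x => f x i j) @ F --> A i j.
Proof.
move=> fA.
apply: (@continuous_cvg _ _ _ F FF f (fun M : 'M[K]_(m, n) => M i j) A _ fA).
exact: coord_continuous.
Qed.

Lemma cvg_mulmx T (F : set_system T) (FF : Filter F) m n p
    (f : T -> 'M[K]_(m, n)) (g : T -> 'M[K]_(n, p)) (A : 'M[K]_(m, n)) (B : 'M[K]_(n, p)) :
  f @ F --> A -> g @ F --> B -> (fun x => f x *m g x) @ F --> A *m B.
Proof.
move=> fA gB; apply: cvg_mx => i j.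
rewrite mxE; under eq_cvg do rewrite mxE.
by apply: cvg_big => [|k _]; [exact: add_continuous|apply: cvgM; exact: cvg_coord].
Qed.

Lemma cvg_trmx_map T (F : set_system T) (FF : Filter F) m n (c : K -> K)
    (f : T -> 'M[K]_(m, n)) (A : 'M[K]_(m, n)) :
  continuous c -> f @ F --> A -> (fun x => (map_mx c (f x))^T) @ F --> (map_mx c A)^T.
Proof.
move=> cc fA; apply: cvg_mx => i j.
rewrite !mxE; under eq_cvg do rewrite !mxE.
by apply: continuous_cvg; [exact: cc|exact: cvg_coord].
Qed.

Lemma cvg_det T (F : set_system T) (FF : Filter F) n (f : T -> 'M[K]_n) (A : 'M[K]_n) :
  f @ F --> A -> (fun x => \det (f x)) @ F --> \det A.
Proof.
move=> fA; rewrite /determinant.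
apply: cvg_big => [|s _]; first exact: add_continuous.
apply: cvgM; first exact: cvg_cst.
apply: cvg_big => [|i _]; first exact: mul_continuous.
exact: cvg_coord.
Qed.

Lemma cvg_invmx T (F : set_system T) (FF : Filter F) n (f : T -> 'M[K]_n) (A : 'M[K]_n) :
  A \in unitmx -> (forall x, f x \in unitmx) ->
  f @ F --> A -> (fun x => invmx (f x)) @ F --> invmx A.
Proof.
move=> uA uf fA; rewrite /invmx uA; under eq_cvg do rewrite uf.
apply: cvgZ.
  apply: cvgV; last exact: cvg_det.
  by move: uA; rewrite unitmxE unitfE.
apply: cvg_mx => i j; rewrite !mxE; under eq_cvg do rewrite !mxE /cofactor.
apply: cvgM; first exact: cvg_cst.
apply: cvg_det; apply: cvg_mx => k l; rewrite !mxE.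
under eq_cvg do rewrite !mxE; exact: cvg_coord.
Qed.

End MatrixLimits.

(** * Velocities *)

Section Velocities.
Variables (R : realType) (K : numFieldType) (iota : {rmorphism R -> K}).
Hypothesis iota_cont : continuous iota.
Variable p : nat.
Local Notation M := 'M[K]_p.
Local Notation is_velocity := (@is_velocity R K iota p).
Implicit Types (c d : R -> M) (v w : M).

Lemma iota_cvg0 : iota @ (0 : R)^' --> (0 : K).
Proof.
by apply: cvg_trans (_ : iota @ (0 : R) --> _); [apply: cvg_app; exact: cvg_within
  |rewrite -[X in _ --> X](rmorph0 iota); exact: iota_cont].
Qed.

Lemma velocity_cvg c v : is_velocity c v -> c @ (0 : R)^' --> c 0.
Proof.
move=> cv.
have h : (fun t => c 0 + iota t *: ((iota t)^-1 *: (c t - c 0))) @ (0 : R)^' --> c 0.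
  have -> : nbhs (c 0) = nbhs (c 0 + 0 *: v) by rewrite scale0r addr0.
  by apply: cvgD; [exact: cvg_cst|apply: cvgZ => //; exact: iota_cvg0].
apply: cvg_trans h; apply: near_eq_cvg; near=> t.
have t0 : iota t != 0 by rewrite fmorph_eq0; near: t; exact: nbhs_dnbhs_neq.
by rewrite scalerA divff // scale1r addrC subrK.
Unshelve. all: by end_near. Qed.

Lemma velocity_unique c v w : is_velocity c v -> is_velocity c w -> v = w.
Proof. by move=> cv cw; apply: cvg_unique cv cw; exact: norm_hausdorff. Qed.

Lemma velocity_cst (A : M) : is_velocity (fun=> A) 0.
Proof.
by rewrite /Defs.is_velocity; under eq_cvg do rewrite subrr scaler0; exact: cvg_cst.
Qed.

Lemma velocityD c d v w : is_velocity c v -> is_velocity d w ->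
  is_velocity (fun t => c t + d t) (v + w).
Proof.
move=> cv dw; rewrite /Defs.is_velocity.
by under eq_cvg do rewrite opprD addrACA scalerDr; exact: cvgD.
Qed.

Lemma velocityZ c v a : is_velocity c v -> is_velocity (fun t => a *: c t) (a *: v).
Proof.
move=> cv; rewrite /Defs.is_velocity.
under eq_cvg do rewrite -scalerBr scalerA mulrC -scalerA.
by apply: cvgZ => //; exact: cvg_cst.
Qed.

Lemma velocityN c v : is_velocity c v -> is_velocity (fun t => - c t) (- v).
Proof.
move=> cv; have := @velocityZ c v (-1) cv; rewrite scaleN1r.
by under eq_fun do rewrite scaleN1r.
Qed.

Lemma velocity_sum I (r : seq I) (P : pred I) (c : I -> R -> M) (v : I -> M) :
  (forall i, P i -> is_velocity (c i) (v i)) ->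
  is_velocity (fun t => \sum_(i <- r | P i) c i t) (\sum_(i <- r | P i) v i).
Proof.
move=> cv; elim: r => [|i r IH].
  by under eq_fun do rewrite big_nil; rewrite big_nil; exact: velocity_cst.
under eq_fun do rewrite big_cons; rewrite big_cons.
by case: ifP => // Pi; apply: velocityD => //; exact: cv.
Qed.

Lemma velocityM c d v w : is_velocity c v -> is_velocity d w ->
  is_velocity (fun t => c t *m d t) (v *m d 0 + c 0 *m w).
Proof.
move=> cv dw; rewrite /Defs.is_velocity.
have E t : (iota t)^-1 *: (c t *m d t - c 0 *m d 0) =
    ((iota t)^-1 *: (c t - c 0)) *m d t + c 0 *m ((iota t)^-1 *: (d t - d 0)).
  by rewrite -scalemxAl -scalemxAr mulmxBl mulmxBr -scalerDr addrA subrK.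
under eq_cvg do rewrite E; apply: cvgD; apply: cvg_mulmx => //.
  exact: velocity_cvg dw.
exact: cvg_cst.
Qed.

Lemma velocityMl (A : M) d w : is_velocity d w -> is_velocity (fun t => A *m d t) (A *m w).
Proof. by move=> dw; have := @velocityM _ _ _ _ (velocity_cst A) dw; rewrite mul0mx add0r. Qed.

Lemma velocityMr (A : M) c v : is_velocity c v -> is_velocity (fun t => c t *m A) (v *m A).
Proof. by move=> cv; have := @velocityM _ _ _ _ cv (velocity_cst A); rewrite mulmx0 addr0. Qed.

Lemma velocity_line (A v : M) : is_velocity (fun t => A + iota t *: v) v.
Proof.
apply: cvg_trans (_ : (fun=> v) @ (0 : R)^' --> v); last exact: cvg_cst.
apply: near_eq_cvg; near=> t.
have t0 : iota t != 0 by rewrite fmorph_eq0; near: t; exact: nbhs_dnbhs_neq.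
by rewrite rmorph0 scale0r addr0 addrC addKr scalerA mulVf // scale1r.
Unshelve. all: by end_near. Qed.

(** A closed real subspace contains the velocities of its curves. *)
Lemma velocity_closed (S : set M) c v : closed S ->
  (forall t A B, S A -> S B -> S (iota t *: (A - B))) ->
  (forall t, S (c t)) -> is_velocity c v -> S v.
Proof.
move=> clS Slin Sc cv.
have h : \forall t \near (0 : R)^', S ((iota t)^-1 *: (c t - c 0)).
  by apply: nearW => t; rewrite -fmorphV; exact: Slin.
exact: (closed_cvg _ clS h _ cv).
Qed.

End Velocities.

(** * Scalars with an involution and the adjoint *)

(** The inclusion of R in K, for K = R with the identity or K = R[i] with the
    conjugation; [cj_disk] says that the unit disk is relatively compact. *)
Record scalars (R : realType) (K : numFieldType) := Scalars {
  inc :> {rmorphism R -> K};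
  cj : {rmorphism K -> K};
  inc_continuous : continuous inc;
  cj_continuous : continuous cj;
  cjK : involutive cj;
  cj_inc : forall t, cj (inc t) = inc t;
  cj_ge0 : forall z, 0 <= z * cj z;
  cj_disk : exists2 D : set K, compact D & forall z, z * cj z <= 1 -> D z }.

Section Star.
Variables (R : realType) (K : numFieldType) (S : scalars R K).

Definition star m n (A : 'M[K]_(m, n)) : 'M[K]_(n, m) := (map_mx (cj S) A)^T.

Lemma starK m n (A : 'M[K]_(m, n)) : star (star A) = A.
Proof. by rewrite /star map_trmx trmxK -map_mx_comp; apply/matrixP => i j; rewrite mxE /= cjK. Qed.

Lemma starM m n p (A : 'M[K]_(m, n)) (B : 'M[K]_(n, p)) :
  star (A *m B) = star B *m star A.
Proof. by rewrite /star map_mxM trmx_mul. Qed.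

Lemma starD m n (A B : 'M[K]_(m, n)) : star (A + B) = star A + star B.
Proof. by rewrite /star map_mxD linearD. Qed.

Lemma starN m n (A : 'M[K]_(m, n)) : star (- A) = - star A.
Proof. by rewrite /star map_mxN linearN. Qed.

Lemma starB m n (A B : 'M[K]_(m, n)) : star (A - B) = star A - star B.
Proof. by rewrite starD starN. Qed.

Lemma starZ m n a (A : 'M[K]_(m, n)) : star (a *: A) = cj S a *: star A.
Proof. by rewrite /star map_mxZ linearZ. Qed.

Lemma starZr m n t (A : 'M[K]_(m, n)) : star (S t *: A) = S t *: star A.
Proof. by rewrite starZ cj_inc. Qed.

Lemma star0 m n : star (0 : 'M[K]_(m, n)) = 0.
Proof. by rewrite /star map_mx0 trmx0. Qed.

Lemma star1 n : star (1%:M : 'M[K]_n) = 1%:M.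
Proof. by rewrite /star map_mx1 trmx1. Qed.

Lemma star_sum I (r : seq I) (P : pred I) m n (A : I -> 'M[K]_(m, n)) :
  star (\sum_(i <- r | P i) A i) = \sum_(i <- r | P i) star (A i).
Proof. by rewrite /star map_mx_sum linear_sum. Qed.

(** The square of the Frobenius norm. *)
Definition frob m n (A : 'M[K]_(m, n)) : K := \tr (A *m star A).

Lemma frobE m n (A : 'M[K]_(m, n)) :
  frob A = \sum_i \sum_j A i j * cj S (A i j).
Proof. by apply: eq_bigr => i _; rewrite mxE; apply: eq_bigr => j _; rewrite !mxE. Qed.

Lemma frob_ge0 m n (A : 'M[K]_(m, n)) : 0 <= frob A.
Proof. by rewrite frobE; apply: sumr_ge0 => i _; apply: sumr_ge0 => j _; exact: cj_ge0. Qed.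

Lemma frob_eq0 m n (A : 'M[K]_(m, n)) : frob A = 0 -> A = 0.
Proof.
rewrite frobE => /eqP; rewrite psumr_eq0; last first.
  by move=> i _; apply: sumr_ge0 => j _; exact: cj_ge0.
move=> /allP A0; apply/matrixP => i j; rewrite mxE.
have := A0 i (mem_index_enum i); rewrite psumr_eq0; last by move=> ? _; exact: cj_ge0.
move=> /allP /(_ j (mem_index_enum j)); rewrite /= mulf_eq0 fmorph_eq0 orbb.
by move=> /eqP.
Qed.

(** No nonzero vector is fixed by a skew matrix, whose spectrum is imaginary. *)
Lemma unitmx1B_skew n (X : 'M[K]_n) : star X = - X -> 1%:M - X \in unitmx.
Proof.
move=> skX; rewrite -row_free_unit -kermx_eq0; apply/eqP; set A := kermx _.
have AX : A = A *m X.
  by apply/eqP; rewrite -subr_eq0 -[X in X - _]mulmx1 -mulmxBr mulmx_ker.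
have frobN : A *m star A = - (A *m star A).
  have E : star (A *m X) = - (X *m star A) by rewrite starM skX mulNmx.
  by rewrite {1}AX -mulmxA -[X *m _]opprK -E mulmxN -AX.
apply: frob_eq0; rewrite /frob.
have : \tr (A *m star A) = - \tr (A *m star A) by rewrite -linearN -frobN.
by move/eqP; rewrite -addr_eq0 -mulr2n mulrn_eq0 => /eqP.
Qed.

Lemma cvg_star T (FF : set_system T) (FFF : Filter FF) m n
    (f : T -> 'M[K]_(m, n)) (A : 'M[K]_(m, n)) :
  f @ FF --> A -> (fun x => star (f x)) @ FF --> star A.
Proof. by apply: cvg_trmx_map; exact: cj_continuous. Qed.

Lemma velocity_star p (c : R -> 'M[K]_p) v : is_velocity S c v ->
  is_velocity S (fun t => star (c t)) (star v).
Proof.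
move=> cv; rewrite /is_velocity.
have E t : (S t)^-1 *: (star (c t) - star (c 0)) = star ((S t)^-1 *: (c t - c 0)).
  by rewrite -fmorphV starZr starB.
by under eq_cvg do rewrite E; exact: cvg_star.
Qed.

End Star.

(** * Compact groups of unitary matrices *)

(** The Lie algebra of [grp] is the skew-adjoint part of the real algebra [alg];
    the Cayley transform [grp_cayley] stands for the exponential map, as it is
    rational and commutes with whatever commutes with its argument. *)
Record compact_form (R : realType) (K : numFieldType) (S : scalars R K) (p : nat) :=
  CompactForm {
  alg : set 'M[K]_p;
  grp : set 'M[K]_p;
  alg1 : alg 1%:M;
  algD : forall A B, alg A -> alg B -> alg (A + B);
  algM : forall A B, alg A -> alg B -> alg (A *m B);
  algZ : forall t A, alg A -> alg (S t *: A);
  alg_star : forall A, alg A -> alg (star S A);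
  alg_closed : closed alg;
  grp_alg : forall g, grp g -> alg g;
  grp_unitary : forall g, grp g -> g *m star S g = 1%:M;
  grp1 : grp 1%:M;
  grpM : forall g h, grp g -> grp h -> grp (g *m h);
  grp_star : forall g, grp g -> grp (star S g);
  grp_closed : closed grp;
  grp_cayley : forall X, alg X -> star S X = - X ->
    grp ((1%:M + X) *m invmx (1%:M - X)) }.

Section Embedding.
Variables (R : realType) (K : numFieldType) (S : scalars R K) (p : nat).
Variable F : compact_form S p.
Local Notation M := 'M[K]_p.
Local Notation G := (grp F).
Local Notation star := (star S).
Local Notation is_velocity := (@is_velocity R K S p).

Lemma grp_unitaryV g : G g -> star g *m g = 1%:M.
Proof. by move=> /grp_unitary /mulmx1C. Qed.

Lemma grp_invmx g : G g -> invmx g = star g.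
Proof.
move=> Gg; have [_ ug] := mulmx1_unit (grp_unitaryV Gg).
by rewrite -[RHS]mulmx1 -(mulmxV ug) mulmxA grp_unitaryV // mul1mx.
Qed.

(** The rows of a unitary matrix have norm 1, so its entries lie in the unit disk. *)
Lemma grp_compact : compact G.
Proof.
have [D cD DP] := cj_disk S.
pose T := prod_topology (fun _ : 'I_p * 'I_p => (K : topologicalType)).
have cT : compact [set f : T | forall ij, D (f ij)].
  exact: (@tychonoff ('I_p * 'I_p)%type (fun=> K) (fun=> D) (fun=> cD)).
pose mk (f : T) : M := \matrix_(i, j) f (i, j).
have mk_cont : continuous mk.
  move=> f; apply: (@cvg_mx K T (nbhs f) _ p p mk (mk f)) => i j.
  rewrite mxE; under eq_cvg do rewrite mxE.
  exact: (@proj_continuous _ (fun=> (K : topologicalType)) (i, j) f).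
have cmk := continuous_compact (continuous_subspaceT mk_cont) cT.
apply: (subclosed_compact (@grp_closed _ _ _ _ F) cmk).
move=> g Gg; exists (fun ij => g ij.1 ij.2); last by apply/matrixP => i j; rewrite mxE.
move=> [i j] /=; apply: DP.
have := grp_unitary Gg => /matrixP /(_ i i); rewrite !mxE eqxx mulr1n => <-.
rewrite (bigD1 j) //= !mxE lerDl; apply: sumr_ge0 => k _; rewrite !mxE; exact: cj_ge0.
Qed.

(** Differentiate g g^-1 = 1, where the inverse is the adjoint. *)
Lemma lie_alg X : lie S G X -> alg F X /\ star X = - X.
Proof.
move=> [c [c0 Gc cX]]; split.
  apply: (velocity_closed (@alg_closed _ _ _ _ F)) cX.
    move=> t A B FA FB; apply: algZ; apply: algD => //.
    have -> : - B = S (-1) *: B by rewrite rmorphN1 scaleN1r.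
    exact: algZ.
  by move=> t; apply: grp_alg.
have := velocityM (@inc_continuous _ _ S) cX (velocity_star cX).
rewrite c0 star1 mulmx1 mul1mx => vs.
have h0 : is_velocity (fun t => c t *m star (c t)) 0.
  under eq_fun do rewrite (grp_unitary (Gc _)); exact: velocity_cst.
by have /eqP := velocity_unique vs h0; rewrite addrC addr_eq0 => /eqP.
Qed.

End Embedding.

(** * The orbit map *)

Section OrbitMap.
Variables (R : realType) (K : numFieldType) (S : scalars R K) (p : nat).
Variable F : compact_form S p.
Local Notation M := 'M[K]_p.
Local Notation G := (grp F).
Local Notation star := (star S).
Local Notation is_velocity := (@is_velocity R K S p).
Local Notation icont := (@inc_continuous _ _ S).
Variables (q : nat) (x0 : 'I_q -> M).

Definition stab : set M := [set g | G g /\ forall l, g *m x0 l = x0 l *m g].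

(** The representative picked by [get] does not matter: x0 is fixed by [stab]. *)
Definition orbit_map (C : set M) : 'I_q -> M :=
  fun l => get C *m x0 l *m star (get C).

Let act (g : M) : 'I_q -> M := fun l => g *m x0 l *m star g.

Lemma stab1 : stab 1%:M.
Proof. by split=> [|l]; [exact: grp1|rewrite mul1mx mulmx1]. Qed.

Lemma mem_coset g : coset g stab g.
Proof. by exists 1%:M; [exact: stab1|rewrite mulmx1]. Qed.

Lemma act_coset g g' : G g -> coset g stab g' -> act g' = act g.
Proof.
move=> Gg [h [Gh hx] <-]; apply: funext => l; rewrite /act starM.
by rewrite -(mulmxA g) hx !mulmxA -(mulmxA _ h) (grp_unitary Gh) mulmx1.
Qed.

Lemma orbit_map_coset g l : G g ->
  orbit_map (coset g stab) l = g *m x0 l *m star g.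
Proof.
move=> Gg; have := @getPex _ (coset g stab) (ex_intro _ g (mem_coset g)).
by move=> /(act_coset Gg) /(congr1 (fun f => f l)).
Qed.

Lemma orbit_map_cosetE g : G g -> orbit_map (coset g stab) = act g.
Proof. by move=> Gg; apply: funext => l; exact: orbit_map_coset. Qed.

Lemma coset_act g g' : G g -> G g' -> act g = act g' -> coset g stab = coset g' stab.
Proof.
suff sub a b : G a -> G b -> act a = act b -> coset a stab `<=` coset b stab.
  by move=> Gg Gg' E; apply/seteqP; split; apply: sub.
move=> Ga Gb E _ [h [Gh hx] <-]; exists (star b *m a *m h); last first.
  by rewrite !mulmxA (grp_unitary Gb) mul1mx.
split=> [|l]; first by apply: grpM => //; apply: grpM => //; exact: grp_star.
have /(congr1 (fun f => star b *m f l *m a)) := E.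
rewrite /act !mulmxA -(mulmxA _ (star a) a) (grp_unitaryV Ga) (grp_unitaryV Gb) mulmx1 mul1mx => e.
by rewrite -(mulmxA _ h) hx (mulmxA _ (x0 l) h) e.
Qed.

Lemma cvg_act T (FF : set_system T) (FFF : Filter FF) (f : T -> M) (A : M) l :
  f @ FF --> A -> (fun x => act (f x) l) @ FF --> act A l.
Proof.
move=> fA; apply: cvg_mulmx; last exact: cvg_star.
by apply: cvg_mulmx => //; exact: cvg_cst.
Qed.

Lemma act_continuous l : continuous (fun g : M => act g l).
Proof. by move=> g; apply: (@cvg_act M (nbhs g) _ id g l); exact: cvg_id. Qed.

(** The map is quadratic in the real coordinates of g, so that its third derivatives
    vanish. *)
Lemma act_smooth l : forall k, Ck S k (fun g : M => act g l).
Proof.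
have cstC k (A : M) : Ck S k (fun=> A).
  have cont (B : M) : continuous (fun _ : M => B) by exact: cst_continuous.
  elim: k A => [|k IH] A; first by split.
  split=> // v; exists (fun=> 0); split; first by move=> ?; exact: velocity_cst.
  exact: IH.
have linC k (a v : M) :
    Ck S k (fun g : M => v *m a *m star g + g *m a *m star v).
  have cont : continuous (fun g : M => v *m a *m star g + g *m a *m star v).
    suff h T (FF : set_system T) (FFF : Filter FF) (f : T -> M) (A : M) :
        f @ FF --> A -> (fun x => v *m a *m star (f x) + f x *m a *m star v) @ FF -->
          v *m a *m star A + A *m a *m star v.
      by move=> g; apply: (h M (nbhs g) _ id g); exact: cvg_id.
    move=> fA; apply: cvgD; apply: cvg_mulmx; try exact: cvg_cst.
      exact: cvg_star.
    by apply: cvg_mulmx => //; exact: cvg_cst.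
  case: k => [|k]; split=> // w.
  exists (fun=> v *m a *m star w + w *m a *m star v); split=> // g.
  have lw := @velocity_line R K S p g w.
  exact: (velocityD (velocityMl icont (velocity_star lw))
    (velocityMr icont (velocityMr icont lw))).
case=> [|k]; split=> //; try exact: act_continuous.
move=> v; exists (fun g => v *m x0 l *m star g + g *m x0 l *m star v); split=> // g.
have lv := @velocity_line R K S p g v.
have := velocityM icont (velocityMr (A := x0 l) icont lv) (velocity_star lv).
by rewrite !rmorph0 !scale0r !addr0.
Qed.

(** The Cayley transform t |-> (1 + t X / 2) (1 - t X / 2)^-1 is a curve in the
    group with velocity X, and it commutes with all that commutes with X. *)
Lemma stab_tangent g X : G g -> alg F X -> star X = - X ->
  (forall l, X *m x0 l = x0 l *m X) -> tangent S (coset g stab) g (g *m X).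
Proof.
move=> Gg FX sX Xx.
pose Y t : M := S t *: (S 2^-1 *: X).
have FY t : alg F (Y t) by do 2 apply: algZ.
have sY t : star (Y t) = - Y t by rewrite /Y !starZr sX !scalerN.
have uY t : 1%:M - Y t \in unitmx by exact: unitmx1B_skew (sY t).
have Y0 : Y 0 = 0 by rewrite /Y rmorph0 scale0r.
pose h t : M := (1%:M + Y t) *m invmx (1%:M - Y t).
have h0 : h 0 = 1%:M by rewrite /h Y0 subr0 addr0 mul1mx invmx1.
have h_stab t : stab (h t).
  split=> [|l]; first exact: grp_cayley.
  have Yx : Y t *m x0 l = x0 l *m Y t.
    by rewrite /Y -!scalemxAl -!scalemxAr Xx.
  have ix : invmx (1%:M - Y t) *m x0 l = x0 l *m invmx (1%:M - Y t).
    apply: (can_inj (mulKmx (uY t))); rewrite mulKVmx //.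
    have c1 : (1%:M - Y t) *m x0 l = x0 l *m (1%:M - Y t).
      by rewrite mulmxBl mulmxBr mul1mx mulmx1 Yx.
    by rewrite mulmxA c1 -mulmxA mulmxV // mulmx1.
  by rewrite /h -mulmxA ix !mulmxA mulmxDl mulmxDr mul1mx mulmx1 Yx.
exists (fun t => g *m h t); split; first by rewrite h0 mulmx1.
  by move=> t; exists (h t).
apply: (velocityMl icont); rewrite /Defs.is_velocity h0.
have h_lim : (fun t => X *m invmx (1%:M - Y t)) @ (0 : R)^' --> X.
  have -> : nbhs X = nbhs (X *m invmx (1%:M - Y 0)) by rewrite Y0 subr0 invmx1 mulmx1.
  apply: cvg_mulmx; first exact: cvg_cst.
  apply: cvg_invmx => //; apply: cvgB; first exact: cvg_cst.
  rewrite Y0; have -> : nbhs (0 : M) = nbhs (0 *: (S 2^-1 *: X)) by rewrite scale0r.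
  apply: cvgZ; last exact: cvg_cst.
  exact: iota_cvg0 (@inc_continuous _ _ S).
apply: cvg_trans h_lim; apply: near_eq_cvg; near=> t.
have t0 : S t != 0 by rewrite fmorph_eq0; near: t; exact: nbhs_dnbhs_neq.
have -> : h t - 1%:M = (Y t + Y t) *m invmx (1%:M - Y t).
  rewrite /h -[X in _ - X](mulmxV (uY t)) -mulmxBl; congr (_ *m _).
  by rewrite opprB addrC addrA subrK.
have -> : Y t + Y t = S t *: X.
  by rewrite -scalerDr -scalerDl -rmorphD -div1r -splitr rmorph1 scale1r.
by rewrite -scalemxAl scalerA mulVf // scale1r.
Unshelve. all: by end_near. Qed.

End OrbitMap.

Section EmbeddingTheorem.
Variables (R : realType) (K : numFieldType) (S : scalars R K) (p : nat).
Variable F : compact_form S p.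
Local Notation M := 'M[K]_p.
Local Notation G := (grp F).
Local Notation star := (star S).
Local Notation is_velocity := (@is_velocity R K S p).
Local Notation icont := (@inc_continuous _ _ S).
Variables (q : nat) (x0 : 'I_q -> M).
Local Notation H := (stab F x0).
Let act (g : M) : 'I_q -> M := fun l => g *m x0 l *m star g.

(** If the velocity of c(t) x0 c(t)^-1 is 0 then c(0)^-1 v commutes with x0, hence is
    tangent to the stabilizer. *)
Lemma orbit_map_immersion (c : R -> M) v : (forall t, G (c t)) -> is_velocity c v ->
  (forall l, is_velocity (fun t => orbit_map S x0 (coset (c t) H) l) 0) ->
  tangent S (coset (c 0) H) (c 0) v.
Proof.
move=> Gc cv cx; set g := c 0; have Gg : G g := Gc 0.
have [FX sX] : alg F (star g *m v) /\ star (star g *m v) = - (star g *m v).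
  apply: lie_alg; exists (fun t => star g *m c t); split.
  - exact: (grp_unitaryV Gg).
  - by move=> t; apply: grpM => //; exact: grp_star.
  - exact: (velocityMl icont).
have vE : v = g *m (star g *m v) by rewrite mulmxA (grp_unitary Gg) mul1mx.
rewrite vE; apply: stab_tangent => // l.
have := cx l; under eq_fun do rewrite orbit_map_coset //.
move=> /velocity_unique; have := velocityM icont
  (velocityMr (A := x0 l) icont cv) (velocity_star cv).
rewrite -/g => h /(_ _ h) /esym /(congr1 (fun A => star g *m A *m g)).
rewrite mulmx0 mul0mx mulmxDr mulmxDl !mulmxA -(mulmxA _ (star g) g) (grp_unitaryV Gg).
rewrite mulmx1 mul1mx -[X in _ + X]mulmxA => /eqP.
have -> : star v *m g = - (star g *m v) by rewrite -sX starM starK.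
by rewrite mulmxN subr_eq0 => /eqP ->; rewrite mulmxA.
Qed.

Lemma orbit_map_inj : set_inj (quot G H) (orbit_map S x0).
Proof.
move=> C D; rewrite !inE => -[g Gg <-] [g' Gg' <-].
by rewrite !orbit_map_cosetE // => /(coset_act Gg Gg').
Qed.

(** A continuous map from the compact group G to a Hausdorff space is closed. *)
Lemma orbit_map_topology (U : set (set M)) : U `<=` quot G H ->
  (quot_open G H U <-> exists2 O : set {ptws 'I_q -> M}, open O &
     forall C, quot G H C -> (U C <-> O (orbit_map S x0 C))).
Proof.
move=> UQ.
have act_cont : continuous (act : M -> {ptws 'I_q -> M}).
  move=> g; have FF : Filter (act @ nbhs g) by apply: fmap_filter.
  apply/cvg_sup => l A [B [[W oW <-] Wg] BA].
  apply: (filterS BA); apply: (@act_continuous R K S p q x0 l g).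
  exact: open_nbhs_nbhs.
split=> -[W oW WU].
  (* The image of the complement of W in G is compact, and U is its complement. *)
  pose A := [set g | G g /\ ~ W g].
  have cA : compact A.
    apply: (subclosed_compact _ (@grp_compact _ _ _ _ F)); last by move=> g [].
    apply: closedI; first exact: grp_closed.
    exact: open_closedC.
  exists (~` (act @` A)).
    apply: closed_openC; apply: compact_closed.
      apply: hausdorff_product => _; exact: norm_hausdorff.
    exact: (continuous_compact (continuous_subspaceT act_cont) cA).
  move=> C [g Gg <-]; rewrite orbit_map_cosetE //; split.
    move=> Ug [g' [Gg' nO] E]; apply: nO; apply/WU => //.
    by rewrite (coset_act Gg' Gg E).
  by move=> nA; apply/WU => //; apply: contrapT => nO; apply: nA; exists g.
exists (act @^-1` W); first exact: (open_comp (fun g _ => act_cont g)).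
by move=> g Gg; rewrite WU ?orbit_map_cosetE //; exists g.
Qed.

Theorem orbit_map_embedding : embedding S G H (orbit_map S x0).
Proof.
split.
- exact: orbit_map_inj.
- move=> l; exists (fun g => act g l); split; first exact: act_smooth.
  by move=> g Gg; rewrite orbit_map_coset.
- exact: orbit_map_immersion.
- exact: orbit_map_topology.
Qed.

End EmbeddingTheorem.

(** * Kato's formula *)

Lemma eq_from_diff (V : zmodType) (a b c d : V) : c = d -> a - b = c - d -> a = b.
Proof. by move=> ->; rewrite subrr => /eqP; rewrite subr_eq0 => /eqP. Qed.

Ltac mxabel :=
  repeat match goal with |- context [@mulmx ?R ?m ?n ?q ?A ?B] =>
    let x := fresh "x" in set x := @mulmx _ m n q A B; move: x => x end; apply/matrixP => ? ?; rewrite !mxE; field; done.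

Section Kato.
Variables (K : numFieldType) (p r : nat).
Local Notation M := 'M[K]_p.

(** For the algebra spanned by P0 and by J_s, P_s = - J_s^2, the element
    P0 (x) P0 + 1/2 sum_s (P_s (x) P_s - J_s (x) J_s) is a separability idempotent:
    its product is 1 and it commutes with the algebra.  Applying the derivation
    J_s |-> D_s to the left factors and multiplying gives Q.  This is Kato's formula
    sum_i E_i' E_i, for E_i the spectral projections, without complex scalars. *)
Lemma kato (J D : 'I_r -> M) :
  (forall s t, s != t -> J s *m J t = 0) ->
  (forall s, J s *m J s *m J s = - J s) ->
  (forall s t, s != t -> D s *m J t + J s *m D t = 0) ->
  (forall s, (D s *m J s + J s *m D s) *m J s + J s *m J s *m D s = - D s) ->
  exists Q : M, forall t, Defs.commutator Q (J t) = D t.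
Proof.
move=> J0 J3 D0 D3.
pose P s := - (J s *m J s); pose DP s := - (D s *m J s + J s *m D s).
pose P0 := 1%:M - \sum_s P s; pose DP0 := - \sum_s DP s.
have PJ s t : P s *m J t = if s == t then J t else 0.
  rewrite /P mulNmx; case: eqP => [->|/eqP st]; first by rewrite J3 opprK.
  by rewrite -mulmxA J0 // mulmx0 oppr0.
have JDP t s : J t *m DP s = (if s == t then D t else 0) - D t *m P s.
  rewrite /DP mulmxN; case: (eqVneq s t) => [->|st] /=.
    have h := D3 t; rewrite mulmxDl -!mulmxA in h; rewrite mulmxDr.
    by apply: (eq_from_diff (esym h)); rewrite /P mulmxN; mxabel.
  have := D0 t s; rewrite eq_sym => /(_ st) /eqP; rewrite addr_eq0 => /eqP h.
  by rewrite mulmxDr !mulmxA J0 1?eq_sym // mul0mx addr0 add0r /P mulmxN opprK mulmxA h mulNmx.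
have JD t s : J t *m D s = - (if s == t then DP t else 0) - D t *m J s.
  case: (eqVneq s t) => [->|st]; first by rewrite /DP opprK addrAC subrr add0r.
  have := D0 t s; rewrite eq_sym => /(_ st) /eqP; rewrite addrC addr_eq0 => /eqP ->.
  by rewrite oppr0 add0r.
have P0J t : P0 *m J t = 0.
  rewrite mulmxBl mul1mx mulmx_suml (bigD1 t) //= PJ eqxx big1 ?addr0 ?subrr // => s st.
  by rewrite PJ (negbTE st).
have P00 : P0 *m P0 = P0.
  rewrite {2}/P0 mulmxBr mulmx1 mulmx_sumr big1 ?subr0 // => s _.
  by rewrite /P mulmxN mulmxA P0J mul0mx oppr0.
have JDP0 t : J t *m DP0 = - (D t *m P0).
  rewrite /DP0 mulmxN mulmx_sumr; congr (- _).
  under eq_bigr do rewrite JDP.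
  rewrite big_split /= -big_mkcond big_pred1_eq sumrN -mulmx_sumr.
  by rewrite -{1}[D t]mulmx1 -mulmxBr.
pose Q : M := DP0 *m P0 + 2^-1 *: \sum_s (DP s *m P s - D s *m J s).
exists Q => t.
have QJ : Q *m J t =
    2^-1 *: (DP t *m J t + D t *m P t).
  rewrite /Q mulmxDl -mulmxA P0J mulmx0 add0r -scalemxAl mulmx_suml (bigD1 t) //= big1.
    by rewrite addr0 mulmxBl -!mulmxA PJ eqxx /P mulmxN.
  by move=> s st; rewrite mulmxBl -!mulmxA PJ (negbTE st) J0 // !mulmx0 subrr.
have PP s : P s *m P s = P s.
  by rewrite {2}/P mulmxN mulmxA PJ eqxx.
have JQ : J t *m Q =
    - D t + 2^-1 *: (DP t *m J t + D t *m P t).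
  rewrite /Q mulmxDr mulmxA JDP0 mulNmx -mulmxA P00 -scalemxAr mulmx_sumr.
  have -> : \sum_s J t *m (DP s *m P s - D s *m J s) =
      (DP t *m J t + D t *m P t) - 2 *: \sum_s D t *m P s.
    rewrite scaler_sumr -[X in X - _](big_pred1_eq +%R t (fun t => DP t *m J t + D t *m P t)).
    rewrite big_mkcond /= -sumrB; apply: eq_bigr => s _.
    rewrite mulmxBr !mulmxA JDP JD !mulmxBl mulNmx -!mulmxA PP.
    have -> : J s *m J s = - P s by rewrite /P opprK.
    by case: eqP => [->|_]; rewrite ?mul0mx mulmxN; mxabel.
  rewrite scalerBr scalerA mulVf ?pnatr_eq0 // scale1r -mulmx_sumr.
  have -> : D t *m P0 = D t - D t *m \sum_s P s by rewrite /P0 mulmxBr mulmx1.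
  mxabel.
rewrite /Defs.commutator QJ JQ; set A := 2^-1 *: _; by rewrite opprD opprK addrCA subrr addr0.
Qed.

End Kato.

(** * Isotropy *)

(** Invariance of the trace form: <X, [xi, zeta]> = <[X, xi], zeta> = <Q, [zeta, X]>. *)
Lemma tr_commutator (K : numFieldType) p (X xi zeta Q : 'M[K]_p) :
  xi *m X - X *m xi = Defs.commutator Q X ->
  \tr (X *m Defs.commutator xi zeta) = \tr (Q *m (zeta *m X - X *m zeta)).
Proof.
rewrite /Defs.commutator => e.
have trC (A B C : 'M[K]_p) : \tr (A *m (B *m C)) = \tr (B *m C *m A).
  by rewrite mxtrace_mulC.
have trB (A B : 'M[K]_p) : \tr (A - B) = \tr A - \tr B by rewrite linearB.
rewrite !mulmxBr !trB trC [\tr (X *m (zeta *m xi))]trC.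
have -> : \tr (xi *m zeta *m X) - \tr (zeta *m xi *m X) = - \tr (zeta *m (xi *m X - X *m xi)).
  rewrite mulmxBr trB opprB; congr (_ - _); last by rewrite mulmxA.
  by rewrite [RHS]trC -[in RHS]mulmxA [RHS]trC.
rewrite e !mulmxBr !trB opprB; congr (_ - _).
  by rewrite [RHS]trC mulmxA.
by rewrite trC -mulmxA.
Qed.

Section Isotropy.
Variables (R : realType) (K : numFieldType) (S : scalars R K) (p : nat).
Variable F : compact_form S p.
Local Notation M := 'M[K]_p.
Local Notation G := (grp F).
Local Notation star := (star S).
Local Notation is_velocity := (@is_velocity R K S p).
Local Notation icont := (@inc_continuous _ _ S).
Variables (q r : nat) (a : K) (x0 : 'I_q -> M) (J0 : 'I_r -> M).
Variables (b : 'I_r -> 'I_q -> K) (c : 'I_q -> 'I_r -> K).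
Hypothesis J0_orth : forall s t, s != t -> J0 s *m J0 t = 0.
Hypothesis J0_cube : forall s, J0 s *m J0 s *m J0 s = - J0 s.
Hypothesis J0E : forall s, J0 s = \sum_l b s l *: (a *: x0 l).
Hypothesis x0E : forall l, a *: x0 l = \sum_s c l s *: J0 s.
Hypothesis moment0 : \sum_l a *: x0 l = 0.

Definition conj_orbit : set ('I_q -> M) :=
  [set x | exists2 g, G g & forall l, x l = g *m x0 l *m star g].

Let B s (y : 'I_q -> M) : M := \sum_l b s l *: (a *: y l).

Lemma conj_orbit_J x s g : (forall l, x l = g *m x0 l *m star g) ->
  B s x = g *m J0 s *m star g.
Proof.
move=> xg; rewrite /B J0E mulmx_sumr mulmx_suml; apply: eq_bigr => l _.
by rewrite xg -!scalemxAr -!scalemxAl.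
Qed.

Lemma conj_orbit_orth x s t : conj_orbit x -> s != t -> B s x *m B t x = 0.
Proof.
move=> [g Gg xg] st; rewrite !(conj_orbit_J _ xg) !mulmxA -(mulmxA _ (star g) g).
by rewrite (grp_unitaryV Gg) mulmx1 -(mulmxA g) J0_orth // mulmx0 mul0mx.
Qed.

Lemma conj_orbit_cube x s : conj_orbit x -> B s x *m B s x *m B s x = - B s x.
Proof.
move=> [g Gg xg]; rewrite !(conj_orbit_J _ xg) !mulmxA.
rewrite -!(mulmxA _ (star g) g) (grp_unitaryV Gg) !mulmx1.
by rewrite -(mulmxA g) -(mulmxA g) J0_cube mulmxN mulNmx.
Qed.

Lemma conj_orbit_xE x l : conj_orbit x -> a *: x l = \sum_s c l s *: B s x.
Proof.
move=> [g Gg xg]; under eq_bigr do rewrite (conj_orbit_J _ xg).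
rewrite xg scalemxAl scalemxAr x0E mulmx_sumr mulmx_suml.
by apply: eq_bigr => s _; rewrite -scalemxAr -scalemxAl.
Qed.

Lemma conj_orbit_moment x : conj_orbit x -> \sum_l a *: x l = 0.
Proof.
move=> [g Gg xg]; under eq_bigr do rewrite xg scalemxAl scalemxAr.
by rewrite -mulmx_suml -mulmx_sumr moment0 mulmx0 mul0mx.
Qed.

(** A tangent vector v to the image is the velocity of a curve of families of
    orthogonal partial complex structures.  The matrix Q of Kato's formula generates
    v in all the factors at once; whether Q lies in the Lie algebra does not matter,
    since the trace form is invariant under all matrices. *)
Theorem conj_orbit_isotropic : isotropic S a G conj_orbit.
Proof.
move=> x v w xi zeta Sx [cv [cv0 Scv cvv]] [cw [cw0 Scw cww]] gv gw.
have velB s : is_velocity (fun t => B s (cv t)) (B s v).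
  by apply: velocity_sum => l _; do 2 apply: velocityZ; exact: cvv.
have [Q QJ] : exists Q, forall s, Defs.commutator Q (B s x) = B s v.
  apply: kato; rewrite -?cv0.
  - by move=> s t st; exact: conj_orbit_orth.
  - by move=> s; exact: conj_orbit_cube.
  - move=> s t st; have h := velocityM icont (velB s) (velB t).
    apply: velocity_unique h _; under eq_fun do rewrite conj_orbit_orth //.
    exact: velocity_cst.
  - move=> s; have h := velocityM icont (velocityM icont (velB s) (velB s)) (velB s).
    apply: velocity_unique h _; under eq_fun do rewrite conj_orbit_cube //.
    exact: velocityN.
have vE l : a *: v l = Defs.commutator Q (a *: x l).
  have h1 : is_velocity (fun t => a *: cv t l) (a *: v l) by exact: velocityZ.
  have h2 : is_velocity (fun t => a *: cv t l) (\sum_s c l s *: B s v).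
    under eq_fun do rewrite conj_orbit_xE //.
    by apply: velocity_sum => s _; exact: velocityZ.
  rewrite (velocity_unique h1 h2) conj_orbit_xE // /Defs.commutator.
  rewrite mulmx_sumr mulmx_suml -sumrB; apply: eq_bigr => s _.
  by rewrite -QJ /Defs.commutator -scalemxAr -scalemxAl scalerBr.
have sumw : \sum_l a *: w l = 0.
  have h1 : is_velocity (fun t => \sum_l a *: cw t l) (\sum_l a *: w l).
    by apply: velocity_sum => l _; exact: velocityZ.
  apply: velocity_unique h1 _; under eq_fun do rewrite conj_orbit_moment //.
  exact: velocity_cst.
rewrite (_ : \sum_l _ = \tr (Q *m \sum_l a *: w l)); last first.
  rewrite mulmx_sumr linear_sum; apply: eq_bigr => l _ /=.
  rewrite /kks; have [_ vl] := gv l; have [_ wl] := gw l.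
  have e : xi l *m (a *: x l) - (a *: x l) *m xi l = Defs.commutator Q (a *: x l).
    by rewrite -vE vl /Defs.commutator scalerBr scalemxAr scalemxAl.
  have -> : a *: w l = zeta l *m (a *: x l) - (a *: x l) *m zeta l.
    by rewrite wl /Defs.commutator scalerBr scalemxAr scalemxAl.
  exact: tr_commutator e.
by rewrite sumw mulmx0 mxtrace0.
Qed.

End Isotropy.

(** * Flags of partial complex structures *)

Section FlagForm.
Variables (R : realType) (K : numFieldType) (S : scalars R K) (p : nat).
Local Notation M := 'M[K]_p.
Local Notation star := (star S).
Local Notation frob := (frob S).

Lemma frobD (A B : M) :
  frob (A + B) = frob A + frob B + (\tr (A *m star B) + \tr (B *m star A)).
Proof.
rewrite /frob starD mulmxDl !mulmxDr !linearD /=; ring.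
Qed.

(** Strict convexity of the norm: a weighted sum of vectors of norm at most
    that of [B] can be an extreme multiple of [B] only if they all agree. *)
Lemma frob_extreme I (s : seq I) (P : pred I) (w : I -> K) (B : M) (C : I -> M) :
  (forall i, P i -> 0 < w i) -> (forall i, P i -> cj S (w i) = w i) ->
  (forall i, P i -> frob (C i) <= frob B) ->
  \sum_(i <- s | P i) w i *: C i = - ((\sum_(i <- s | P i) w i) *: B) ->
  \sum_(i <- s | P i) w i * frob (C i + B) = 0.
Proof.
move=> w0 wr CB sumC; apply/eqP; rewrite eq_le; apply/andP; split; last first.
  by apply: sumr_ge0 => i Pi; apply: mulr_ge0; [exact/ltW/w0|exact: frob_ge0].
set W := \sum_(i <- s | P i) w i in sumC.
have cjW : cj S W = W by rewrite rmorph_sum; apply: eq_bigr => i Pi; exact: wr.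
have e1 : \sum_(i <- s | P i) w i * \tr (C i *m star B) = - (W * frob B).
  transitivity (\tr ((\sum_(i <- s | P i) w i *: C i) *m star B)).
    rewrite mulmx_suml linear_sum; apply: eq_bigr => i _ /=.
    by rewrite -scalemxAl linearZ.
  by rewrite sumC mulNmx linearN -scalemxAl linearZ.
have e2 : \sum_(i <- s | P i) w i * \tr (B *m star (C i)) = - (W * frob B).
  transitivity (\tr (B *m star (\sum_(i <- s | P i) w i *: C i))).
    rewrite star_sum mulmx_sumr linear_sum; apply: eq_bigr => i Pi /=.
    by rewrite starZ wr // -scalemxAr linearZ.
  by rewrite sumC starN starZ cjW mulmxN linearN -scalemxAr linearZ.
have e0 : \sum_(i <- s | P i)
    (w i * (frob B + frob B) + (w i * \tr (C i *m star B) + w i * \tr (B *m star (C i)))) = 0.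
  rewrite !big_split /= e1 e2 -mulr_suml -/W; ring.
rewrite -[leRHS]e0.
apply: ler_sum => i Pi; rewrite frobD -!mulrDr.
by rewrite ler_pM2l ?w0 // !lerD2r CB.
Qed.

(** Since 1 + Y^2 is the projection on the kernel of Y, Pythagoras gives
    frob B = frob (Y B) + frob ((1 + Y^2) B). *)
Lemma frob_contract (Y B : M) : star Y = - Y -> Y *m Y *m Y = - Y ->
  frob (Y *m B) <= frob B.
Proof.
move=> sY Y3; rewrite -subr_ge0.
suff -> : frob B - frob (Y *m B) = frob (B + Y *m (Y *m B)) by exact: frob_ge0.
have E1 : \tr (B *m star (Y *m (Y *m B))) = - frob (Y *m B).
  rewrite /frob mxtrace_mulC [in RHS]mxtrace_mulC -linearN /= -mulNmx; congr (\tr _).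
  by rewrite !starM sY !mulmxN !mulNmx !opprK !mulmxA.
have E2 : \tr (Y *m (Y *m B) *m star B) = - frob (Y *m B).
  rewrite /frob mxtrace_mulC [in RHS]mxtrace_mulC -linearN /= -mulNmx; congr (\tr _).
  by rewrite !starM sY !mulmxN !mulNmx !opprK !mulmxA.
have E3 : frob (Y *m (Y *m B)) = frob (Y *m B).
  rewrite /frob mxtrace_mulC [in RHS]mxtrace_mulC; congr (\tr _).
  have AY3 (A : M) : A *m Y *m Y *m Y = - (A *m Y) by rewrite -!mulmxA [Y *m _]mulmxA Y3 mulmxN.
  by rewrite !starM sY !mulmxN !mulNmx !mulmxA !opprK AY3 !mulNmx.
by rewrite frobD E1 E2 E3; ring.
Qed.

Variables (r : nat) (Y : nat -> M).
Hypothesis Y_skew : forall l, (l <= r)%N -> star (Y l) = - Y l.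
Hypothesis Y_cube : forall l, (l <= r)%N -> Y l *m Y l *m Y l = - Y l.
Hypothesis Y_sum : \sum_(l < r) 2 ^+ (r - l.+1) *: Y l + Y r = 0.

(** The sum of the J_s with s < l; the recursion comes from
    Y_l = J_l - flagZ l and flagZ (l+1) = flagZ l + J_l. *)
Fixpoint flagZ l : M := if l is l'.+1 then Y l' + 2 *: flagZ l' else 0.
Definition flagJ l : M := Y l + flagZ l.

Lemma flagZE l : flagZ l = \sum_(s < l) flagJ s.
Proof.
elim: l => [|l IH]; first by rewrite big_ord0.
by rewrite big_ord_recr /= -IH /flagJ scaler_nat mulr2n addrCA.
Qed.

Let wt k : K := if (k < r)%N then 2 ^+ (r - k.+1) else 1.

Lemma sum_wt l : (l <= r)%N -> \sum_(l <= k < r.+1) wt k = 2 ^+ (r - l).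
Proof.
move=> lr; rewrite big_nat_recr //= {2}/wt ltnn.
have -> : \sum_(l <= k < r) wt k = \sum_(l <= k < r) 2 ^+ (r - k.+1).
  by apply: eq_big_nat => k /andP[_ kr]; rewrite /wt kr.
elim: {l}(r - l)%N {-2}l (erefl (r - l)%N) lr => [|d IH] l dl lr.
  have -> : l = r by apply/eqP; rewrite eqn_leq lr -subn_eq0 dl.
  by rewrite big_geq // subnn add0r expr0.
have lr' : (l < r)%N by rewrite -subn_gt0 dl.
have dl' : (r - l.+1 = d)%N by rewrite subnS dl.
rewrite big_ltn // -addrA IH // dl' dl exprS -mulr2n mulr_natl; ring.
Qed.

Lemma Y_sum_wt : \sum_(0 <= k < r.+1) wt k *: Y k = 0.
Proof.
rewrite big_nat_recr //= {2}/wt ltnn scale1r -[RHS]Y_sum; congr (_ + _).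
by rewrite big_mkord; apply: eq_bigr => k _; rewrite /wt ltn_ord.
Qed.

(** The last clause says that the images of the J_s with s < l are split off: there
    Y_k = - J_s for all k > s. *)
Definition flag_upto l := [/\
  forall s, (s < l)%N -> star (flagJ s) = - flagJ s,
  forall s, (s < l)%N -> flagJ s *m flagJ s *m flagJ s = - flagJ s,
  forall s t, (s < l)%N -> (t < l)%N -> s != t -> flagJ s *m flagJ t = 0
  & forall s k, (s < l)%N -> (s < k <= r)%N -> Y k *m flagJ s = - (flagJ s *m flagJ s)].

(** Multiply the relation between the Y_k by J_l on the right.  The terms with k < l
    vanish, as Y_k is a combination of J_0, ..., J_k.  The others are an extreme case
    of [frob_extreme], because 2^(r-l-1) is the sum of the later weights. *)
Lemma flag_step l : (l < r)%N -> flag_upto l -> flag_upto l.+1.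
Proof.
move=> lr [Jsk J3 J0 YJ].
have Zsk : star (flagZ l) = - flagZ l.
  by rewrite flagZE star_sum -sumrN; apply: eq_bigr => s _; exact: Jsk.
have JlsK : star (flagJ l) = - flagJ l.
  by rewrite /flagJ starD Zsk Y_skew ?(ltnW lr) // opprD.
have ZJ s : (s < l)%N -> flagZ l *m flagJ s = flagJ s *m flagJ s.
  move=> sl; rewrite flagZE mulmx_suml (bigD1 (Ordinal sl)) //= big1 ?addr0 //.
  by move=> t ts; rewrite J0.
have JlJ s : (s < l)%N -> flagJ l *m flagJ s = 0.
  by move=> sl; rewrite mulmxDl YJ ?sl ?(ltnW lr) // ZJ // addNr.
have JJl s : (s < l)%N -> flagJ s *m flagJ l = 0.
  move=> sl; have := congr1 (fun A : M => star A) (JlJ s sl).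
  by rewrite starM star0 JlsK Jsk // mulmxN mulNmx opprK.
have JlZ : flagJ l *m flagZ l = 0.
  by rewrite flagZE mulmx_sumr big1 // => s _; exact: JlJ.
have ZJl : flagZ l *m flagJ l = 0.
  by rewrite flagZE mulmx_suml big1 // => s _; exact: JJl.
have Z3 : flagZ l *m flagZ l *m flagZ l = - flagZ l.
  have -> : flagZ l *m flagZ l = \sum_(s < l) flagJ s *m flagJ s.
    rewrite {2}flagZE mulmx_sumr; apply: eq_bigr => s _; exact: ZJ.
  rewrite mulmx_suml [in RHS]flagZE -sumrN; apply: eq_bigr => s _.
  rewrite flagZE mulmx_sumr (bigD1 s) //= J3 // big1 ?addr0 // => t ts.
  by rewrite -mulmxA J0 1?eq_sym // mulmx0.
have YE : Y l = flagJ l - flagZ l by rewrite /flagJ addrK.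
have Jl3 : flagJ l *m flagJ l *m flagJ l = - flagJ l.
  have JZJ : (flagJ l - flagZ l) *m (flagJ l - flagZ l) = flagJ l *m flagJ l + flagZ l *m flagZ l.
    by rewrite mulmxBl !mulmxBr JlZ ZJl subr0 sub0r opprK.
  have := Y_cube (ltnW lr); rewrite YE JZJ mulmxDl !mulmxBr Z3 -!mulmxA JlZ ZJl !mulmx0.
  by rewrite subr0 sub0r opprK opprB addrC => /addrI.
have YJl k : (k < l)%N -> Y k *m flagJ l = 0.
  move=> kl; have -> : Y k = flagJ k - flagZ k by rewrite /flagJ addrK.
  rewrite mulmxBl JJl // flagZE mulmx_suml big1 ?subrr // => s _.
  by rewrite JJl // (ltn_trans (ltn_ord s)).
have YlJl : Y l *m flagJ l = flagJ l *m flagJ l.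
  by rewrite {1}YE mulmxBl ZJl subr0.
(* Here the convexity of the norm enters. *)
have YkJl k : (l < k <= r)%N -> Y k *m flagJ l = - (flagJ l *m flagJ l).
  move=> /andP[lk kr]; apply/eqP; rewrite -addr_eq0; apply/eqP.
  have JJ : frob (flagJ l *m flagJ l) = frob (flagJ l).
    rewrite /frob starM JlsK mulmxN mulNmx opprK !mulmxA Jl3 mulNmx.
    by rewrite mulmxN.
  have wt0 i : 0 < wt i by rewrite /wt; case: ifP => _ //; exact: exprn_gt0.
  have := @frob_extreme _ (index_iota l.+1 r.+1) (fun k => (l < k <= r)%N) wt
    (flagJ l *m flagJ l) (fun k => Y k *m flagJ l).
  move=> /(_ (fun i _ => wt0 i)) h.
  have /h {h} h : forall i, (l < i <= r)%N -> cj S (wt i) = wt i.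
    by move=> i _; rewrite /wt; case: ifP; rewrite ?rmorphXn ?rmorph1 ?rmorph_nat.
  have /h {h} h : forall i, (l < i <= r)%N ->
      frob (Y i *m flagJ l) <= frob (flagJ l *m flagJ l).
    by move=> i /andP[_ ir]; rewrite JJ; apply: frob_contract; [exact: Y_skew|exact: Y_cube].
  have /h {h} : \sum_(l.+1 <= i < r.+1 | (l < i <= r)%N) wt i *: (Y i *m flagJ l) =
      - ((\sum_(l.+1 <= i < r.+1 | (l < i <= r)%N) wt i) *: (flagJ l *m flagJ l)).
    have E : \sum_(l.+1 <= i < r.+1 | (l < i <= r)%N) wt i = wt l.
      rewrite /wt lr -sum_wt //; symmetry; rewrite big_seq_cond [RHS]big_seq_cond.
      by apply: eq_bigl => i; rewrite mem_index_iota ltnS andbT andbb.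
    have E2 : \sum_(l.+1 <= i < r.+1 | (l < i <= r)%N) wt i *: (Y i *m flagJ l) =
        \sum_(l.+1 <= i < r.+1) wt i *: (Y i *m flagJ l).
      rewrite big_seq_cond [RHS]big_seq_cond.
      by apply: eq_bigl => i; rewrite mem_index_iota ltnS andbT andbb.
    rewrite E E2; have := congr1 (fun A : M => A *m flagJ l) Y_sum_wt.
    rewrite mul0mx mulmx_suml (big_cat_nat (n := l)) //=; last by rewrite (leq_trans (ltnW lr)).
    rewrite big_nat big1 => [|i /andP[_ il]]; last by rewrite -scalemxAl YJl // scaler0.
    rewrite add0r big_ltn ?ltnS 1?ltnW // -scalemxAl YlJl => /eqP.
    rewrite addrC addr_eq0 => /eqP <-; apply: eq_bigr => i _; by rewrite scalemxAl.
  move=> /eqP; rewrite psumr_eq0; last first.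
    by move=> i _; apply: mulr_ge0; [exact: ltW|exact: frob_ge0].
  move=> /allP /(_ k); rewrite mem_index_iota ltnS lk kr => /(_ isT) /=.
  by rewrite mulf_eq0 gt_eqF //= => /eqP /frob_eq0.
split.
- move=> s; rewrite ltnS leq_eqVlt => /predU1P[->|]; [exact: JlsK|exact: Jsk].
- move=> s; rewrite ltnS leq_eqVlt => /predU1P[->|]; [exact: Jl3|exact: J3].
- move=> s t; rewrite ltnS leq_eqVlt => /predU1P[->|sl];
    rewrite ltnS leq_eqVlt => /predU1P[->|tl] st.
  + by rewrite eqxx in st.
  + exact: JlJ.
  + exact: JJl.
  + exact: J0.
- move=> s k; rewrite ltnS leq_eqVlt => /predU1P[->|sl]; [exact: YkJl|exact: YJ].
Qed.

Theorem flag_form : flag_upto r /\ Y r = - flagZ r.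
Proof.
split.
  suff: forall l, (l <= r)%N -> flag_upto l by apply.
  elim=> [|l IH] lr; first by split.
  by apply: flag_step => //; apply: IH; exact: ltnW.
apply/eqP; rewrite -addr_eq0 -[X in _ == X]Y_sum addrC; apply/eqP; congr (_ + _).
suff: forall l, (l <= r)%N ->
    \sum_(k < l) 2 ^+ (r - k.+1) *: Y k = 2 ^+ (r - l) *: flagZ l.
  by move=> /(_ r (leqnn r)); rewrite subnn expr0 scale1r.
elim=> [|l IH] lr; first by rewrite big_ord0 scaler0.
rewrite big_ord_recr /= IH 1?ltnW // scalerDr scalerA -exprSr subnSK // addrC.
by [].
Qed.

End FlagForm.

(** * Real and complex scalars *)

Section ScalarInstances.
Variable R : realType.
Let C : numFieldType := R[i].

Lemma real_complex_continuous : continuous (real_complex R : R -> C).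
Proof.
move=> x; apply/cvgrPdist_lt => e e0.
have [d d0 ->] : exists2 d : R, 0 < d & e = d%:C.
  move: e0; rewrite ltcE /= => /andP[/eqP im0 re0]; exists (complex.Re e) => //.
  by case: e im0 {re0} => a b /= ->.
have /cvgrPdist_lt /(_ d d0) := @cvg_id R (nbhs x).
apply: filterS => y; rewrite -rmorphB normc_def /= expr0n addr0 sqrtr_sqr ltcR.
by [].
Qed.

Lemma conjC_continuous : continuous (Num.conj : C -> C).
Proof.
move=> x; apply/(@cvgrPdist_lt _ C C (nbhs x) _ Num.conj (Num.conj x)) => e e0.
have /(@cvgrPdist_lt _ C C (nbhs x) _ id x) /(_ e e0) := @cvg_id C (nbhs x).
by apply: filterS => y; rewrite -rmorphB norm_conjC.
Qed.

Lemma conjC_real_complex (t : R) : Num.conj (real_complex R t) = real_complex R t.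
Proof. by apply: conj_Creal; rewrite complex_real. Qed.

Lemma complex_disk : exists2 D : set C, compact D &
  forall z, z * Num.conj z <= 1 -> D z.
Proof.
pose f (z : R * R) : C := real_complex R z.1 + 'i%C * real_complex R z.2.
have f_cont : continuous f.
  move=> z; apply: cvgD.
    by apply: (@cvg_comp _ _ _ fst); [exact: cvg_fst|exact: real_complex_continuous].
  apply: cvgM; first exact: cvg_cst.
  by apply: (@cvg_comp _ _ _ snd); [exact: cvg_snd|exact: real_complex_continuous].
exists (f @` (`[(-1 : R), 1] `*` `[(-1 : R), 1])).
  apply: continuous_compact; first exact: continuous_subspaceT.
  by apply: compact_setX; exact: segment_compact.
move=> [x y] h; exists (x, y).
  have : x ^+ 2 + y ^+ 2 <= 1.
    move: h; rewrite -normCK normc_def -rmorphXn /= sqr_sqrtr ?addr_ge0 ?sqr_ge0 //.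
    by rewrite -(rmorph1 (real_complex R)) lecR.
  move=> xy; split; rewrite /= in_itv /= -ler_norml -(@ler_pXn2r _ 2) ?nnegrE // expr1n
    real_normK ?num_real //; apply: le_trans xy; rewrite ?lerDl ?lerDr sqr_ge0 //.
rewrite /f /=; apply/eqP; rewrite eq_complex /=; by simpc; rewrite ?eqxx.
Qed.

Definition complex_scalars : scalars R C :=
  @Scalars R C (real_complex R) Num.conj real_complex_continuous
    conjC_continuous (@conjCK _) conjC_real_complex (@mul_conjC_ge0 _) complex_disk.

Lemma real_disk : exists2 D : set R, compact D & forall z, z * idfun z <= 1 -> D z.
Proof.
exists (`[(-1 : R), 1]%classic); first exact: segment_compact.
move=> z /=; rewrite -expr2 => z1; rewrite in_itv /= -ler_norml.
by rewrite -(@ler_pXn2r _ 2) ?nnegrE // expr1n real_normK ?num_real.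
Qed.

Definition real_scalars : scalars R R :=
  @Scalars R R idfun idfun (fun x => @cvg_id _ _)
    (fun x => @cvg_id _ _) (fun=> erefl) (fun=> erefl)
    (fun z => sqr_ge0 z) real_disk.

End ScalarInstances.

Notation adj := (star (complex_scalars _)).

(** * Complex structures and Hermitian projections *)

Section ComplexMatrices.
Variable R : realType.
Local Notation C := R[i].

Lemma unitarymx_adj m n (u : 'M[C]_(m, n)) : (u \is unitarymx) <-> u *m adj u = 1%:M.
Proof.
have -> : adj u = map_mx Num.conj u^T by rewrite /star map_trmx.
by split=> [/unitarymxP|h]; [|apply/unitarymxP].
Qed.

(** A Hermitian projection is the product of an isometry with its adjoint: an
    orthonormal basis of its row space gives the isometry. *)
Lemma projection_isometry n (P : 'M[C]_n) : adj P = P -> P *m P = P ->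
  exists k, exists B : 'M[C]_(k, n), B *m adj B = 1%:M /\ adj B *m B = P.
Proof.
move=> hP PP.
suff key k (B : 'M[C]_(k, n)) : B *m adj B = 1%:M -> (B :=: P)%MS -> adj B *m B = P.
  exists (\rank P), (schmidt (row_base P)).
  have B1 : schmidt (row_base P) *m adj (schmidt (row_base P)) = 1%:M.
    by apply/unitarymx_adj/schmidt_unitarymx; exact: rank_leq_col.
  split=> //; apply: key => //.
  apply: eqmx_trans (eq_row_base P); apply: eqmx_schmidt_free; exact: row_base_free.
move=> B1 eqB.
have /submxP[D PD] : (P <= B)%MS by rewrite eqB.
have /submxP[E BE] : (B <= P)%MS by rewrite eqB.
have BP : B *m P = B by rewrite BE -mulmxA PP.
have PBB : P *m (adj B *m B) = P by rewrite PD -!mulmxA [B *m (_ *m _)]mulmxA B1 mul1mx.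
have := congr1 (fun A : 'M[C]_n => adj A) PBB; rewrite !starM starK hP => <-.
by rewrite -mulmxA BP.
Qed.

End ComplexMatrices.

(** M_n(C) as a real *-subalgebra of [alg], with 1 not necessarily sent to 1.
    [um_lift] extends unitary matrices to elements of the group, [um_commutant]
    says that the image is the full commutant of the standard complex structure, and
    [um_flip] reverses the orientation of some coordinate lines of C^n. *)
Record unitary_model (R : realType) (K : numFieldType) (S : scalars R K) (p : nat)
    (F : compact_form S p) (n : nat) := UnitaryModel {
  um :> 'M[R[i]]_n -> 'M[K]_p;
  umD : forall u v, um (u + v) = um u + um v;
  umM : forall u v, um (u *m v) = um u *m um v;
  umZ : forall t u, um (real_complex R t *: u) = S t *: um u;
  um_star : forall u, um (star (complex_scalars R) u) = star S (um u);
  um_inj : injective um;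
  um_alg : forall u, alg F (um u);
  um_lift : forall u, u \is unitarymx -> exists2 g, grp F g &
    forall x, g *m um x *m star S g = um (u *m x *m star (complex_scalars R) u);
  um_commutant : forall X, alg F X ->
    X *m um ('i%C%:M) = um ('i%C%:M) *m X ->
    X *m um 1%:M = X -> um 1%:M *m X = X -> exists u, X = um u;
  um_trace : forall u v, \tr (um u) = \tr (um v) ->
    complex.Re (\tr u) = complex.Re (\tr v);
  um_flip : forall e : 'I_n -> bool, exists2 g, grp F g & forall d : 'I_n -> R,
    g *m um ('i%C *: diag_mx (\row_k (real_complex R (d k)))) *m star S g =
    um ('i%C *: diag_mx (\row_k (real_complex R ((-1) ^+ e k * d k)))) }.

Section Conjugacy.
Variables (R : realType) (K : numFieldType) (S : scalars R K) (p : nat).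
Variables (F : compact_form S p) (n : nat) (U : unitary_model F n).
Local Notation C := R[i].
Local Notation M := 'M[K]_p.
Local Notation G := (grp F).
Local Notation star := (star S).

Lemma um0 : U 0 = 0.
Proof. by have := umZ U 0 0; rewrite !rmorph0 !scale0r. Qed.

Lemma umN u : U (- u) = - U u.
Proof. by have := umZ U (-1) u; rewrite !rmorphN1 !scaleN1r. Qed.

Lemma um_sum I (s : seq I) (P : pred I) (u : I -> 'M[C]_n) :
  U (\sum_(i <- s | P i) u i) = \sum_(i <- s | P i) U (u i).
Proof. by apply: (big_morph U (umD U) um0). Qed.

Variables (r : nat) (ns : 'I_r -> nat) (v : forall s, 'M[C]_(n, ns s)).
Hypothesis v_iso : forall s, adj (v s) *m v s = 1%:M.
Hypothesis v_orth : forall s t, s != t -> adj (v s) *m v t = 0.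
Let Pi s : 'M[C]_n := v s *m adj (v s).

Lemma Pi_adj s : adj (Pi s) = Pi s.
Proof. by rewrite /Pi starM starK. Qed.

Lemma vPi s t : adj (v s) *m Pi t = if s == t then adj (v s) else 0.
Proof.
rewrite /Pi mulmxA; case: eqP => [->|/eqP st]; first by rewrite v_iso mul1mx.
by rewrite v_orth // mul0mx.
Qed.

Lemma PiPi s t : Pi s *m Pi t = if s == t then Pi s else 0.
Proof. by rewrite {1}/Pi -mulmxA vPi; case: eqP => // _; rewrite mulmx0. Qed.

Lemma sumPi2 : (\sum_s Pi s) *m (\sum_s Pi s) = \sum_s Pi s.
Proof.
rewrite mulmx_suml; apply: eq_bigr => s _; rewrite mulmx_sumr (bigD1 s) //=.
by rewrite big1 ?addr0 ?PiPi ?eqxx // => t ts; rewrite PiPi eq_sym (negbTE ts).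
Qed.

(** The unitary matrix sends orthonormal bases of the images of the [Pi s] to
    orthonormal bases of the images of the P s; the traces say that they have the same
    lengths. *)
Lemma projections_conj (P : 'I_r -> 'M[C]_n) :
  (forall s, adj (P s) = P s) -> (forall s, P s *m P s = P s) ->
  (forall s t, s != t -> P s *m P t = 0) -> \sum_s P s = \sum_s Pi s ->
  (forall s, complex.Re (\tr (P s)) = complex.Re (\tr (Pi s))) ->
  exists2 u, u \is unitarymx & forall s, P s = u *m Pi s *m adj u.
Proof.
move=> hP PP P0 sumP trP.
have exB s : exists B : 'M[C]_(ns s, n), B *m adj B = 1%:M /\ adj B *m B = P s.
  have [k [B [B1 BP]]] := projection_isometry (hP s) (PP s).
  have : \tr (P s) = k%:R by rewrite -BP mxtrace_mulC B1 mxtrace1.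
  have : \tr (Pi s) = (ns s)%:R by rewrite /Pi mxtrace_mulC v_iso mxtrace1.
  have := trP s => + e1 e2; rewrite e1 e2 -!(rmorph_nat (real_complex R)) /= => /eqP.
  rewrite eqr_nat => /eqP kn; move: B B1 BP; rewrite kn => B B1 BP; by exists B.
pose B s := projT1 (cid (exB s)).
have BB s : adj (B s) *m B s = P s by have [] := projT2 (cid (exB s)).
(* The identity on the common complement N of the Pi s and of the P s completes the
   sum of the partial isometries to a unitary matrix. *)
pose N : 'M[C]_n := 1%:M - \sum_s Pi s.
have hN : adj N = N.
  by rewrite /N starB star1 star_sum; congr (_ - _); apply: eq_bigr => s _; rewrite Pi_adj.
have vN s : adj (v s) *m N = 0.
  rewrite /N mulmxBr mulmx1 mulmx_sumr (bigD1 s) //= vPi eqxx big1 ?addr0 ?subrr //.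
  by move=> t ts; rewrite vPi eq_sym (negbTE ts).
have NN : N *m N = N.
  rewrite {1}/N mulmxBl mul1mx mulmx_suml big1 ?subr0 // => s _.
  by rewrite /Pi -mulmxA vN mulmx0.
pose u : 'M[C]_n := \sum_s adj (B s) *m adj (v s) + N.
have uv t : u *m v t = adj (B t).
  have Nv : N *m v t = 0 by rewrite -hN -[v t](starK (complex_scalars R)) -starM vN star0.
  rewrite mulmxDl Nv addr0 mulmx_suml (bigD1 t) //= -mulmxA v_iso mulmx1 big1 ?addr0 //.
  by move=> s st; rewrite -mulmxA v_orth // mulmx0.
have uN : u *m N = N.
  rewrite mulmxDl NN mulmx_suml big1 ?add0r // => s _.
  by rewrite -mulmxA vN mulmx0.
have uE : adj u = \sum_s v s *m B s + N.
  by rewrite /u starD hN star_sum; congr (_ + _); apply: eq_bigr => s _; rewrite starM !starK.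
exists u.
  apply/unitarymx_adj; rewrite uE mulmxDr uN mulmx_sumr.
  under eq_bigr do rewrite mulmxA uv BB.
  by rewrite sumP /N addrC subrK.
by move=> s; rewrite /Pi mulmxA -mulmxA uv -starM uv starK BB.
Qed.

(** Orthogonality makes every J s commute with the sum, the standard complex
    structure.  Hence the J s come from M_n(C), where they are i times the projections of
    [projections_conj]. *)
Lemma structures_conj (J : 'I_r -> M) :
  (forall s, alg F (J s)) -> (forall s, star (J s) = - J s) ->
  (forall s, J s *m J s *m J s = - J s) ->
  (forall s t, s != t -> J s *m J t = 0) ->
  \sum_s J s = U ('i%C *: \sum_s Pi s) ->
  (forall s, \tr (J s *m J s) = - \tr (U (Pi s))) ->
  exists2 g, G g & forall s, J s = g *m U ('i%C *: Pi s) *m star g.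
Proof.
move=> FJ skJ J3 J0 sumJ trJ.
pose Pi0 := \sum_s Pi s.
have Jsum s : J s *m \sum_t J t = J s *m J s.
  by rewrite mulmx_sumr (bigD1 s) //= big1 ?addr0 // => t ts; rewrite J0 // eq_sym.
have sumJr s : (\sum_t J t) *m J s = J s *m J s.
  by rewrite mulmx_suml (bigD1 s) //= big1 ?addr0 // => t ts; rewrite J0.
have ii : 'i%C * 'i%C = -1 :> C by rewrite -expr2 sqr_i.
have UPi : U Pi0 = - (U ('i%C *: Pi0) *m U ('i%C *: Pi0)).
  by rewrite -umM -scalemxAl -scalemxAr scalerA ii sumPi2 scaleN1r umN opprK.
have JPi s : J s *m U Pi0 = J s.
  by rewrite UPi -sumJ mulmxN mulmxA Jsum -mulmxA Jsum mulmxA J3 opprK.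
have PiJ s : U Pi0 *m J s = J s.
  by rewrite UPi -sumJ mulNmx -mulmxA sumJr mulmxA sumJr J3 opprK.
have exy s : exists y, J s = U y.
  apply: (@um_commutant _ _ _ _ _ _ U (J s)) => //.
  - rewrite -{1}JPi -{2}PiJ -!mulmxA -umM mulmxA -umM.
    by rewrite mul_mx_scalar mul_scalar_mx -sumJ Jsum sumJr.
  - by rewrite -{1}JPi -mulmxA -umM mulmx1 JPi.
  - by rewrite -{1}PiJ mulmxA -umM mul1mx PiJ.
pose P s : 'M[C]_n := - ('i%C *: projT1 (cid (exy s))).
have iP s : J s = U ('i%C *: P s).
  by rewrite /P scalerN scalerA ii scaleN1r opprK; exact: projT2 (cid (exy s)).
have sumP : \sum_s P s = Pi0.
  have : U ('i%C *: \sum_s P s) = U ('i%C *: Pi0).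
    by rewrite -sumJ scaler_sumr um_sum; apply: eq_bigr => s _.
  move/um_inj/(congr1 (fun A => - ('i%C *: A))).
  by rewrite !scalerA ii !scaleN1r !opprK.
have P0 s t : s != t -> P s *m P t = 0.
  move=> st; have := J0 s t st; rewrite !iP -umM -scalemxAl -scalemxAr scalerA ii.
  rewrite scaleN1r -[RHS]um0 => /um_inj /eqP; by rewrite oppr_eq0 => /eqP.
have hP s : adj (P s) = P s.
  have := skJ s; rewrite iP -um_star -umN => /um_inj.
  rewrite starZ /= conjCi scaleNr => /eqP; rewrite eqr_opp => /eqP.
  move/(congr1 (fun A => - ('i%C *: A))).
  by rewrite !scalerA ii !scaleN1r !opprK.
(* P s ^ 3 = P s only; P s is idempotent because the sum of all of them is. *)
have Psum s : P s *m Pi0 = P s *m P s.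
  by rewrite -sumP mulmx_sumr (bigD1 s) //= big1 ?addr0 // => t ts; rewrite P0 // eq_sym.
have PP s : P s *m P s = P s.
  have := JPi s; rewrite iP -umM => /um_inj; rewrite -scalemxAl Psum.
  move/(congr1 (fun A => - ('i%C *: A))).
  by rewrite !scalerA ii !scaleN1r !opprK.
have trP s : complex.Re (\tr (P s)) = complex.Re (\tr (Pi s)).
  apply: (@um_trace _ _ _ _ _ _ U).
  have := trJ s; rewrite iP -umM -scalemxAl -scalemxAr scalerA ii PP scaleN1r umN.
  by rewrite linearN => /eqP; rewrite eqr_opp => /eqP.
have [u uu Pu] := projections_conj hP PP P0 sumP trP.
have [g Gg gU] := um_lift U uu; exists g => // s.
by rewrite gU iP Pu -scalemxAr -scalemxAl.
Qed.

End Conjugacy.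

(** * The zero level of the moment map *)

Section LevelSet.
Variables (R : realType) (K : numFieldType) (S : scalars R K) (p : nat).
Variables (F : compact_form S p) (n : nat) (U : unitary_model F n).
Local Notation C := R[i].
Local Notation M := 'M[K]_p.
Local Notation G := (grp F).
Local Notation star := (star S).
Variables (r : nat) (ns : 'I_r -> nat) (v : forall s, 'M[C]_(n, ns s)).
Hypothesis v_iso : forall s, adj (v s) *m v s = 1%:M.
Hypothesis v_orth : forall s t, s != t -> adj (v s) *m v t = 0.
Let Pi s : 'M[C]_n := v s *m adj (v s).

(** The entry of Upsilon_l on the s-th block, up to the power of 2. *)
Definition flag_sign {T : pzRingType} (s l : nat) : T :=
  if (s < l)%N then -1 else if s == l then 1 else 0.

Let E (l : nat) : 'M[C]_n := \sum_(s < r) flag_sign s l *: Pi s.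

Lemma sumPiM (a b : 'I_r -> C) :
  (\sum_s a s *: Pi s) *m (\sum_s b s *: Pi s) = \sum_s (a s * b s) *: Pi s.
Proof.
rewrite mulmx_suml; apply: eq_bigr => s _; rewrite mulmx_sumr (bigD1 s) //=.
rewrite -scalemxAl -scalemxAr scalerA PiPi // eqxx big1 ?addr0 // => t ts.
by rewrite -scalemxAl -scalemxAr PiPi // eq_sym (negbTE ts) !scaler0.
Qed.

Lemma flag_sign_cube (T : pzRingType) s l :
  flag_sign s l * flag_sign s l * flag_sign s l = flag_sign s l :> T.
Proof. by rewrite /flag_sign; (case: ifP => _; last case: ifP => _); rewrite ?mulrNN ?mul1r ?mul0r. Qed.

Lemma E_cube l : E l *m E l *m E l = E l.
Proof. by rewrite !sumPiM; apply: eq_bigr => s _; rewrite flag_sign_cube. Qed.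

Lemma E_adj l : adj (E l) = E l.
Proof.
rewrite star_sum; apply: eq_bigr => s _; rewrite starZ Pi_adj /flag_sign.
by congr (_ *: _); (case: ifP => _; last case: ifP => _); rewrite ?rmorphN1 ?rmorph1 ?rmorph0.
Qed.

Lemma E_sqr l : E l *m E l = \sum_(s < r | (s <= l)%N) Pi s.
Proof.
rewrite sumPiM [RHS]big_mkcond; apply: eq_bigr => s _; rewrite /flag_sign.
by case: ltngtP => _; rewrite ?mulrNN ?mulr1 ?mulr0 ?scale1r ?scale0r.
Qed.

Lemma E_top : E r = - \sum_s Pi s.
Proof. by rewrite -sumrN; apply: eq_bigr => s _; rewrite /flag_sign ltn_ord scaleN1r. Qed.

Lemma E_flag (l : 'I_r) : E l = Pi l - \sum_(s < r | (s < l)%N) Pi s.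
Proof.
rewrite /E (bigD1 l) //= [in RHS]big_mkcond /flag_sign ltnn eqxx scale1r [in RHS](bigD1 l) //=.
rewrite ltnn /= add0r -sumrN; congr (_ + _); apply: eq_bigr => s sl.
by case: ltngtP sl; rewrite ?scaleN1r ?scale0r ?oppr0 // => /val_inj ->; rewrite eqxx.
Qed.

Let ct (l : nat) : R := 2 ^+ (r - l.+1).

(** The power of 2 at l = s compensates all those with l > s. *)
Lemma flag_sign_sum (s : nat) : (s < r)%N ->
  \sum_(l < r.+1) real_complex R (ct l) * flag_sign s l = 0.
Proof.
move=> sr; rewrite -(big_mkord xpredT (fun l => real_complex R (ct l) * flag_sign s l)).
rewrite (big_cat_nat (n := s)) //=; last by rewrite (leq_trans (ltnW sr)).
rewrite big_nat big1 => [|l /andP[_ ls]]; last first.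
  by rewrite /flag_sign ltnNge (ltnW ls) /= gtn_eqF ?mulr0.
rewrite add0r big_ltn ?ltnS 1?ltnW // /flag_sign ltnn eqxx mulr1.
have -> : \sum_(s.+1 <= l < r.+1) real_complex R (ct l) * flag_sign s l =
    - \sum_(s.+1 <= l < r.+1) (if (l < r)%N then 2 ^+ (r - l.+1) else 1 : C).
  rewrite -sumrN; apply: eq_big_nat => l /andP[sl lr]; rewrite /flag_sign sl mulrN1.
  congr (- _); rewrite rmorphXn rmorph_nat; case: ifP => // /negbT; rewrite -leqNgt => rl.
  by rewrite (_ : (r - l.+1)%N = 0%N) //; apply/eqP; rewrite subn_eq0 leqW.
by rewrite sum_wt // rmorphXn rmorph_nat subrr.
Qed.

Lemma E_sum_ct : \sum_(l < r.+1) real_complex R (ct l) *: E l = 0.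
Proof.
under eq_bigr do rewrite scaler_sumr; rewrite exchange_big big1 // => s _.
under eq_bigr do rewrite scalerA.
by rewrite -scaler_suml flag_sign_sum // scale0r.
Qed.

Lemma conj_skew (g : M) (u : 'M[C]_n) : adj u = u ->
  star (g *m U ('i%C *: u) *m star g) = - (g *m U ('i%C *: u) *m star g).
Proof.
move=> hu; rewrite !starM starK -um_star starZ /= hu conjCi scaleNr umN.
by rewrite mulNmx mulmxN mulmxA.
Qed.

Lemma conjM g (A B : M) : G g ->
  (g *m A *m star g) *m (g *m B *m star g) = g *m (A *m B) *m star g.
Proof. by move=> Gg; rewrite !mulmxA -(mulmxA _ (star g) g) (grp_unitaryV Gg) mulmx1. Qed.

Lemma conjK g (A : M) : G g -> g *m (star g *m A *m g) *m star g = A.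
Proof.
move=> Gg; rewrite !mulmxA (grp_unitary Gg) mul1mx -mulmxA.
by rewrite (grp_unitary Gg) mulmx1.
Qed.

Lemma conj_tr g (A : M) : G g -> \tr (g *m A *m star g) = \tr A.
Proof. by move=> Gg; rewrite mxtrace_mulC mulmxA (grp_unitaryV Gg) mul1mx. Qed.

Lemma umii u w : U ('i%C *: u) *m U ('i%C *: w) = - U (u *m w).
Proof.
rewrite -umM -scalemxAl -scalemxAr scalerA.
by rewrite -expr2 sqr_i scaleN1r umN.
Qed.

(** [flag_form] provides the J_s.  Their ranks are found inductively from the traces
    of the Y_l^2, which are those at the base point. *)
Theorem level_set_conj (X : 'I_r.+1 -> M) :
  (forall l, exists2 g, G g &
     X l = g *m U ('i%C *: (real_complex R (ct l) *: E l)) *m star g) ->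
  \sum_l X l = 0 ->
  exists2 g, G g & forall l,
     X l = g *m U ('i%C *: (real_complex R (ct l) *: E l)) *m star g.
Proof.
move=> XG sumX.
pose Y (k : nat) : M := (S (ct k))^-1 *: X (inord k).
have ct0 l : S (ct l) != 0 by rewrite fmorph_eq0 expf_neq0 ?pnatr_eq0.
have umct l : U ('i%C *: (real_complex R (ct l) *: E l)) = S (ct l) *: U ('i%C *: E l).
  by rewrite scalerA mulrC -scalerA umZ.
have YG k : (k <= r)%N -> exists2 g, G g & Y k = g *m U ('i%C *: E k) *m star g.
  move=> kr; have [g Gg gX] := XG (inord k); exists g => //.
  rewrite /Y gX umct -scalemxAr -scalemxAl scalerA inordK //.
  by rewrite mulVf // scale1r.
have XY (l : 'I_r.+1) : X l = S (ct l) *: Y l.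
  by rewrite /Y scalerA divff // scale1r inord_val.
have Ysk l : (l <= r)%N -> star (Y l) = - Y l.
  by move=> /YG [g Gg ->]; rewrite conj_skew // E_adj.
have Y3 l : (l <= r)%N -> Y l *m Y l *m Y l = - Y l.
  move=> /YG [g Gg ->]; rewrite !conjM // umii mulNmx -umM.
  by rewrite -scalemxAr E_cube mulmxN mulNmx.
have Ysum : \sum_(l < r) 2 ^+ (r - l.+1) *: Y l + Y r = 0.
  have ctE (k : nat) : S (ct k) = 2 ^+ (r - k.+1) by rewrite rmorphXn rmorph_nat.
  rewrite -[RHS]sumX big_ord_recr /= XY /= ctE.
  rewrite (_ : (r - r.+1)%N = 0%N) ?expr0 ?scale1r; last by apply/eqP; rewrite subn_eq0.
  by congr (_ + _); apply: eq_bigr => l _; rewrite XY ctE.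
have [[Jsk J3 J0 _] Yr] := flag_form Ysk Y3 Ysum.
pose J := flagJ Y.
(* h conjugates the last factor to its base point. *)
have [h Gh hY] := YG r (leqnn r).
have FY k : (k <= r)%N -> alg F (Y k).
  move=> /YG [g Gg ->]; apply: algM; last by apply: alg_star; exact: grp_alg.
  by apply: algM; [exact: grp_alg|exact: um_alg].
have FZ k : (k <= r)%N -> alg F (flagZ Y k).
  elim: k => [|k IH] kr /=.
    by rewrite -(scale0r (1%:M : M)) -(rmorph0 S); apply: algZ; exact: alg1.
  apply: algD; first exact: FY (ltnW kr).
  by rewrite -(rmorph_nat S 2); apply: algZ; apply: IH; exact: ltnW.
have FJ k : (k < r)%N -> alg F (J k).
  by move=> kr; apply: algD; [exact: FY (ltnW kr)|exact: FZ (ltnW kr)].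
have YE k : Y k = J k - flagZ Y k by rewrite /J /flagJ addrK.
have YY (k : 'I_r) : Y k *m Y k = J k *m J k + \sum_(s < r | (s < k)%N) J s *m J s.
  have JZ : J k *m flagZ Y k = 0.
    rewrite flagZE mulmx_sumr big1 // => s _; have sk := ltn_ord s.
    by rewrite J0 ?(ltn_trans sk) // gtn_eqF.
  have ZJ : flagZ Y k *m J k = 0.
    rewrite flagZE mulmx_suml big1 // => s _; have sk := ltn_ord s.
    by rewrite J0 ?(ltn_trans sk) // ltn_eqF.
  rewrite YE mulmxBl !mulmxBr JZ ZJ subr0 sub0r opprK; congr (_ + _).
  rewrite -(big_ord_widen r (fun s => J s *m J s)) 1?ltnW // flagZE mulmx_suml.
  apply: eq_bigr => s _; rewrite mulmx_sumr (bigD1 s) //= big1 ?addr0 // => t ts.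
  have sk := ltn_ord s; have tk := ltn_ord t.
  by rewrite J0 ?(ltn_trans sk) ?(ltn_trans tk) // eq_sym.
have trJ (s : 'I_r) : \tr (J s *m J s) = - \tr (U (Pi s)).
  have [k] := ubnP (s : nat); elim: k s => // k IH s; rewrite ltnS => sk.
  have [g Gg gY] := YG s (ltnW (ltn_ord s)).
  have : \tr (Y s *m Y s) = - \sum_(t < r | (t <= s)%N) \tr (U (Pi t)).
    rewrite gY conjM // conj_tr // umii linearN /= E_sqr um_sum; congr (- _).
    by rewrite linear_sum.
  rewrite YY linearD linear_sum /= [in RHS](bigD1 s) //=.
  have -> : \sum_(t < r | (t < s)%N) \tr (J t *m J t) =
      - \sum_(t < r | (t < s)%N) \tr (U (Pi t)).
    by rewrite -sumrN; apply: eq_bigr => t ts; apply: IH; exact: leq_trans ts sk.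
  rewrite [in RHS](eq_bigl (fun t : 'I_r => (t < s)%N)) => [|t]; last first.
    by rewrite ltn_neqAle andbC.
  by rewrite opprD => /addIr.
have Gh' : G (star h) by exact: grp_star.
have [g Gg Jg] : exists2 g, G g & forall s : 'I_r,
    star h *m J s *m star (star h) = g *m U ('i%C *: Pi s) *m star g.
  apply: structures_conj => //.
  - move=> s; apply: algM; last by apply: alg_star; exact: grp_alg.
    by apply: algM; [exact: grp_alg|exact: FJ].
  - by move=> s; rewrite !starM Jsk // !starK mulNmx mulmxN mulmxA.
  - by move=> s; rewrite !conjM // J3 // mulmxN mulNmx.
  - by move=> s t st; rewrite conjM // J0 // mulmx0 mul0mx.
  - rewrite -mulmx_suml -mulmx_sumr -flagZE -[flagZ Y r]opprK -Yr hY E_top.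
    rewrite starK scalerN umN !(mulmxN, mulNmx) ?opprK !mulmxA (grp_unitaryV Gh) mul1mx.
    by rewrite -mulmxA (grp_unitaryV Gh) mulmx1.
  - by move=> s; rewrite conjM // conj_tr // trJ.
have JE (s : 'I_r) : flagJ Y s = (h *m g) *m U ('i%C *: Pi s) *m star (h *m g).
  by have := Jg s; rewrite starK => e; rewrite starM -[LHS](conjK _ Gh) e !mulmxA.
exists (h *m g); first exact: grpM.
move=> l; rewrite XY umct -scalemxAr -scalemxAl; congr (_ *: _).
have [lr|] := ltnP l r; last first.
  move=> rl; have -> : l = r :> nat by apply/eqP; rewrite eqn_leq rl -ltnS ltn_ord.
  rewrite Yr E_top flagZE; under eq_bigr do rewrite JE.
  rewrite scalerN scaler_sumr umN um_sum mulmxN mulNmx mulmx_sumr mulmx_suml.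
  by [].
rewrite YE flagZE (big_ord_widen r (fun s => flagJ Y s)) 1?ltnW //.
have /= e1 := JE (Ordinal lr); have /= e2 := E_flag (Ordinal lr).
rewrite /J e1 e2 scalerBr umD umN mulmxDr mulmxN mulmxDl mulNmx.
congr (_ - _); rewrite scaler_sumr um_sum mulmx_sumr mulmx_suml.
by apply: eq_bigr => s _; rewrite JE.
Qed.

End LevelSet.


(** * Orbits in a unitary model *)

Section ModelMain.
Variables (R : realType) (K : numFieldType) (S : scalars R K) (p : nat).
Variables (F : compact_form S p) (n : nat) (U : unitary_model F n).
Local Notation C := R[i].
Local Notation M := 'M[K]_p.
Local Notation G := (grp F).
Local Notation star := (star S).
Local Notation rC := (real_complex R).

Lemma orbit_star (x : M) : Defs.orbit G x = [set g *m x *m star g | g in G].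
Proof.
by apply/seteqP; split=> _ [g Gg <-]; exists g; rewrite ?(grp_invmx Gg).
Qed.

(** G / H is defined with the stabilizer of x0, which is only conjugate to that of x. *)
Lemma quot_is_orbit_conj (H : set M) (x x0 k : M) :
  G k -> x = k *m x0 *m star k -> H = stab F (fun _ : 'I_1 => x0) ->
  quot_is_orbit S G H x.
Proof.
move=> Gk xk ->; exists (fun D => orbit_map S (fun _ : 'I_1 => x0) D ord0); split.
- exact: (orbit_map_embedding F (fun _ : 'I_1 => x0)).
- rewrite orbit_star; apply/seteqP; split=> [_ [_ [g Gg <-] <-]|_ [g Gg <-]].
    exists (g *m star k); first by apply: grpM => //; exact: grp_star.
    rewrite orbit_map_coset // xk starM starK !mulmxA -(mulmxA g) (grp_unitaryV Gk) mulmx1.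
    by rewrite -(mulmxA _ (star k) k) (grp_unitaryV Gk) mulmx1.
  exists (coset (g *m k) (stab F (fun _ : 'I_1 => x0))).
    by exists (g *m k) => //; exact: grpM.
  by rewrite orbit_map_coset ?xk ?starM ?mulmxA //; exact: grpM.
- move=> g _ Gg [h Gh <-].
  have -> : [set g *m y | y in coset h (stab F (fun _ : 'I_1 => x0))] =
      coset (g *m h) (stab F (fun _ : 'I_1 => x0)).
    apply/seteqP; split=> [_ [_ [y Hy <-] <-]|_ [y Hy <-]].
      by exists y => //; rewrite mulmxA.
    by exists (h *m y); [exists y|rewrite mulmxA].
  rewrite !orbit_map_coset ?(grp_invmx Gg) ?starM ?mulmxA //.
  exact: grpM.
Qed.

Variables (r : nat) (ns : 'I_r -> nat) (v : forall s, 'M[C]_(n, ns s)).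
Hypothesis v_iso : forall s, adj (v s) *m v s = 1%:M.
Hypothesis v_orth : forall s t, s != t -> adj (v s) *m v t = 0.
Let Pi s : 'M[C]_n := v s *m adj (v s).
Let E (l : nat) : 'M[C]_n := \sum_(s < r) flag_sign s l *: Pi s.
Let ct (l : nat) : R := 2 ^+ (r - l.+1).

Definition commutant : set M :=
  [set g | G g /\ forall s, g *m U ('i%C *: Pi s) = U ('i%C *: Pi s) *m g].

Variables (a : K) (L : 'I_r.+1 -> M).
Hypothesis a0 : a != 0.
Hypothesis LE : forall l : 'I_r.+1, a *: L l = U ('i%C *: (rC (ct l) *: E l)).

Lemma umZi t u : U ('i%C *: (rC t *: u)) = S t *: U ('i%C *: u).
Proof. by rewrite scalerA mulrC -scalerA umZ. Qed.

(** The system that expresses the Upsilon_l by the projections is triangular, with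
    powers of 2 on the diagonal. *)
Lemma Pi_span s : exists b : 'I_r.+1 -> R, Pi s = \sum_l rC (b l) *: (rC (ct l) *: E l).
Proof.
have [k] := ubnP (s : nat); elim: k s => // k IH s; rewrite ltnS => sk.
have {}IH (t : 'I_r) : exists b : 'I_r.+1 -> R, (t < s)%N ->
    Pi t = \sum_l rC (b l) *: (rC (ct l) *: E l).
  have [ts|_] := boolP (t < s)%N; last by exists (fun=> 0).
  by have [b bE] := IH t (leq_trans ts sk); exists b.
pose b t := projT1 (cid (IH t)).
have bE (t : 'I_r) : (t < s)%N -> Pi t = \sum_l rC (b t l) *: (rC (ct l) *: E l).
  exact: projT2 (cid (IH t)).
(* Pi s is Upsilon_s divided by its power of 2, plus the sum of the previous Pi t. *)
pose s' : 'I_r.+1 := widen_ord (leqnSn r) s.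
exists (fun l => (if l == s' then (ct s)^-1 else 0) + \sum_(t < r | (t < s)%N) b t l).
under eq_bigr do rewrite rmorphD scalerDl.
rewrite big_split /= (bigD1 s') //= eqxx big1 => [|l /negbTE ->]; last first.
  by rewrite rmorph0 scale0r.
rewrite addr0 scalerA -rmorphM mulVf ?expf_neq0 ?pnatr_eq0 // rmorph1 scale1r.
under [X in _ + X]eq_bigr do rewrite rmorph_sum scaler_suml.
rewrite exchange_big /=; under [X in _ + X]eq_bigr do rewrite -bE //.
by rewrite /E E_flag subrK.
Qed.

Let b s := projT1 (cid (Pi_span s)).

Lemma J0E s : U ('i%C *: Pi s) = \sum_l S (b s l) *: (a *: L l).
Proof.
rewrite {1}(projT2 (cid (Pi_span s))) -/(b s) scaler_sumr um_sum.
by apply: eq_bigr => l _; rewrite umZi -LE.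
Qed.

Lemma L_JE (l : 'I_r.+1) : a *: L l = \sum_(s < r) S (ct l * flag_sign s l) *: U ('i%C *: Pi s).
Proof.
rewrite LE /E !scaler_sumr um_sum; apply: eq_bigr => s _.
rewrite -umZi rmorphM -scalerA; congr (U (_ *: (_ *: (_ *: _)))); rewrite /flag_sign.
by (case: ifP => _; last case: ifP => _); rewrite ?rmorphN1 ?rmorph1 ?rmorph0.
Qed.

Lemma commutant_stab : commutant = stab F L.
Proof.
apply/seteqP; split=> g [Gg gc]; split=> // i.
  apply: (scalerI a0); rewrite scalemxAr scalemxAl L_JE mulmx_sumr mulmx_suml.
  by apply: eq_bigr => s _; rewrite -scalemxAr -scalemxAl gc.
rewrite J0E mulmx_sumr mulmx_suml; apply: eq_bigr => l _.
by rewrite -!scalemxAr -!scalemxAl gc.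
Qed.

Lemma conj_orbit_image : orbit_map S L @` quot G (stab F L) = conj_orbit F L.
Proof.
apply/seteqP; split=> [_ [_ [g Gg <-] <-]|x [g Gg xg]].
  by exists g => // l; rewrite orbit_map_coset.
exists (coset g (stab F L)); first by exists g.
by apply: funext => l; rewrite orbit_map_coset.
Qed.

Lemma L_moment : \sum_l a *: L l = 0.
Proof.
rewrite (eq_bigr _ (fun l _ => LE l)) -um_sum -scaler_sumr.
by rewrite E_sum_ct scaler0 um0.
Qed.

Lemma conj_orbit_level : conj_orbit F L = [set x | orbit_prod G L x /\ moment a x = 0].
Proof.
apply/seteqP; split=> [x Cx|x [xL x0]].
  split; last exact: (conj_orbit_moment L_moment Cx).
  by have [g Gg xg] := Cx; move=> l; rewrite orbit_star; exists g.
have [g Gg gE] : exists2 g, G g & forall l,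
    a *: x l = g *m U ('i%C *: (rC (ct l) *: E l)) *m star g.
  apply: level_set_conj => // l; have := xL l; rewrite orbit_star => -[g Gg gx].
  by exists g => //; rewrite -LE -gx -scalemxAr -scalemxAl.
by exists g => // l; apply: (scalerI a0); rewrite gE -LE -scalemxAr -scalemxAl.
Qed.

Theorem model_embedding (H : set M) : H = commutant ->
  exists phi : set M -> 'I_r.+1 -> M,
   [/\ embedding S G H phi, phi @` quot G H `<=` orbit_prod G L,
       isotropic S a G (phi @` quot G H)
     & phi @` quot G H = [set x | orbit_prod G L x /\ moment a x = 0]].
Proof.
move=> ->; rewrite commutant_stab; exists (orbit_map S L).
rewrite conj_orbit_image conj_orbit_level; split=> //.
- exact: orbit_map_embedding.
- by move=> x [].
rewrite -conj_orbit_level.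
have UU s t : U ('i%C *: Pi s) *m U ('i%C *: Pi t) = - U (if s == t then Pi s else 0).
  by rewrite umii PiPi.
apply: (@conj_orbit_isotropic R K S p F r.+1 r a L (fun s => U ('i%C *: Pi s))
  (fun s l => S (b s l)) (fun l s => S (ct l * flag_sign s l))).
- by move=> s t st; rewrite UU (negbTE st) um0 oppr0.
- move=> s; rewrite UU eqxx mulNmx -umM -scalemxAr.
  by rewrite PiPi // eqxx.
- exact: J0E.
- exact: L_JE.
- exact: L_moment.
Qed.

(** Changing the sign of some of the coordinates conjugates L to a multiple of a
    single partial complex structure, whose stabilizer is that of the quotient. *)
Variable blk : 'I_r -> 'I_n -> bool.
Hypothesis PiE : forall s, Pi s = diag_mx (\row_k (blk s k)%:R).

Theorem model_quot_is_orbit (l : 'I_r.+1) (H : set M) :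
  H = [set g | G g /\ g *m U ('i%C *: \sum_(s < r | (s <= l)%N) Pi s) =
     U ('i%C *: \sum_(s < r | (s <= l)%N) Pi s) *m g] ->
  quot_is_orbit S G H (L l).
Proof.
move=> HE; pose PL := \sum_(s < r | (s <= l)%N) Pi s.
pose e k := [exists s : 'I_r, (s < l)%N && blk s k].
have [g Gg gU] := um_flip U e.
(* The point whose stabilizer is H, with all its signs positive. *)
pose x0 : M := a^-1 *: (S (ct l) *: U ('i%C *: PL)).
apply: (quot_is_orbit_conj (x0 := x0) Gg); last first.
  rewrite HE; apply/seteqP; split=> h [Gh hc]; split=> //.
    by move=> _; rewrite /x0 -!scalemxAr -!scalemxAl hc.
  have := hc ord0; rewrite /x0 -!scalemxAr -!scalemxAl => /scalerI h1.
  by apply: scalerI (h1 _); rewrite ?invr_eq0 // fmorph_eq0 expf_neq0 ?pnatr_eq0.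
apply: (scalerI a0); rewrite LE umZi scalemxAl scalemxAr /x0 [a *: (_ *: _)]scalerA divff // scale1r.
rewrite -scalemxAr -scalemxAl; congr (_ *: _).
have PLE : PL = diag_mx (\row_k rC ((\sum_(s < r | (s <= l)%N) (blk s k)%:R))).
  rewrite /PL; under eq_bigr do rewrite PiE.
  rewrite -linear_sum; congr diag_mx; apply/rowP => k; rewrite !mxE summxE rmorph_sum.
  by apply: eq_bigr => s _; rewrite mxE rmorph_nat.
rewrite PLE gU; congr (U (_ *: _)); rewrite /E.
under eq_bigr do rewrite PiE -linearZ /=.
rewrite -linear_sum; congr diag_mx; apply/rowP => k; rewrite !mxE summxE.
rewrite mulr_sumr rmorph_sum [RHS]big_mkcond; apply: eq_bigr => s _; rewrite !mxE.
have [bk|] := boolP (blk s k); last by rewrite mulr0 mulr0 rmorph0 if_same.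
rewrite mulr1 mulr1 rmorphXn rmorphN1 /flag_sign.
case: ltngtP => // sl.
  by have -> : e k by apply/existsP; exists s; rewrite sl.
have -> // : e k = false.
apply/existsP => -[t /andP[tl bt]].
have ts : t != s by apply: contraTneq tl => ->; rewrite sl ltnn.
have := congr1 (fun A : 'M[C]_n => A k k) (PiPi v_iso v_orth t s).
rewrite (negbTE ts) -!/(Pi _) !PiE mulmx_diag !mxE eqxx bt bk mulr1 => /eqP.
by rewrite mulr1n oner_eq0.
Qed.

End ModelMain.

(** * Selection of coordinate blocks *)

Section Selection.
Variable T : pzRingType.

(** The inclusion of q coordinates, starting at o, in p coordinates. *)
Definition sel p q (o : nat) : 'M[T]_(p, q) := \matrix_(i, j) (i == o + j :> nat)%N%:R.

Definition offset r (q : 'I_r -> nat) (s : nat) := (\sum_(t < r | (t < s)%N) q t)%N.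

Lemma offsetS r (q : 'I_r -> nat) (s : 'I_r) :
  (\sum_(t < r | (t <= s)%N) q t)%N = (offset q s + q s)%N.
Proof.
rewrite (bigD1 s) //= addnC; congr (_ + _)%N; apply: eq_bigl => t.
by rewrite ltn_neqAle andbC.
Qed.

Lemma offset_le r (q : 'I_r -> nat) (s : 'I_r) t : (s < t)%N ->
  (offset q s + q s <= offset q t)%N.
Proof.
move=> st; rewrite -offsetS /offset [leqRHS](bigID (fun i : 'I_r => (i <= s)%N)) /=.
rewrite [X in (_ <= X + _)%N](eq_bigl (fun i : 'I_r => (i <= s)%N)) ?leq_addr // => i.
by case: (leqP i s) => [/leq_ltn_trans ->|]; rewrite ?andbF.
Qed.

Lemma offset_total r (q : 'I_r -> nat) (s : 'I_r) : (offset q s + q s <= \sum_t q t)%N.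
Proof.
rewrite -offsetS [leqRHS](bigID (fun i : 'I_r => (i <= s)%N)) /=.
by rewrite leq_addr.
Qed.

Variables (r p q0 : nat) (q : 'I_r -> nat).
Hypothesis e : (\sum_s q s + q0 = p)%N.
Let W s := sel p (q s) (offset q s).
Let W0 := sel p q0 (\sum_s q s).

Lemma sel_row : row_mx (\mxrow_s W s) W0 = castmx (e, erefl) 1%:M.
Proof.
apply/matrixP => i j; rewrite castmxE !mxE cast_ord_id.
case: (split_ordP j) => k ->; rewrite ?mxE.
  by rewrite /offset -tagnat.rect -val_eqE.
by rewrite -val_eqE.
Qed.

(** The identity matrix of size p, once its columns are cut into blocks, is the row of
    the selection matrices, and the cast amounts to conjugation by it. *)
Lemma castmx_block_mxdiag (B : forall s, 'M[T]_(q s)) (A : 'M[T]_q0) :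
  castmx (e, e) (block_mx (\mxdiag_s B s) 0 0 A) =
    \sum_s W s *m B s *m (W s)^T + W0 *m A *m W0^T.
Proof.
transitivity (castmx (e, erefl) 1%:M *m block_mx (\mxdiag_s B s) 0 0 A *m
    (castmx (e, erefl) 1%:M)^T).
  rewrite trmx_cast trmx1 /=; case: _ / e => /=.
  by rewrite !castmx_id mul1mx mulmx1.
rewrite -sel_row tr_row_mx mul_row_block !mulmx0 addr0 add0r mul_row_col; congr (_ + _).
by rewrite mul_mxrow_mxdiag tr_mxrow mul_mxrow_mxcol.
Qed.

Lemma sel_complete : \sum_s W s *m (W s)^T + W0 *m W0^T = 1%:M.
Proof.
have := castmx_block_mxdiag (fun=> 1%:M) 1%:M.
rewrite mxdiagZ -scalar_mx_block => h; rewrite mulmx1 in h.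
rewrite (eq_bigr (fun s => W s *m 1%:M *m (W s)^T)) => [|s _]; last by rewrite mulmx1.
rewrite -h; by case: _ / e; rewrite castmx_id.
Qed.

End Selection.

Section SelectionOrth.
Variable T : pzRingType.

Lemma sel_iso p q o : (o + q <= p)%N -> (sel T p q o)^T *m sel T p q o = 1%:M.
Proof.
move=> oq; apply/matrixP => i j; rewrite !mxE.
have ip : (o + i < p)%N by apply: leq_trans oq; rewrite ltn_add2l.
rewrite (bigD1 (Ordinal ip)) //= !mxE eqxx mul1r big1 ?addr0.
  by rewrite eqn_add2l.
by move=> k ki; rewrite !mxE (_ : _ == _ = false) ?mul0r //; apply: negbTE.
Qed.

Lemma sel_disj p q q' o o' : (o + q <= o')%N || (o' + q' <= o)%N ->
  (sel T p q o)^T *m sel T p q' o' = 0.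
Proof.
move=> oq; apply/matrixP => i j; rewrite !mxE big1 // => k _; rewrite !mxE.
case: eqP => [->|_]; last by rewrite mul0r.
case: eqP => [h|_]; last by rewrite mulr0.
by move: oq; have := ltn_ord i; have := ltn_ord j; lia.
Qed.

Lemma sel_diag p q o : sel T p q o *m (sel T p q o)^T =
  diag_mx (\row_k ((o <= k < o + q)%N)%:R).
Proof.
apply/matrixP => i j; rewrite !mxE.
have [/andP[oi iq]|oiq] := boolP (o <= i < o + q)%N.
  have iq' : (i - o < q)%N by lia.
  rewrite (bigD1 (Ordinal iq')) //= !mxE subnKC // eqxx mul1r big1 ?addr0.
    by rewrite (eq_sym (nat_of_ord j)) val_eqE; case: (i == j).
  move=> k ki; rewrite !mxE (_ : (i == _ :> nat) = false) ?mul0r //.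
  by apply: contraNF ki => /eqP h; apply/eqP/val_inj => /=; lia.
rewrite mul0rn big1 // => k _; rewrite !mxE (_ : (i == _ :> nat) = false) ?mul0r //.
by apply: contraNF oiq => /eqP ->; have := ltn_ord k; lia.
Qed.

Lemma map_sel (T' : pzRingType) (f : {rmorphism T -> T'}) p q o :
  map_mx f (sel T p q o) = sel T' p q o.
Proof. by apply/matrixP => i j; rewrite !mxE rmorph_nat. Qed.

Variables (r p q0 : nat) (q : 'I_r -> nat).
Hypothesis e : (\sum_s q s + q0 = p)%N.
Let W s := sel T p (q s) (offset q s).
Let W0 := sel T p q0 (\sum_s q s).

Lemma sel_frame_iso s : (W s)^T *m W s = 1%:M.
Proof. by apply: sel_iso; rewrite -e (leq_trans (offset_total q s)) ?leq_addr. Qed.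

Lemma sel_frame_orth s t : s != t -> (W s)^T *m W t = 0.
Proof.
move=> st; apply: sel_disj; move: st; rewrite neq_ltn => /orP[st|ts].
  by rewrite (offset_le _ st).
by rewrite (offset_le _ ts) orbT.
Qed.

Lemma sel_frame_orth0 s : (W s)^T *m W0 = 0.
Proof. by apply: sel_disj; rewrite offset_total. Qed.

Lemma sel_frame0_orth s : W0^T *m W s = 0.
Proof. by apply: sel_disj; rewrite offset_total orbT. Qed.

Lemma sel_frame0_iso : W0^T *m W0 = 1%:M.
Proof. by apply: sel_iso; rewrite e. Qed.

End SelectionOrth.

(** * Tensor products with 2 x 2 matrices *)

Lemma ord2P (x : 'I_2) : x = ord0 \/ x = ord_max.
Proof. by case: x => [] [|[|//]] h; [left|right]; apply: val_inj. Qed.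

Section Tensor.
Variable T : comPzRingType.

Lemma tensmxDl m n p q (A B : 'M[T]_(m, n)) (D : 'M[T]_(p, q)) :
  (A + B) *t D = A *t D + B *t D.
Proof. by apply/matrixP => i j; rewrite !mxE mulrDl. Qed.

Lemma tensmxDr m n p q (A : 'M[T]_(m, n)) (B D : 'M[T]_(p, q)) :
  A *t (B + D) = A *t B + A *t D.
Proof. by apply/matrixP => i j; rewrite !mxE mulrDr. Qed.

Lemma tensmxNl m n p q (A : 'M[T]_(m, n)) (D : 'M[T]_(p, q)) :
  (- A) *t D = - (A *t D).
Proof. by apply/matrixP => i j; rewrite !mxE mulNr. Qed.

Lemma tensmxNr m n p q (A : 'M[T]_(m, n)) (D : 'M[T]_(p, q)) :
  A *t (- D) = - (A *t D).
Proof. by apply/matrixP => i j; rewrite !mxE mulrN. Qed.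

Lemma tensmxZl m n p q a (A : 'M[T]_(m, n)) (D : 'M[T]_(p, q)) :
  (a *: A) *t D = a *: (A *t D).
Proof. by apply/matrixP => i j; rewrite !mxE mulrA. Qed.

Lemma tens1mx1 m n : (1%:M : 'M[T]_m) *t (1%:M : 'M[T]_n) = 1%:M.
Proof.
apply/matrixP => i j.
case: (mxtens_indexP i) => i0 i1; case: (mxtens_indexP j) => j0 j1.
by rewrite tensmxE !mxE -natrM mulnb (can_eq (@mxtens_indexK m n)).
Qed.

Lemma big_mxtens m n (V : nmodType) (f : 'I_(m * n) -> V) :
  \sum_i f i = \sum_i \sum_j f (mxtens_index (i, j)).
Proof.
rewrite pair_bigA /= (reindex (@mxtens_index m n)) /=.
  by apply: eq_bigr => -[].
by exists (@mxtens_unindex m n) => i _; rewrite ?mxtens_indexK ?mxtens_unindexK.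
Qed.

Lemma mul_tens1r k (X : 'M[T]_(k * 2)) (D : 'M[T]_2) a x b y :
  (X *m ((1%:M : 'M[T]_k) *t D)) (mxtens_index (a, x)) (mxtens_index (b, y)) =
  \sum_z X (mxtens_index (a, x)) (mxtens_index (b, z)) * D z y.
Proof.
rewrite mxE big_mxtens (bigD1 b) //= [X in _ + X]big1 ?addr0.
  by apply: eq_bigr => z _; rewrite tensmxE !mxE eqxx mul1r.
move=> c cb; rewrite big1 // => z _.
by rewrite tensmxE mxE (negbTE cb) mul0r mulr0.
Qed.

Lemma mul_tens1l k (X : 'M[T]_(k * 2)) (D : 'M[T]_2) a x b y :
  (((1%:M : 'M[T]_k) *t D) *m X) (mxtens_index (a, x)) (mxtens_index (b, y)) =
  \sum_z D x z * X (mxtens_index (a, z)) (mxtens_index (b, y)).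
Proof.
rewrite mxE big_mxtens (bigD1 a) //= [X in _ + X]big1 ?addr0.
  by apply: eq_bigr => z _; rewrite tensmxE !mxE eqxx mul1r.
move=> c ca; rewrite big1 // => z _.
by rewrite tensmxE mxE eq_sym (negbTE ca) !mul0r.
Qed.

Lemma tens_matrixP k (X Y : 'M[T]_(k * 2)) :
  (forall a x b y, X (mxtens_index (a, x)) (mxtens_index (b, y)) =
     Y (mxtens_index (a, x)) (mxtens_index (b, y))) -> X = Y.
Proof.
move=> h; apply/matrixP => i j.
by case: (mxtens_indexP i) => i0 i1; case: (mxtens_indexP j) => j0 j1.
Qed.

Lemma sel_tens p q o : sel T (p * 2) (q * 2) (o * 2) = sel T p q o *t (1%:M : 'M[T]_2).
Proof.
apply/matrixP => i j.
case: (mxtens_indexP i) => i0 i1; case: (mxtens_indexP j) => j0 j1.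
rewrite tensmxE !mxE /= -natrM mulnb; congr (_%:R); congr (nat_of_bool _).
have := ltn_ord i1; have := ltn_ord j1; rewrite -val_eqE /=.
move: (nat_of_ord i0) (nat_of_ord i1) (nat_of_ord j0) (nat_of_ord j1) => a b c d.
by move=> *; apply/eqP/andP => [h|[/eqP h /eqP ->]]; [split; apply/eqP; lia|lia].
Qed.

Lemma J2_sqr : (J2 : 'M[T]_2) *m J2 = - 1%:M.
Proof.
apply/matrixP => i j; rewrite !mxE !big_ord_recl big_ord0 !mxE /=.
case: i => [] [|[|//]] ? /=; case: j => [] [|[|//]] ? /=;
 rewrite ?mxE /=; ring.
Qed.

Lemma J2_tr : (J2 : 'M[T]_2)^T = - J2.
Proof. by apply/matrixP => i j; rewrite !mxE opprB. Qed.

Lemma big_ord2 (V : nmodType) (f : 'I_2 -> V) : \sum_z f z = f ord0 + f ord_max.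
Proof.
by rewrite !big_ord_recl big_ord0 addr0; congr (_ + f _); apply: val_inj.
Qed.

Lemma mul_tensJr k (X : 'M[T]_(k * 2)) a x b y :
  (X *m (1%:M *t J2)) (mxtens_index (a, x)) (mxtens_index (b, y)) =
  if y == ord0 then - X (mxtens_index (a, x)) (mxtens_index (b, ord_max))
  else X (mxtens_index (a, x)) (mxtens_index (b, ord0)).
Proof.
rewrite mul_tens1r big_ord2; case: (ord2P y) => ->; rewrite !mxE /=.
  by rewrite subrr sub0r mulr0 add0r mulrN1.
by rewrite subr0 subrr mulr1 mulr0 addr0.
Qed.

Lemma mul_tensJl k (X : 'M[T]_(k * 2)) a x b y :
  ((1%:M *t J2) *m X) (mxtens_index (a, x)) (mxtens_index (b, y)) =
  if x == ord0 then X (mxtens_index (a, ord_max)) (mxtens_index (b, y))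
  else - X (mxtens_index (a, ord0)) (mxtens_index (b, y)).
Proof.
rewrite mul_tens1l big_ord2; case: (ord2P x) => ->; rewrite !mxE /=.
  by rewrite subrr subr0 mul0r add0r mul1r.
by rewrite sub0r subrr mulN1r mul0r addr0.
Qed.

Lemma mul_tens_sigma3r k (X : 'M[T]_(k * 2)) a x b y :
  (X *m (1%:M *t sigma3)) (mxtens_index (a, x)) (mxtens_index (b, y)) =
  if y == ord0 then X (mxtens_index (a, x)) (mxtens_index (b, y))
  else - X (mxtens_index (a, x)) (mxtens_index (b, y)).
Proof.
rewrite mul_tens1r big_ord2; case: (ord2P y) => ->; rewrite !mxE /=.
  by rewrite mulr1n mulr0n mulr1 mulr0 addr0.
by rewrite mulr1n mulr0n mulr0 add0r mulrN1.
Qed.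

Lemma mul_tens_sigma3l k (X : 'M[T]_(k * 2)) a x b y :
  ((1%:M *t sigma3) *m X) (mxtens_index (a, x)) (mxtens_index (b, y)) =
  if x == ord0 then X (mxtens_index (a, x)) (mxtens_index (b, y))
  else - X (mxtens_index (a, x)) (mxtens_index (b, y)).
Proof.
rewrite mul_tens1l big_ord2; case: (ord2P x) => ->; rewrite !mxE /=.
  by rewrite mulr1n mulr0n mul1r mul0r addr0.
by rewrite mulr1n mulr0n mul0r add0r mulN1r.
Qed.

End Tensor.

(** * Complex matrices as real matrices *)

Section RealForm.
Variable R : realType.
Local Notation C := R[i].
Local Notation mxRe := (map_mx (@complex.Re R)).
Local Notation mxIm := (map_mx (@complex.Im R)).

Lemma mxRe_mul m n p (u : 'M[C]_(m, n)) (v : 'M[C]_(n, p)) :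
  mxRe (u *m v) = mxRe u *m mxRe v - mxIm u *m mxIm v.
Proof.
apply/matrixP => i j; rewrite !mxE raddf_sum -sumrB; apply: eq_bigr => k _.
by rewrite !mxE; case: (u i k) => a b; case: (v k j) => c d.
Qed.

Lemma mxIm_mul m n p (u : 'M[C]_(m, n)) (v : 'M[C]_(n, p)) :
  mxIm (u *m v) = mxRe u *m mxIm v + mxIm u *m mxRe v.
Proof.
apply/matrixP => i j; rewrite !mxE raddf_sum -big_split; apply: eq_bigr => k _.
by rewrite !mxE; case: (u i k) => a b; case: (v k j) => c d.
Qed.

Lemma U_SO_mul k (u v : 'M[C]_k) : U_SO (u *m v) = U_SO u *m U_SO v.
Proof.
rewrite /U_SO mxRe_mul mxIm_mul mulmxDl !mulmxDr !tensmx_mul !mulmx1 !mul1mx J2_sqr.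
by rewrite tensmxNr !tensmxDl tensmxNl -!addrA; congr (_ + _); rewrite addrC addrA addrC.
Qed.

Lemma U_SO_add k (u v : 'M[C]_k) : U_SO (u + v) = U_SO u + U_SO v.
Proof. by rewrite /U_SO !map_mxD !tensmxDl addrACA. Qed.

Lemma U_SO_scale k t (u : 'M[C]_k) : U_SO (real_complex R t *: u) = t *: U_SO u.
Proof.
rewrite /U_SO (_ : map_mx _ _ = t *: mxRe u); last first.
  by apply/matrixP => i j; rewrite !mxE; case: (u i j) => a b /=; rewrite mul0r subr0.
rewrite (_ : map_mx _ (_ *: _) = t *: mxIm u); last first.
  by apply/matrixP => i j; rewrite !mxE; case: (u i j) => a b /=; rewrite mul0r addr0.
by rewrite !tensmxZl scalerDr.
Qed.

Lemma U_SO_adj k (u : 'M[C]_k) : U_SO (adj u) = (U_SO u)^T.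
Proof.
have trD (A B : 'M[R]_(k * 2)) : (A + B)^T = A^T + B^T by rewrite linearD.
rewrite /U_SO trD !trmx_tens trmx1 J2_tr tensmxNr -tensmxNl.
rewrite (_ : map_mx _ (adj u) = (mxRe u)^T); last first.
  by apply/matrixP => i j; rewrite !mxE; case: (u j i).
rewrite (_ : map_mx _ (adj u) = - (mxIm u)^T) //.
by apply/matrixP => i j; rewrite !mxE; case: (u j i).
Qed.

Lemma U_SO1 k : U_SO (1%:M : 'M[C]_k) = 1%:M.
Proof.
have e1 : mxRe (1%:M : 'M[C]_k) = 1%:M.
  by apply/matrixP => i j; rewrite !mxE; case: (i == j).
have e2 : mxIm (1%:M : 'M[C]_k) = 0.
  by apply/matrixP => i j; rewrite !mxE; case: (i == j).
by rewrite /U_SO e1 e2 tens0mx addr0 tens1mx1.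
Qed.

Lemma U_SOi k (N : 'M[R]_k) :
  U_SO ('i%C *: map_mx (real_complex R) N) = N *t J2.
Proof.
have e1 : mxRe ('i%C *: map_mx (real_complex R) N) = 0.
  by apply/matrixP => i j; rewrite !mxE /= mul0r mulr0 subr0.
have e2 : mxIm ('i%C *: map_mx (real_complex R) N) = N.
  by apply/matrixP => i j; rewrite !mxE /= mul0r mul1r add0r.
by rewrite /U_SO e1 e2 tens0mx add0r.
Qed.

Lemma U_SOE k (u : 'M[C]_k) a x b y :
  U_SO u (mxtens_index (a, x)) (mxtens_index (b, y)) =
  complex.Re (u a b) *+ (x == y) + complex.Im (u a b) * J2 x y.
Proof. by rewrite mxE !tensmxE !mxE mulr_natr. Qed.

Lemma U_SO_inj k : injective (@U_SO R k).
Proof.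
move=> u v uv; apply/matrixP => a b.
have h y := congr1 (fun X : 'M[R]_(k * 2) => X (mxtens_index (a, ord0)) (mxtens_index (b, y))) uv.
have := h ord0; have := h ord_max; rewrite !U_SOE !mxE /=.
rewrite ?(subr0, mulr0, mulr1, addr0, mulr0n, mulr1n, add0r). 
by case: (u a b) => ? ?; case: (v a b) => ? ? /= -> ->.
Qed.

(** Among the four real entries over a pair of indices, commuting with J leaves the
    real and the imaginary part of one complex number. *)
Lemma U_SO_commutant k (X : 'M[R]_(k * 2)) :
  X *m (1%:M *t J2) = (1%:M *t J2) *m X -> exists u, X = U_SO u.
Proof.
move=> XJ; exists (\matrix_(a, b) (X (mxtens_index (a, ord0)) (mxtens_index (b, ord0)) +i*
  X (mxtens_index (a, ord0)) (mxtens_index (b, ord_max)))%C).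
apply: tens_matrixP => a x b y; rewrite U_SOE !mxE /=.
have h x y := congr1 (fun Y : 'M[R]_(k * 2) => Y (mxtens_index (a, x)) (mxtens_index (b, y))) XJ.
have := h ord0 ord0; have := h ord0 ord_max.
rewrite !mul_tensJr !mul_tensJl /= => h1 h2.
case: (ord2P x) => ->; case: (ord2P y) => -> /=.
- by rewrite subrr mulr0 addr0.
- by rewrite subr0 mulr1 add0r.
- by rewrite sub0r mulrN1 add0r -h2.
- by rewrite subrr mulr0 addr0 -h1.
Qed.

End RealForm.

(** * Complex matrices as quaternionic matrices *)

Section QuaternionicForm.
Variables (T : numFieldType) (c : {rmorphism T -> T}).

(** The sum of the standard representation and of its conjugate. *)
Definition conj_sum k (u : 'M[T]_k) : 'M[T]_(k * 2) :=
  u *t delta_mx 0 0 + map_mx c u *t delta_mx 1 1.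

Lemma conj_sumM k (u v : 'M[T]_k) : conj_sum (u *m v) = conj_sum u *m conj_sum v.
Proof.
rewrite /conj_sum map_mxM mulmxDl !mulmxDr !tensmx_mul !mul_delta_mx_cond /=.
by rewrite !mulr0n !mulr1n !tensmx0 addr0 add0r.
Qed.

Lemma conj_sumD k (u v : 'M[T]_k) : conj_sum (u + v) = conj_sum u + conj_sum v.
Proof. by rewrite /conj_sum map_mxD !tensmxDl addrACA. Qed.

Lemma conj_sumZ k t (u : 'M[T]_k) : c t = t -> conj_sum (t *: u) = t *: conj_sum u.
Proof. by move=> ct; rewrite /conj_sum map_mxZ ct !tensmxZl scalerDr. Qed.

Lemma conj_sum_adj k (u : 'M[T]_k) :
  conj_sum (map_mx c u)^T = (map_mx c (conj_sum u))^T.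
Proof.
have trD (A B : 'M[T]_(k * 2)) : (A + B)^T = A^T + B^T by rewrite linearD.
rewrite /conj_sum map_mxD trD !map_mxT !trmx_tens !map_delta_mx !trmx_delta.
by rewrite !map_trmx.
Qed.

Lemma conj_sum1 k : conj_sum (1%:M : 'M[T]_k) = 1%:M.
Proof.
rewrite /conj_sum map_mx1 -tensmxDr (_ : delta_mx 0 0 + delta_mx 1 1 = 1%:M) ?tens1mx1 //.
apply/matrixP => i j; rewrite !mxE.
by case: (ord2P i) => ->; case: (ord2P j) => ->; rewrite /= ?addr0 ?add0r.
Qed.

Lemma conj_sumE k (u : 'M[T]_k) a x b y :
  conj_sum u (mxtens_index (a, x)) (mxtens_index (b, y)) =
  (if x == ord0 then u a b else c (u a b)) *+ (x == y).
Proof.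
rewrite mxE !tensmxE !mxE.
by case: (ord2P x) => ->; case: (ord2P y) => ->;
  rewrite /= ?mulr0 ?mulr1 ?addr0 ?add0r.
Qed.

Lemma conj_sumi k (z : T) (N : 'M[T]_k) : c z = - z -> map_mx c N = N ->
  conj_sum (z *: N) = z *: (N *t sigma3).
Proof.
move=> cz cN; apply: tens_matrixP => a x b y; rewrite conj_sumE [RHS]mxE tensmxE !mxE.
have -> : c (z * N a b) = - (z * N a b).
  by rewrite rmorphM cz mulNr; congr (- (_ * _)); rewrite -[in RHS]cN mxE.
case: (ord2P x) => ->; case: (ord2P y) => -> //=.
- by rewrite !mulr1n mulr1.
- by rewrite !mulr0.
- by rewrite !mulr0.
- by rewrite !mulr1n mulrN1 mulrN.
Qed.

Lemma conj_sum_inj k : injective (@conj_sum k).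
Proof.
move=> u v uv; apply/matrixP => a b.
have := congr1 (fun X : 'M[T]_(k * 2) => X (mxtens_index (a, ord0)) (mxtens_index (b, ord0))) uv.
by rewrite !conj_sumE.
Qed.

(** Matrices that commute with the antilinear map v |-> J (conj v), whose square is -1:
    they are the matrices with entries in the quaternions. *)
Definition quaternionic k : set 'M[T]_(k * 2) :=
  [set X | (1%:M *t J2) *m X = map_mx c X *m (1%:M *t J2)].

Lemma conj_sum_quaternionic k (u : 'M[T]_k) : involutive c -> quaternionic (conj_sum u).
Proof.
move=> cK; apply: tens_matrixP => a x b y; rewrite mul_tensJr mul_tensJl ![map_mx c _ _ _]mxE !conj_sumE.
have uE : c (c (u a b)) = u a b by rewrite cK.
by case: (ord2P x) => ->; case: (ord2P y) => -> /=;
  rewrite ?mulr0n ?mulr1n ?rmorph0 ?oppr0 ?uE.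
Qed.

(** Commuting with sigma3 kills the entries that mix the two vectors of a pair, and
    the quaternionic relation makes the two remaining ones conjugate. *)
Lemma conj_sum_commutant k (X : 'M[T]_(k * 2)) : quaternionic X ->
  X *m (1%:M *t sigma3) = (1%:M *t sigma3) *m X -> exists u, X = conj_sum u.
Proof.
move=> qX Xs; exists (\matrix_(a, b) X (mxtens_index (a, ord0)) (mxtens_index (b, ord0))).
apply: tens_matrixP => a x b y; rewrite conj_sumE !mxE.
have h x y := congr1 (fun Y : 'M[T]_(k * 2) => Y (mxtens_index (a, x)) (mxtens_index (b, y))) Xs.
have hq x y := congr1 (fun Y : 'M[T]_(k * 2) => Y (mxtens_index (a, x)) (mxtens_index (b, y))) qX.
have := h ord0 ord_max; have := h ord_max ord0; have := hq ord0 ord_max.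
rewrite mul_tensJr mul_tensJl 2!mul_tens_sigma3r 2!mul_tens_sigma3l /= => h1 h2 h3.
have opp0 (z : T) : z = - z -> z = 0.
  by move/eqP; rewrite -addr_eq0 -mulr2n mulrn_eq0 => /eqP.
case: (ord2P x) => ->; case: (ord2P y) => -> /=.
- by [].
- exact: opp0.
- exact: opp0.
- by rewrite h1 mxE.
Qed.

End QuaternionicForm.

(** * Commutants and frames *)

Section Frames.
Variables (T : comPzRingType) (r p q0 : nat) (q : 'I_r -> nat).
Variables (W : forall s, 'M[T]_(p, q s)) (W0 : 'M[T]_(p, q0)).
Variable N : forall s, 'M[T]_(q s).
Hypothesis W_iso : forall s, (W s)^T *m W s = 1%:M.
Hypothesis W_orth : forall s t, s != t -> (W s)^T *m W t = 0.
Hypothesis W_full : \sum_s W s *m (W s)^T + W0 *m W0^T = 1%:M.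
Hypothesis N_sqr : forall s, N s *m N s = - 1%:M.

(** The projection on the image of W_s is - (W_s N_s W_s^T)^2, so X commutes with all
    these projections and is block diagonal. *)
Lemma commute_frames (X : 'M[T]_p) :
  (forall s, X *m (W s *m N s *m (W s)^T) = (W s *m N s *m (W s)^T) *m X) ->
  [/\ forall s, X *m (W s *m (W s)^T) = (W s *m (W s)^T) *m X,
      forall s, ((W s)^T *m X *m W s) *m N s = N s *m ((W s)^T *m X *m W s),
      X *m (W0 *m W0^T) = (W0 *m W0^T) *m X
    & X = \sum_s W s *m ((W s)^T *m X *m W s) *m (W s)^T +
      W0 *m (W0^T *m X *m W0) *m W0^T].
Proof.
move=> XN.
have PE s : W s *m (W s)^T =
    - ((W s *m N s *m (W s)^T) *m (W s *m N s *m (W s)^T)).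
  rewrite !mulmxA -(mulmxA _ (W s)^T (W s)) W_iso mulmx1 -(mulmxA (W s)) N_sqr.
  by rewrite mulmxN mulmx1 mulNmx opprK.
have XP s : X *m (W s *m (W s)^T) = (W s *m (W s)^T) *m X.
  rewrite PE; move: (XN s); set m := W s *m N s *m _ => c.
  by rewrite mulmxN mulNmx mulmxA c -mulmxA c mulmxA.
have P0E : W0 *m W0^T = 1%:M - \sum_s W s *m (W s)^T by rewrite -W_full addrC addKr.
have XP0 : X *m (W0 *m W0^T) = (W0 *m W0^T) *m X.
  rewrite P0E mulmxBr mulmxBl mulmx1 mul1mx mulmx_sumr mulmx_suml; congr (_ - _).
  by apply: eq_bigr => s _.
have PP s : (W s *m (W s)^T) *m (W s *m (W s)^T) = W s *m (W s)^T.
  by rewrite mulmxA -(mulmxA _ (W s)^T (W s)) W_iso mulmx1.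
have P00 : (W0 *m W0^T) *m (W0 *m W0^T) = W0 *m W0^T.
  rewrite {2}P0E mulmxBr mulmx1 mulmx_sumr big1 ?subr0 // => s _.
  rewrite P0E mulmxBl mul1mx mulmx_suml (bigD1 s) //= PP big1 ?addr0 ?subrr // => t ts.
  by rewrite mulmxA -(mulmxA _ (W t)^T) W_orth // mulmx0 mul0mx.
split=> //.
- move=> s; have e : X *m W s *m N s = W s *m N s *m ((W s)^T *m X *m W s).
    have := congr1 (fun A : 'M[T]_p => A *m W s) (XN s).
    by rewrite -!mulmxA W_iso mulmx1 !mulmxA.
  rewrite -!mulmxA [X *m _]mulmxA e !mulmxA W_iso mul1mx.
  by [].
- rewrite -{1}[X]mul1mx -W_full mulmxDl mulmx_suml; congr (_ + _).
    apply: eq_bigr => s _; rewrite -{1}PP -mulmxA -XP !mulmxA.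
    by [].
  by rewrite -{1}P00 -mulmxA -XP0 !mulmxA.
Qed.

End Frames.

Section FrameAlgebra.
Variables (T : comPzRingType) (r p q0 : nat) (q : 'I_r -> nat).
Variables (W : forall s, 'M[T]_(p, q s)) (W0 : 'M[T]_(p, q0)).
Hypothesis W_iso : forall s, (W s)^T *m W s = 1%:M.
Hypothesis W_orth : forall s t, s != t -> (W s)^T *m W t = 0.
Hypothesis W0_iso : W0^T *m W0 = 1%:M.
Hypothesis W_orth0 : forall s, (W s)^T *m W0 = 0.
Hypothesis W0_orth : forall s, W0^T *m W s = 0.

Definition frame_mx (B : forall s, 'M[T]_(q s)) (A : 'M[T]_q0) : 'M[T]_p :=
  \sum_s W s *m B s *m (W s)^T + W0 *m A *m W0^T.

Lemma mul_frame_mxl B A s : (W s)^T *m frame_mx B A = B s *m (W s)^T.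
Proof.
rewrite mulmxDr mulmx_sumr (bigD1 s) //= !mulmxA W_iso mul1mx W_orth0 !mul0mx addr0.
by rewrite big1 ?addr0 // => t ts; rewrite !mulmxA W_orth 1?eq_sym // !mul0mx.
Qed.

Lemma mul_frame_mxr B A s : frame_mx B A *m W s = W s *m B s.
Proof.
rewrite mulmxDl mulmx_suml (bigD1 s) //= -!mulmxA W_iso mulmx1 W0_orth !mulmx0 addr0.
by rewrite big1 ?addr0 // => t ts; rewrite -!mulmxA W_orth // !mulmx0.
Qed.

Lemma mul_frame_mx0 B A : W0^T *m frame_mx B A = A *m W0^T.
Proof.
rewrite mulmxDr mulmx_sumr !mulmxA W0_iso mul1mx big1 ?add0r // => t _.
by rewrite !mulmxA W0_orth !mul0mx.
Qed.

Lemma mul_frame_mx B A B' A' :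
  frame_mx B A *m frame_mx B' A' = frame_mx (fun s => B s *m B' s) (A *m A').
Proof.
rewrite {1}/frame_mx mulmxDl mulmx_suml; congr (_ + _).
  by apply: eq_bigr => s _; rewrite -mulmxA mul_frame_mxl !mulmxA.
by rewrite -mulmxA mul_frame_mx0 !mulmxA.
Qed.

Lemma frame_mx_tr B A : (frame_mx B A)^T = frame_mx (fun s => (B s)^T) A^T.
Proof.
have trD (X Y : 'M[T]_p) : (X + Y)^T = X^T + Y^T by rewrite linearD.
rewrite /frame_mx trD linear_sum !trmx_mul trmxK mulmxA; congr (_ + _).
by apply: eq_bigr => s _ /=; rewrite !trmx_mul trmxK mulmxA.
Qed.

Lemma frame_mx_commute B A (N : forall s, 'M[T]_(q s)) s : B s *m N s = N s *m B s ->
  frame_mx B A *m (W s *m N s *m (W s)^T) = (W s *m N s *m (W s)^T) *m frame_mx B A.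
Proof.
move=> BN; rewrite !mulmxA mul_frame_mxr -(mulmxA _ (B s)) BN.
by rewrite -[RHS]mulmxA mul_frame_mxl !mulmxA.
Qed.

End FrameAlgebra.

Lemma sel_col (T : pzRingType) p q o : (o + q <= p)%N ->
  sel T (p + 1) q o = col_mx (sel T p q o) 0.
Proof.
move=> oq; apply/matrixP => i j; rewrite mxE; case: (split_ordP i) => k ->.
  by rewrite col_mxEu mxE.
rewrite col_mxEd mxE /= (_ : _ == _ = false) //; apply/eqP => h.
by have := ltn_ord j; lia.
Qed.

Lemma offset_mul2 r (ns : 'I_r -> nat) s :
  offset (fun t => (ns t * 2)%N) s = (offset ns s * 2)%N.
Proof. by rewrite /offset big_distrl. Qed.

Lemma det_castmx (T : comPzRingType) m n (e : m = n) (A : 'M[T]_m) :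
  \det (castmx (e, e) A) = \det A.
Proof. by case: _ / e; rewrite castmx_id. Qed.

Lemma det_mxdiag (T : comPzRingType) r (q : 'I_r -> nat) (B : forall s, 'M[T]_(q s)) :
  \det (\mxdiag_s B s) = \prod_s \det (B s).
Proof.
elim: r q B => [|r IH] q B; last first.
  by rewrite mxdiag_recl det_castmx det_ublock big_ord_recl IH.
have det0 k (A : 'M[T]_k) : k = 0%N -> \det A = 1.
  by move=> k0; move: A; rewrite k0 => A; rewrite det_mx00.
by rewrite det0 big_ord0.
Qed.

(** * The determinant of a complex matrix seen as a real one *)

(** The square root of a unitary matrix, from its spectral decomposition. *)
Lemma unitary_sqrt (C : numClosedFieldType) k (u : 'M[C]_k) : u \is unitarymx ->
  exists2 w : 'M[C]_k, w \is unitarymx & u = w *m w.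
Proof.
move=> uu; pose ad (A : 'M[C]_k) := map_mx Num.conj A^T.
have adM A B : ad (A *m B) = ad B *m ad A by rewrite /ad trmx_mul map_mxM.
have adK A : ad (ad A) = A by exact: trmxCK.
have uau : u *m ad u = 1%:M by exact/unitarymxP.
have nu : u \is normalmx by apply/normalmxP; rewrite uau (mulmx1C uau).
have /orthomx_spectralP uE := nu.
set V := spectralmx u in uE; set d := spectral_diag u in uE.
have Vu : V \is unitarymx := spectral_unitarymx u.
have Vi : invmx V = ad V by rewrite invmx_unitary.
have VV : V *m ad V = 1%:M by exact/unitarymxP.
have VV' : ad V *m V = 1%:M by apply: mulmx1C.
rewrite Vi in uE.
have dE : diag_mx d = V *m u *m ad V.
  by rewrite uE !mulmxA VV mul1mx -mulmxA VV mulmx1.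
have dd : diag_mx d *m ad (diag_mx d) = 1%:M.
  rewrite dE !adM adK !mulmxA -(mulmxA _ (ad V) V) VV' mulmx1 -(mulmxA V) uau.
  by rewrite mulmx1.
have ad_diag (v : 'rV[C]_k) : ad (diag_mx v) = diag_mx (map_mx Num.conj v).
  by rewrite /ad tr_diag_mx map_diag_mx.
have d1 i : `|d 0 i| = 1.
  have := congr1 (fun A : 'M[C]_k => A i i) dd.
  rewrite ad_diag mulmx_diag !mxE eqxx /= !mulr1n -normCK => /eqP.
  by rewrite sqrp_eq1 // => /eqP.
pose D := diag_mx (map_mx sqrtC d).
have DD : D *m D = diag_mx d.
  rewrite /D mulmx_diag; congr diag_mx; apply/rowP => i.
  by rewrite !mxE -expr2 sqrtCK.
have DaD : D *m ad D = 1%:M.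
  rewrite /D ad_diag mulmx_diag; apply/matrixP => i j; rewrite !mxE.
  by rewrite -normCK norm_rootC d1 rootC1 // expr1n.
exists (ad V *m D *m V).
  apply/unitarymxP; rewrite -/(ad _) !adM adK !mulmxA -(mulmxA _ V (ad V)) VV mulmx1.
  by rewrite -(mulmxA _ D) DaD mulmx1.
by rewrite !mulmxA -(mulmxA _ V (ad V)) VV mulmx1 -(mulmxA (ad V) D D) DD.
Qed.

Section DetUSO.
Variable R : realType.
Local Notation C := R[i].

Lemma U_SO_orth k (u : 'M[C]_k) : u \is unitarymx -> U_SO u *m (U_SO u)^T = 1%:M.
Proof. by move=> /unitarymx_adj uu; rewrite -U_SO_adj -U_SO_mul uu U_SO1. Qed.

(** With u = w w, the determinant is the square of that of an orthogonal matrix. *)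
Lemma det_U_SO k (u : 'M[C]_k) : u \is unitarymx -> \det (U_SO u) = 1.
Proof.
move=> /unitary_sqrt [w wu ->]; rewrite U_SO_mul det_mulmx.
by rewrite -{2}(det_tr (U_SO w)) -det_mulmx U_SO_orth // det1.
Qed.

End DetUSO.

(** * Change of orientation of coordinate planes *)

Section Flip.
Variables (T : comPzRingType) (n : nat).

Definition diag_fun (f : 'I_n -> T) : 'M[T]_n := diag_mx (\row_k f k).

Lemma diag_funM f g : diag_fun f *m diag_fun g = diag_fun (fun k => f k * g k).
Proof. by rewrite /diag_fun mulmx_diag; congr diag_mx; apply/rowP => k; rewrite !mxE. Qed.

Lemma diag_funD f g : diag_fun f + diag_fun g = diag_fun (fun k => f k + g k).
Proof. by rewrite /diag_fun -linearD; congr diag_mx; apply/rowP => k; rewrite !mxE. Qed.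

Lemma eq_diag_fun f g : f =1 g -> diag_fun f = diag_fun g.
Proof. by move=> fg; congr diag_mx; apply/rowP => k; rewrite !mxE. Qed.

Lemma diag_fun0 f : (forall k, f k = 0) -> diag_fun f = 0.
Proof. by move=> f0; apply/matrixP => i j; rewrite !mxE f0 mul0rn. Qed.

Lemma diag_fun1 f : (forall k, f k = 1) -> diag_fun f = 1%:M.
Proof. by move=> f1; apply/matrixP => i j; rewrite !mxE f1. Qed.

Definition flip (e : 'I_n -> bool) (B : 'M[T]_2) : 'M[T]_(n * 2) :=
  diag_fun (fun k => (~~ e k)%:R) *t 1%:M + diag_fun (fun k => (e k)%:R) *t B.

Lemma flip_conj (N B B' : 'M[T]_2) (e : 'I_n -> bool) (d : 'I_n -> T) :
  B *m N *m B' = - N ->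
  flip e B *m (diag_fun d *t N) *m flip e B' = diag_fun (fun k => (-1) ^+ e k * d k) *t N.
Proof.
move=> BN; rewrite /flip !mulmxDl !mulmxDr !tensmx_mul !diag_funM !mulmx1 !mul1mx BN.
rewrite [X in X *t (N *m B')]diag_fun0 => [|k]; last by case: (e k); rewrite /= ?mulr0 ?mul0r.
rewrite [X in X *t (B *m N)]diag_fun0 => [|k]; last by case: (e k); rewrite /= ?mulr0 ?mul0r.
rewrite !tens0mx addr0 add0r tensmxNr -tensmxNl -tensmxDl; congr (_ *t _).
rewrite /diag_fun -linearN -linearD; congr diag_mx; apply/rowP => k; rewrite !mxE.
by case: (e k) => /=; ring.
Qed.

Lemma flip_unit (B B' : 'M[T]_2) (e : 'I_n -> bool) : B *m B' = 1%:M ->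
  flip e B *m flip e B' = 1%:M.
Proof.
move=> BB; rewrite /flip !mulmxDl !mulmxDr !tensmx_mul !diag_funM !mulmx1 !mul1mx BB.
rewrite [X in X *t B']diag_fun0 => [|k]; last by case: (e k); rewrite /= ?mulr0 ?mul0r.
rewrite [X in X *t B]diag_fun0 => [|k]; last by case: (e k); rewrite /= ?mulr0 ?mul0r.
rewrite !tens0mx addr0 add0r -tensmxDl diag_funD diag_fun1 ?tens1mx1 // => k.
by case: (e k) => /=; ring.
Qed.

Lemma flip_tr (B : 'M[T]_2) (e : 'I_n -> bool) : (flip e B)^T = flip e B^T.
Proof.
have trD (X Y : 'M[T]_(n * 2)) : (X + Y)^T = X^T + Y^T by rewrite linearD.
by rewrite /flip trD !trmx_tens !tr_diag_mx trmx1.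
Qed.

Lemma sigma3_sqr : (sigma3 : 'M[T]_2) *m sigma3 = 1%:M.
Proof.
apply/matrixP => i j; rewrite !mxE big_ord2 !mxE.
by case: (ord2P i) => ->; case: (ord2P j) => ->; rewrite /= ?(mulr1n, mulr0n); ring.
Qed.

Lemma sigma3_tr : (sigma3 : 'M[T]_2)^T = sigma3.
Proof. by apply/matrixP => i j; rewrite !mxE; case: eqVneq => [->|]; rewrite ?eqxx // eq_sym; case: eqVneq. Qed.

Lemma J2_sigma3 : (J2 : 'M[T]_2) *m sigma3 = - (sigma3 *m J2).
Proof.
apply/matrixP => i j; rewrite !mxE !big_ord2 !mxE.
by case: (ord2P i) => ->; case: (ord2P j) => ->; rewrite /= ?(mulr1n, mulr0n); ring.
Qed.

End Flip.

(** * The special orthogonal group *)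

Lemma cayley_unitary (R : realType) (K : numFieldType) (S : scalars R K) p (X : 'M[K]_p) :
  star S X = - X ->
  ((1%:M + X) *m invmx (1%:M - X)) *m star S ((1%:M + X) *m invmx (1%:M - X)) = 1%:M.
Proof.
move=> sX; have u1 : 1%:M - X \in unitmx := unitmx1B_skew sX.
have sB : star S (1%:M - X) = 1%:M + X by rewrite starB star1 sX opprK.
have sD : star S (1%:M + X) = 1%:M - X by rewrite -sB starK.
have u2 : 1%:M + X \in unitmx by rewrite -sB /star unitmx_tr map_unitmx.
have comm : (1%:M - X) *m (1%:M + X) = (1%:M + X) *m (1%:M - X).
  by rewrite !mulmxDl !mulmxDr !mul1mx !mulmx1 !mulmxN !mulNmx; mxabel.
have swap : (1%:M + X) *m invmx (1%:M - X) = invmx (1%:M - X) *m (1%:M + X).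
  by apply: (can_inj (mulKmx u1)); rewrite mulKVmx // mulmxA comm mulmxK.
rewrite {1}swap starM sD /star map_invmx trmx_inv -/(star S _) sB.
by rewrite -mulmxA mulKVmx // mulVmx.
Qed.

Section SOForm.
Variable R : realType.
Local Notation C := R[i].
Local Notation RS := (real_scalars R).

Lemma star_real m n (A : 'M[R]_(m, n)) : star RS A = A^T.
Proof. by rewrite /star /= map_mx_id. Qed.

Lemma closed_eq_set (K : numFieldType) (T : topologicalType) m n (f g : T -> 'M[K]_(m, n)) :
  continuous f -> continuous g -> closed [set x | f x = g x].
Proof.
move=> cf cg.
have -> : [set x | f x = g x] = (fun x => f x - g x) @^-1` [set 0].
  apply/seteqP; split=> x /= h; first by rewrite h subrr.
  by apply/eqP; rewrite -subr_eq0 h.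
apply: preimage_closed; first by move=> x _; exact: (cvgB (cf x) (cg x)).
exact: accessible_closed_set1 (hausdorff_accessible (@norm_hausdorff _ _)) _.
Qed.

Variable p : nat.

Lemma SO_closed : closed (@SO R p).
Proof.
apply: closedI.
  apply: (@closed_eq_set R 'M[R]_p p p (fun g => g *m g^T) (fun=> 1%:M)).
    move=> g; apply: (@cvg_mulmx R _ (nbhs g) _ p p p id (fun g => g^T)); first exact: cvg_id.
    apply: cvg_mx => i j; rewrite mxE; under eq_cvg do rewrite mxE.
    exact: coord_continuous.
  exact: cst_continuous.
apply: (@preimage_closed _ _ (fun g : 'M[R]_p => \det g) [set 1]).
  by move=> g _; apply: (@cvg_det R _ (nbhs g) _ p id g); exact: cvg_id.
exact: accessible_closed_set1 (hausdorff_accessible (@norm_hausdorff _ _)) _.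
Qed.

Lemma SO_tr g : @SO R p g -> @SO R p g^T.
Proof. by move=> [gg dg]; split; rewrite ?trmxK ?det_tr //; exact: mulmx1C. Qed.

Lemma SO_cayley X : setT X -> star RS X = - X ->
  @SO R p ((1%:M + X) *m invmx (1%:M - X)).
Proof.
move=> _ sX; have tX : X^T = - X by rewrite -star_real.
have u1 : 1%:M - X \in unitmx := unitmx1B_skew sX.
have trB : (1%:M - X)^T = 1%:M + X by rewrite linearB /= trmx1 tX opprK.
split; first by rewrite -star_real cayley_unitary.
rewrite det_mulmx det_inv -trB det_tr divrr //.
Qed.

Definition SO_form : compact_form RS p.
Proof.
apply: (@CompactForm R R RS p setT (@SO R p)) => //.
- by move=> g [gg _]; rewrite star_real.
- by split; rewrite ?trmx1 ?mulmx1 ?det1.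
- move=> g h [gg dg] [hh dh]; split; last by rewrite det_mulmx dg dh mulr1.
  by rewrite trmx_mul mulmxA -(mulmxA g) hh mulmx1.
- by move=> g; rewrite star_real; exact: SO_tr.
- exact: SO_closed.
- exact: SO_cayley.
Defined.

End SOForm.

Section SOModel.
Variables (R : realType) (n : nat).
Local Notation C := R[i].
Local Notation RS := (real_scalars R).
Local Notation G := (@SO_form R (n * 2 + 1)).
Local Notation rC := (real_complex R).

Definition um_SO (u : 'M[C]_n) : 'M[R]_(n * 2 + 1) := block_mx (U_SO u) 0 0 0.

Lemma um_SO_D u v : um_SO (u + v) = um_SO u + um_SO v.
Proof. by rewrite /um_SO U_SO_add add_block_mx !addr0. Qed.

Lemma um_SO_M u v : um_SO (u *m v) = um_SO u *m um_SO v.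
Proof. by rewrite /um_SO U_SO_mul mulmx_block !mulmx0 !mul0mx !addr0. Qed.

Lemma um_SO_Z t u : um_SO (rC t *: u) = RS t *: um_SO u.
Proof. by rewrite /um_SO U_SO_scale scale_block_mx !scaler0. Qed.

Lemma um_SO_star u : um_SO (adj u) = star RS (um_SO u).
Proof. by rewrite star_real /um_SO U_SO_adj tr_block_mx !trmx0. Qed.

Lemma um_SO_inj : injective um_SO.
Proof. by move=> u v /eq_block_mx [/U_SO_inj]. Qed.

Lemma um_SO_lift u : u \is unitarymx -> exists2 g, grp G g &
  forall x, g *m um_SO x *m star RS g = um_SO (u *m x *m adj u).
Proof.
move=> uu; exists (block_mx (U_SO u) 0 0 1%:M).
  split; last by rewrite det_ublock det_U_SO // det1 mulr1.
  rewrite tr_block_mx mulmx_block !trmx0 !mulmx0 !mul0mx !addr0 !add0r U_SO_orth //.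
  by rewrite trmx1 mulmx1 -scalar_mx_block.
move=> x; rewrite star_real tr_block_mx !trmx0 /um_SO !mulmx_block.
rewrite !mulmx0 !mul0mx !addr0 -U_SO_adj -!U_SO_mul.
by rewrite !mul0mx !addr0.
Qed.

Lemma U_SO_i k : U_SO ('i%C%:M : 'M[C]_k) = 1%:M *t J2.
Proof. by rewrite -U_SOi map_mx1 scalemx1. Qed.

Lemma um_SO_commutant (X : 'M[R]_(n * 2 + 1)) :
  X *m um_SO ('i%C%:M) = um_SO ('i%C%:M) *m X ->
  X *m um_SO 1%:M = X -> um_SO 1%:M *m X = X -> exists u, X = um_SO u.
Proof.
rewrite -[X]submxK; move: (ulsubmx X) (ursubmx X) (dlsubmx X) (drsubmx X) => A B D E.
rewrite /um_SO U_SO_i U_SO1 !mulmx_block !mulmx0 !mul0mx !addr0 !mulmx1 !mul1mx.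
move=> /eq_block_mx [AJ _ _ _] /eq_block_mx [_ <- _ <-] /eq_block_mx [_ _ <- _].
by have [u ->] := U_SO_commutant AJ; exists u.
Qed.

Lemma um_SO_trace u v : \tr (um_SO u) = \tr (um_SO v) ->
  complex.Re (\tr u) = complex.Re (\tr v).
Proof.
have trE w : \tr (um_SO w) = 2 * complex.Re (\tr w).
  rewrite /um_SO mxtrace_block mxtrace0 addr0 /mxtrace big_mxtens raddf_sum mulr_sumr.
  apply: eq_bigr => a _; rewrite big_ord2 !U_SOE !mxE /= subrr !mulr0 !addr0.
  by rewrite mulr2n mulrDl mul1r.
by rewrite !trE => /mulfI; apply; rewrite pnatr_eq0.
Qed.

(** Reflections of the planes reverse J; the last coordinate of R^(2n+1), on which
    the base points vanish, absorbs the sign of the determinant. *)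
Lemma um_SO_flip (e : 'I_n -> bool) : exists2 g, grp G g & forall d : 'I_n -> R,
    g *m um_SO ('i%C *: diag_mx (\row_k (rC (d k)))) *m star RS g =
    um_SO ('i%C *: diag_mx (\row_k (rC ((-1) ^+ e k * d k)))).
Proof.
pose B : 'M[R]_(n * 2) := flip e sigma3.
have tB : B^T = B by rewrite /B flip_tr sigma3_tr.
have BB : B *m B = 1%:M by apply: flip_unit; exact: sigma3_sqr.
have dB : \det B * \det B = 1 by rewrite -det_mulmx BB det1.
(* B is its own inverse, so its determinant is 1 or -1. *)
exists (block_mx B 0 0 (\det B)%:M).
  split; last by rewrite det_ublock det_scalar expr1.
  rewrite tr_block_mx mulmx_block !trmx0 !mulmx0 !mul0mx !addr0 !add0r tB BB.
  by rewrite tr_scalar_mx -scalar_mxM dB -scalar_mx_block.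
move=> d; have dE (f : 'I_n -> R) : diag_mx (\row_k (rC (f k))) = map_mx rC (diag_fun f).
  by rewrite /diag_fun map_diag_mx; congr diag_mx; apply/rowP => k; rewrite !mxE.
rewrite star_real tr_block_mx !trmx0 /um_SO !mulmx_block.
rewrite !mulmx0 !mul0mx !addr0 tB !dE !U_SOi !mul0mx !addr0; congr (block_mx _ _ _ _).
apply: flip_conj.
by rewrite -mulmxA J2_sigma3 mulmxN mulmxA sigma3_sqr mul1mx.
Qed.

Definition SO_model : unitary_model G n.
Proof.
apply: (@UnitaryModel R R RS _ G n um_SO).
- exact: um_SO_D.
- exact: um_SO_M.
- exact: um_SO_Z.
- exact: um_SO_star.
- exact: um_SO_inj.
- by [].
- exact: um_SO_lift.
- by move=> X _; exact: um_SO_commutant.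
- exact: um_SO_trace.
- exact: um_SO_flip.
Defined.

Variables (r : nat) (ns : 'I_r -> nat).
Hypothesis hm : (\sum_s ns s <= n)%N.
Let v s : 'M[C]_(n, ns s) := sel C n (ns s) (offset ns s).
Let q s := (ns s * 2)%N.
Let W s := sel R (n * 2 + 1) (q s) (offset q s).

Lemma um_SO_Pi s : um_SO ('i%C *: (v s *m adj (v s))) = W s *m (1%:M *t J2) *m (W s)^T.
Proof.
have -> : v s *m adj (v s) =
    map_mx rC (sel R n (ns s) (offset ns s) *m (sel R n (ns s) (offset ns s))^T).
  rewrite map_mxM -map_trmx map_sel; congr (_ *m _).
  by rewrite /star (map_sel (cj (complex_scalars R))).
have os : (offset ns s + ns s <= n)%N := leq_trans (offset_total ns s) hm.
rewrite /um_SO U_SOi /W /q offset_mul2 sel_col; last by lia.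
rewrite tr_col_mx trmx0 mul_col_mx mul_col_row !mul0mx !mulmx0; congr (block_mx _ _ _ _).
by rewrite sel_tens trmx_tens trmx1 !tensmx_mul mulmx1 mul1mx mulmx1.
Qed.

(** The commutant of the J_s consists of block diagonal matrices, whose first blocks
    are complex by [U_SO_commutant]; these have determinant 1, hence so has the last
    block. *)
Lemma SO_sub_commutant :
  @SO_sub R n r ns = commutant SO_model v.
Proof.
have e : (\sum_s q s + ((n - \sum_s ns s) * 2 + 1) = n * 2 + 1)%N.
  by rewrite -big_distrl addnA -mulnDl subnKC.
pose W0 := sel R (n * 2 + 1) ((n - \sum_s ns s) * 2 + 1) (\sum_s q s).
have W_iso : forall s, (W s)^T *m W s = 1%:M := sel_frame_iso R e.
have W_orth : forall s t, s != t -> (W s)^T *m W t = 0.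
  by move=> s t; exact: sel_frame_orth.
have W_orth0 : forall s, (W s)^T *m W0 = 0 by move=> s; exact: sel_frame_orth0.
have W0_orth : forall s, W0^T *m W s = 0 by move=> s; exact: sel_frame0_orth.
have W0_iso : W0^T *m W0 = 1%:M := sel_frame0_iso R e.
have W_full := sel_complete R e.
rewrite -/W0 in W_full.
have J2J2 s : (1%:M *t J2 : 'M[R]_(q s)) *m (1%:M *t J2) = - 1%:M.
  by rewrite tensmx_mul mulmx1 J2_sqr tensmxNr tens1mx1.
apply/seteqP; split=> g.
  move=> [e' [u [A [uu [AA dA] gE]]]].
  rewrite (eq_irrelevance e' e) {e'} in gE.
  have dg : \det g = 1.
    by rewrite gE det_castmx det_ublock det_mxdiag big1 ?mul1r // => s _; exact: det_U_SO.
  rewrite castmx_block_mxdiag -/W0 in gE.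
  have {}gE : g = frame_mx W W0 (fun s => U_SO (u s)) A := gE.
  split; first split=> //.
    rewrite gE frame_mx_tr mul_frame_mx // AA -[RHS]W_full /frame_mx mulmx1; congr (_ + _).
    by apply: eq_bigr => s _; rewrite U_SO_orth // mulmx1.
  move=> s; rewrite /= um_SO_Pi gE; apply: (@frame_mx_commute _ _ _ _ _ W W0 W_iso W_orth W_orth0 W0_orth
    (fun s => U_SO (u s)) A (fun s => 1%:M *t J2) s).
  by rewrite -U_SO_i -!U_SO_mul mul_mx_scalar mul_scalar_mx.
move=> [[gg dg] gc].
have gN s : g *m (W s *m (1%:M *t J2) *m (W s)^T) = (W s *m (1%:M *t J2) *m (W s)^T) *m g.
  by rewrite -um_SO_Pi; exact: gc.
have [gP gJ gP0 gE] := commute_frames W_iso W_orth W_full J2J2 gN.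
have ug s : exists w, (W s)^T *m g *m W s = U_SO w := U_SO_commutant (gJ s).
pose u s := projT1 (cid (ug s)).
have uE s : (W s)^T *m g *m W s = U_SO (u s) := projT2 (cid (ug s)).
have part k (V : 'M[R]_(_, k)) : V^T *m V = 1%:M ->
    g *m (V *m V^T) = (V *m V^T) *m g ->
    (V^T *m g *m V) *m (V^T *m g *m V)^T = 1%:M.
  move=> VV gV; rewrite !trmx_mul trmxK -!mulmxA [V *m (V^T *m _)]mulmxA [g *m (_ *m _)]mulmxA gV.
  by rewrite -!mulmxA [V^T *m (V *m _)]mulmxA VV mul1mx [g *m (_ *m _)]mulmxA gg mul1mx.
have uu s : u s \is unitarymx.
  apply/unitarymx_adj; apply: U_SO_inj; rewrite U_SO_mul U_SO_adj U_SO1 -uE.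
  exact: (part _ (W s) (W_iso s) (gP s)).
exists e, u, (W0^T *m g *m W0).
have gE' : g = castmx (e, e) (block_mx (\mxdiag_s U_SO (u s)) 0 0 (W0^T *m g *m W0)).
  rewrite castmx_block_mxdiag -/W0 {1}gE; congr (_ + _).
  by apply: eq_bigr => s _; rewrite uE.
split=> //; split; first exact: (part _ W0 W0_iso gP0).
have prod1 : \prod_s \det (U_SO (u s)) = 1 by apply: big1 => s _; exact: det_U_SO.
move/(congr1 (fun X : 'M[R]_(n * 2 + 1) => \det X)): gE'.
by rewrite det_castmx det_ublock det_mxdiag prod1 mul1r dg => <-.
Qed.

End SOModel.

(** * The compact symplectic group *)

Section QuaternionicGroup.
Variables (R : realType) (K : numFieldType) (S : scalars R K).
Local Notation star := (star S).
Local Notation c := (cj S).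
Local Notation Om k := ((1%:M : 'M[K]_k) *t J2).

Lemma Om_sqr k : Om k *m Om k = - 1%:M.
Proof. by rewrite tensmx_mul mulmx1 J2_sqr tensmxNr tens1mx1. Qed.

Lemma Om_tr k : (Om k)^T = - Om k.
Proof. by rewrite trmx_tens trmx1 J2_tr tensmxNr. Qed.

Lemma map_J2 (T T' : pzRingType) (f : {rmorphism T -> T'}) : map_mx f (J2 : 'M[T]_2) = J2.
Proof. by apply/matrixP => i j; rewrite !mxE rmorphB !rmorph_nat. Qed.

Lemma Om_map k : map_mx c (Om k) = Om k.
Proof. by rewrite map_mxT map_mx1 map_J2. Qed.

Lemma Om_star k : star (Om k) = - Om k.
Proof. by rewrite /star Om_map Om_tr. Qed.

Lemma quaternionicD k (A B : 'M[K]_(k * 2)) :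
  quaternionic c A -> quaternionic c B -> quaternionic c (A + B).
Proof. by rewrite /quaternionic /= => hA hB; rewrite mulmxDr hA hB map_mxD mulmxDl. Qed.

Lemma quaternionicM k (A B : 'M[K]_(k * 2)) :
  quaternionic c A -> quaternionic c B -> quaternionic c (A *m B).
Proof.
by rewrite /quaternionic /= => hA hB; rewrite mulmxA hA -mulmxA hB map_mxM mulmxA.
Qed.

Lemma quaternionicZ k t (A : 'M[K]_(k * 2)) :
  quaternionic c A -> quaternionic c (S t *: A).
Proof.
by rewrite /quaternionic /= => hA; rewrite -scalemxAr hA map_mxZ /= cj_inc -scalemxAl.
Qed.

Lemma quaternionic1 k : quaternionic c (1%:M : 'M[K]_(k * 2)).
Proof. by rewrite /quaternionic /= map_mx1 mul1mx mulmx1. Qed.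

Lemma quaternionic_star k (A : 'M[K]_(k * 2)) :
  quaternionic c A -> quaternionic c (star A).
Proof.
rewrite /quaternionic /= => hA.
have cs : map_mx c (star A) = A^T.
  by apply/matrixP => i j; rewrite !mxE cjK.
have sc : star (map_mx c A) = A^T.
  by apply/matrixP => i j; rewrite !mxE cjK.
have h2 : star A *m Om k = Om k *m A^T.
  have := congr1 (fun X : 'M[K]_(k * 2) => star X) hA.
  by rewrite !starM Om_star sc mulmxN mulNmx => /eqP; rewrite eqr_opp => /eqP.
have := congr1 (fun X : 'M[K]_(k * 2) => - (Om k *m X *m Om k)) h2.
rewrite -!mulmxA Om_sqr mulmxN mulmx1 mulmxN opprK cs => ->.
by rewrite mulmxA Om_sqr mulNmx mul1mx opprK.
Qed.

Lemma quaternionic_inv k (A : 'M[K]_(k * 2)) : A \in unitmx ->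
  quaternionic c A -> quaternionic c (invmx A).
Proof.
rewrite /quaternionic /= => uA hA; rewrite map_invmx.
have uA' : map_mx c A \in unitmx by rewrite map_unitmx.
apply: (can_inj (mulKmx uA')); rewrite mulKVmx // mulmxA -hA -mulmxA mulmxV //.
by rewrite mulmx1.
Qed.

Lemma quaternionic_closed k : closed (@quaternionic K c k).
Proof.
apply: (@closed_eq_set K 'M[K]_(k * 2) _ _
  (fun X => Om k *m X) (fun X => map_mx c X *m Om k)) => X.
  by apply: (@cvg_mulmx K _ (nbhs X) _ _ _ _ (fun=> Om k) id); [exact: cvg_cst|exact: cvg_id].
apply: (@cvg_mulmx K _ (nbhs X) _ _ _ _ (fun X => map_mx c X) (fun=> Om k)).
  apply: cvg_mx => i j; rewrite mxE; under eq_cvg do rewrite mxE.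
  apply: (@cvg_comp _ _ _ (fun X : 'M[K]_(k * 2) => X i j) c); first exact: coord_continuous.
  exact: cj_continuous.
exact: cvg_cst.
Qed.

(** The group Sp(n) over abstract scalars, with unitarity written by means of [star]. *)
Definition Sp_star k : set 'M[K]_(k * 2) :=
  [set g | g *m star g = 1%:M /\ g^T *m Om k *m g = Om k].

(** For a unitary g the transpose of g is the inverse of its conjugate. *)
Lemma Sp_starP k (g : 'M[K]_(k * 2)) :
  Sp_star g <-> g *m star g = 1%:M /\ quaternionic c g.
Proof.
have tr_unit : g *m star g = 1%:M -> map_mx c g *m g^T = 1%:M.
  by move=> /(congr1 trmx); rewrite trmx_mul /star trmxK trmx1.
split=> -[gg gO]; split=> //; have gt := tr_unit gg.
  by rewrite /quaternionic /= -{2}gO !mulmxA gt mul1mx.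
by rewrite -mulmxA gO mulmxA (mulmx1C gt) mul1mx.
Qed.

Lemma Sp_star_unitary k (g : 'M[K]_(k * 2)) : Sp_star g -> g *m star g = 1%:M.
Proof. by case. Qed.

Lemma Sp_star_closed k : closed (@Sp_star k).
Proof.
have -> : @Sp_star k = [set g | g *m star g = 1%:M] `&` @quaternionic K c k.
  by apply/seteqP; split=> g /Sp_starP.
apply: closedI; last exact: quaternionic_closed.
apply: (@closed_eq_set K 'M[K]_(k * 2) _ _ (fun g => g *m star g) (fun=> 1%:M)).
  move=> g; apply: (@cvg_mulmx K _ (nbhs g) _ _ _ _ id (fun g => star g)).
    exact: cvg_id.
  by apply: (@cvg_star R K S _ (nbhs g) _ _ _ id); exact: cvg_id.
exact: cst_continuous.
Qed.

Definition Sp_form k : compact_form S (k * 2).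
Proof.
apply: (@CompactForm R K S (k * 2) (@quaternionic K c k) (@Sp_star k)).
- exact: quaternionic1.
- exact: quaternionicD.
- exact: quaternionicM.
- exact: quaternionicZ.
- exact: quaternionic_star.
- exact: quaternionic_closed.
- by move=> g /Sp_starP[].
- exact: Sp_star_unitary.
- by apply/Sp_starP; rewrite star1 mulmx1; split=> //; exact: quaternionic1.
- move=> g h /Sp_starP[gg qg] /Sp_starP[hh qh]; apply/Sp_starP; split; last exact: quaternionicM.
  by rewrite starM mulmxA -(mulmxA g) hh mulmx1.
- move=> g /Sp_starP[gg qg]; apply/Sp_starP; split; last exact: quaternionic_star.
  by rewrite starK; exact: mulmx1C.
- exact: Sp_star_closed.
- move=> X qX sX; apply/Sp_starP; split; first exact: cayley_unitary.
  have q1 := quaternionic1 k.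
  have qN : quaternionic c (- X).
    by rewrite -scaleN1r -(rmorphN1 S); exact: quaternionicZ.
  apply: quaternionicM; first exact: quaternionicD.
  by apply: quaternionic_inv; [exact: unitmx1B_skew sX|exact: quaternionicD].
Defined.

Lemma flip_J2_Sp k (e : 'I_k -> bool) : Sp_star (flip e (J2 : 'M[K]_2)).
Proof.
have mapF : map_mx c (flip e (J2 : 'M[K]_2)) = flip e J2.
  rewrite /flip map_mxD !map_mxT map_mx1 map_J2 /diag_fun !map_diag_mx.
  by congr (diag_mx _ *t _ + diag_mx _ *t _); apply/rowP => i; rewrite !mxE rmorph_nat.
apply/Sp_starP; split.
  by rewrite /star mapF flip_tr; apply: flip_unit; rewrite J2_tr mulmxN J2_sqr opprK.
rewrite /quaternionic /= mapF /flip mulmxDl mulmxDr !tensmx_mul !mulmx1 !mul1mx.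
by [].
Qed.

Section Stabilizer.
Variable z : K.
Hypothesis cz : c z = - z.
Hypothesis zz : z * z = -1.
Variables (n r : nat) (ns : 'I_r -> nat).
Hypothesis hm : (\sum_s ns s <= n)%N.
Let n0 := (n - \sum_s ns s)%N.
Let v s : 'M[K]_(n, ns s) := sel K n (ns s) (offset ns s).
Let q s := (ns s * 2)%N.
Let W s := sel K (n * 2) (q s) (offset q s).

Definition conj_sum_sub : set 'M[K]_(n * 2) :=
  [set g | exists (e : (\sum_s ns s * 2 + n0 * 2 = n * 2)%N)
     (u : forall s, 'M[K]_(ns s)) (A : 'M[K]_(n0 * 2)),
     [/\ forall s, u s *m star (u s) = 1%:M, Sp_star A &
      g = castmx (e, e) (block_mx (\mxdiag_s conj_sum c (u s)) 0 0 A)]].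

Lemma WE s : W s = v s *t 1%:M.
Proof. by rewrite /W /q offset_mul2 sel_tens. Qed.

Lemma Om_W s : Om n *m W s = W s *m Om (ns s).
Proof. by rewrite WE !tensmx_mul !mulmx1 !mul1mx. Qed.

Lemma conj_sum_Pi s : conj_sum c (z *: (v s *m star (v s))) =
  W s *m conj_sum c z%:M *m (W s)^T.
Proof.
have cv : star (v s) = (v s)^T by rewrite /star map_sel.
rewrite cv -scalemx1 !conj_sumi // ?map_mx1 //; last by rewrite map_mxM -map_trmx map_sel.
rewrite -scalemxAr -scalemxAl; congr (_ *: _).
by rewrite WE trmx_tens trmx1 !tensmx_mul !mulmx1 mul1mx.
Qed.

(** The restriction of a quaternionic matrix to a block is quaternionic, because the
    selection matrices are real and commute with J; so [conj_sum_commutant] applies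
    to the first blocks. *)
Lemma conj_sum_sub_commutant : conj_sum_sub =
  [set g | Sp_star g /\ forall s, g *m conj_sum c (z *: (v s *m star (v s))) =
     conj_sum c (z *: (v s *m star (v s))) *m g].
Proof.
have e : (\sum_s q s + n0 * 2 = n * 2)%N.
  by rewrite -big_distrl -mulnDl subnKC.
pose W0 := sel K (n * 2) (n0 * 2) (\sum_s q s).
have W_iso : forall s, (W s)^T *m W s = 1%:M := sel_frame_iso K e.
have W_orth : forall s t, s != t -> (W s)^T *m W t = 0.
  by move=> s t; exact: sel_frame_orth.
have W_orth0 : forall s, (W s)^T *m W0 = 0 by move=> s; exact: sel_frame_orth0.
have W0_orth : forall s, W0^T *m W s = 0 by move=> s; exact: sel_frame0_orth.
have W0_iso : W0^T *m W0 = 1%:M := sel_frame0_iso K e.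
have W_full := sel_complete K e.
rewrite -/W0 in W_full.
have W0E : W0 = sel K n n0 (\sum_s ns s) *t 1%:M.
  by rewrite /W0 -sel_tens /q big_distrl.
have Om_W0 : Om n *m W0 = W0 *m Om n0.
  by rewrite W0E !tensmx_mul !mulmx1 !mul1mx.
have N_sqr s : conj_sum c (z%:M : 'M[K]_(ns s)) *m conj_sum c z%:M = - 1%:M.
  rewrite -conj_sumM -scalar_mxM zz.
  by rewrite -scalemx1 conj_sumZ ?rmorphN1 // conj_sum1 scaleN1r.
have Om_tr_frame k (V : 'M[K]_(n * 2, k * 2)) : Om n *m V = V *m Om k ->
    Om k *m V^T = V^T *m Om n.
  move=> /(congr1 trmx); rewrite !trmx_mul !Om_tr mulmxN mulNmx.
  by move/eqP; rewrite eqr_opp => /eqP.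
have restrict k (V : 'M[K]_(n * 2, k * 2)) (X : 'M[K]_(n * 2)) : map_mx c V = V ->
    Om n *m V = V *m Om k -> quaternionic c X -> quaternionic c (V^T *m X *m V).
  move=> cV OV; rewrite /quaternionic /= => hX.
  rewrite !map_mxM -map_trmx cV !mulmxA Om_tr_frame // -(mulmxA _ (Om n)) hX -!mulmxA.
  by rewrite OV.
have extend k (V : 'M[K]_(n * 2, k * 2)) (X : 'M[K]_(k * 2)) : map_mx c V = V ->
    Om n *m V = V *m Om k -> quaternionic c X -> quaternionic c (V *m X *m V^T).
  move=> cV OV; rewrite /quaternionic /= => hX.
  rewrite !map_mxM -map_trmx cV !mulmxA OV -(mulmxA V (Om k)) hX -!mulmxA.
  by rewrite Om_tr_frame.
have cW s : map_mx c (W s) = W s by rewrite map_sel.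
have cW0 : map_mx c W0 = W0 by rewrite map_sel.
apply/seteqP; split=> g.
  move=> [e' [u [A [uu AA gE]]]].
  rewrite (eq_irrelevance e' e) {e'} castmx_block_mxdiag -/W0 in gE.
  have {}gE : g = frame_mx W W0 (fun s => conj_sum c (u s)) A := gE.
  have [AA' qA] := (iffLR (Sp_starP A)) AA.
  split; first (apply/Sp_starP; split).
  - have sg : star g = frame_mx W W0 (fun s => conj_sum c (star (u s))) (star A).
      rewrite /star gE.
      have -> : map_mx c (frame_mx W W0 (fun s => conj_sum c (u s)) A) =
          frame_mx W W0 (fun s => map_mx c (conj_sum c (u s))) (map_mx c A).
        rewrite /frame_mx map_mxD map_mx_sum !map_mxM -map_trmx cW0; congr (_ + _).
        by apply: eq_bigr => s _; rewrite !map_mxM -map_trmx cW.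
      rewrite frame_mx_tr; congr (_ + _); apply: eq_bigr => s _.
      by rewrite conj_sum_adj.
    rewrite sg gE mul_frame_mx // AA' -[RHS]W_full /frame_mx mulmx1; congr (_ + _).
    by apply: eq_bigr => s _; rewrite -conj_sumM uu conj_sum1 mulmx1.
  - rewrite gE; apply: quaternionicD; last exact: (extend _ W0 _ cW0 Om_W0 qA).
    elim/big_ind: _ => [|X Y|s _].
    + by rewrite /quaternionic /= map_mx0 mul0mx mulmx0.
    + exact: quaternionicD.
    + apply: (extend _ (W s) _ (cW s) (Om_W s)); apply: conj_sum_quaternionic.
      exact: cjK.
  - move=> s; rewrite conj_sum_Pi gE.
    apply: (@frame_mx_commute _ _ _ _ _ W W0 W_iso W_orth W_orth0 W0_orth
      (fun s => conj_sum c (u s)) A (fun s => conj_sum c z%:M) s).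
    by rewrite -!conj_sumM mul_mx_scalar mul_scalar_mx.
move=> [/Sp_starP[gg qg] gc].
have gN s : g *m (W s *m conj_sum c z%:M *m (W s)^T) =
    (W s *m conj_sum c z%:M *m (W s)^T) *m g.
  by rewrite -conj_sum_Pi; exact: gc.
have [gP gJ gP0 gE] := commute_frames W_iso W_orth W_full N_sqr gN.
have z0 : z != 0 by apply: contra_eq_neq zz => ->; rewrite mul0r eq_sym oppr_eq0 oner_eq0.
have ug s : exists w, (W s)^T *m g *m W s = conj_sum c w.
  apply: conj_sum_commutant; first exact: (restrict _ (W s) g (cW s) (Om_W s) qg).
  have zE : conj_sum c (z%:M : 'M[K]_(ns s)) = z *: (1%:M *t sigma3).
    by rewrite -[z%:M]scalemx1 conj_sumi ?map_mx1.
  by have := gJ s; rewrite zE -scalemxAr -scalemxAl => /(scalerI z0).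
pose u s := projT1 (cid (ug s)).
have uE s : (W s)^T *m g *m W s = conj_sum c (u s) := projT2 (cid (ug s)).
have part k (V : 'M[K]_(_, k)) : map_mx c V = V -> V^T *m V = 1%:M ->
    g *m (V *m V^T) = (V *m V^T) *m g ->
    (V^T *m g *m V) *m star (V^T *m g *m V) = 1%:M.
  move=> cV VV gV; have sV : star V = V^T by rewrite /star cV.
  rewrite !starM -[V^T in X in _ *m X]sV starK sV.
  rewrite -!mulmxA [V *m (V^T *m _)]mulmxA [g *m (_ *m _)]mulmxA gV.
  by rewrite -!mulmxA [V^T *m (V *m _)]mulmxA VV mul1mx [g *m (_ *m _)]mulmxA gg mul1mx.
exists e, u, (W0^T *m g *m W0); split.
- move=> s; apply: (@conj_sum_inj _ c).
  rewrite conj_sumM conj_sum_adj -/(star _) conj_sum1 -uE.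
  exact: (part _ (W s) (cW s) (W_iso s) (gP s)).
- apply/Sp_starP; split; last exact: (restrict _ W0 g cW0 Om_W0 qg).
  exact: (part _ W0 cW0 W0_iso gP0).
- rewrite castmx_block_mxdiag -/W0 {1}gE; congr (_ + _).
  by apply: eq_bigr => s _; rewrite uE.
Qed.

End Stabilizer.
End QuaternionicGroup.

Section QuaternionicLemmas.
Variables (R : realType) (K : numFieldType) (S : scalars R K) (z : K).
Hypothesis cz : cj S z = - z.
Hypothesis zz : z * z = -1.
Variable n : nat.
Local Notation star := (star S).
Local Notation U := (@conj_sum K (cj S) n).

Lemma conj_sum_star u : star (U u) = U (star u).
Proof. by rewrite /star conj_sum_adj. Qed.

Lemma conj_sum_lift (u : 'M[K]_n) : u *m star u = 1%:M -> exists2 g, grp (Sp_form S n) g &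
  forall x, g *m U x *m star g = U (u *m x *m star u).
Proof.
move=> uu; exists (U u); last by move=> x; rewrite conj_sum_star -!conj_sumM.
apply/Sp_starP; split; last by apply: conj_sum_quaternionic; exact: cjK.
by rewrite conj_sum_star -conj_sumM uu conj_sum1.
Qed.

Lemma conj_sum_scalar_commutant (X : 'M[K]_(n * 2)) : alg (Sp_form S n) X ->
  X *m U z%:M = U z%:M *m X -> exists u, X = U u.
Proof.
move=> qX.
have -> : U z%:M = z *: (1%:M *t sigma3).
  by rewrite -[z%:M]scalemx1 conj_sumi ?map_mx1.
rewrite -scalemxAr -scalemxAl => /scalerI h; apply: conj_sum_commutant qX _; apply: h.
by apply: contra_eq_neq zz => ->; rewrite mul0r eq_sym oppr_eq0 oner_eq0.
Qed.

Lemma conj_sum_trace (u : 'M[K]_n) : \tr (U u) = \tr u + cj S (\tr u).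
Proof.
rewrite /mxtrace big_mxtens rmorph_sum -big_split; apply: eq_bigr => a _ /=.
by rewrite big_ord2 !conj_sumE.
Qed.

Lemma conj_sum_flip (e : 'I_n -> bool) : exists2 g, grp (Sp_form S n) g &
  forall d : 'I_n -> R,
    g *m U (z *: diag_mx (\row_k (S (d k)))) *m star g =
    U (z *: diag_mx (\row_k (S ((-1) ^+ e k * d k)))).
Proof.
exists (flip e J2); first exact: flip_J2_Sp.
move=> d.
have dE (f : 'I_n -> R) : U (z *: diag_mx (\row_k (S (f k)))) =
    z *: (diag_fun (fun k => S (f k)) *t sigma3).
  rewrite conj_sumi // map_diag_mx; congr diag_mx; apply/rowP => k.
  by rewrite !mxE cj_inc.
have sF : star (flip e J2) = flip e (- J2 : 'M[K]_2).
  rewrite -J2_tr -flip_tr /star; congr (_^T).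
  rewrite /flip map_mxD !map_mxT map_mx1 map_J2 /diag_fun !map_diag_mx.
  by congr (diag_mx _ *t _ + diag_mx _ *t _); apply/rowP => i; rewrite !mxE rmorph_nat.
rewrite !dE sF -scalemxAr -scalemxAl flip_conj; last first.
  rewrite J2_sigma3 mulNmx mulmxN opprK -mulmxA J2_sqr mulmxN mulmx1.
  by [].
congr (_ *: (_ *t _)); apply: eq_diag_fun => k.
by rewrite rmorphM rmorphXn rmorphN1.
Qed.

End QuaternionicLemmas.

Section SpModel.
Variables (R : realType) (n : nat).
Local Notation C := R[i].
Local Notation CS := (complex_scalars R).
Local Notation G := (Sp_form CS n).

Lemma cj_i : cj CS 'i%C = - 'i%C.
Proof. exact: conjCi. Qed.

Lemma ii : 'i%C * 'i%C = -1 :> C.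
Proof. by rewrite -expr2 sqr_i. Qed.

Definition um_Sp : 'M[C]_n -> 'M[C]_(n * 2) := @conj_sum C (cj CS) n.

Lemma um_Sp_Z t u : um_Sp (real_complex R t *: u) = CS t *: um_Sp u.
Proof. apply: conj_sumZ; exact: (cj_inc CS). Qed.

Lemma um_Sp_trace u v : \tr (um_Sp u) = \tr (um_Sp v) ->
  complex.Re (\tr u) = complex.Re (\tr v).
Proof.
rewrite /um_Sp !(@conj_sum_trace R _ CS) /=.
case: (\tr u) => a b; case: (\tr v) => a' b' [h _].
have : a *+ 2 = a' *+ 2 by rewrite !mulr2n.
by move/eqP; rewrite eqrMn2r // => /eqP.
Qed.

Definition Sp_model : unitary_model G n.
Proof.
apply: (@UnitaryModel R C CS _ G n um_Sp).
- exact: conj_sumD.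
- exact: conj_sumM.
- exact: um_Sp_Z.
- exact: conj_sum_adj.
- exact: conj_sum_inj.
- move=> u; apply: conj_sum_quaternionic; exact: (cjK CS).
- move=> u /unitarymx_adj; exact: conj_sum_lift.
- move=> X qX Xi _ _; exact: (conj_sum_scalar_commutant cj_i ii qX Xi).
- exact: um_Sp_trace.
- exact: (conj_sum_flip cj_i).
Defined.

Lemma SpE k : @Sp R k = @Sp_star R C CS k.
Proof.
by apply/seteqP; split=> g [gu gO]; split=> //; apply/unitarymx_adj.
Qed.

Lemma Sp_sub_commutant r (ns : 'I_r -> nat) (hm : (\sum_s ns s <= n)%N) :
  @Sp_sub R n r ns = commutant Sp_model (fun s => sel C n (ns s) (offset ns s)).
Proof.
rewrite /commutant -(conj_sum_sub_commutant cj_i ii hm).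
apply/seteqP; split=> g [e [u [A [uu AA gE]]]]; exists e, u, A.
  split=> //; first by move=> s; apply/unitarymx_adj.
  by rewrite -SpE.
split=> //; first by move=> s; apply/unitarymx_adj.
by rewrite SpE.
Qed.

End SpModel.

(** * Base points and the theorem *)

Section Blocks.
Variables (R : realType) (n r : nat) (ns : 'I_r -> nat).
Hypothesis hm : (\sum_s ns s <= n)%N.
Local Notation C := R[i].
Local Notation CS := (complex_scalars R).
Local Notation rC := (real_complex R).

Definition block_sel s : 'M[C]_(n, ns s) := sel C n (ns s) (offset ns s).

Definition in_block (s : 'I_r) (k : 'I_n) : bool :=
  (offset ns s <= k < offset ns s + ns s)%N.

Lemma adj_sel p q o : adj (sel C p q o) = (sel C p q o)^T.
Proof. by rewrite /star (map_sel (cj CS)). Qed.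

Lemma block_sel_iso s : adj (block_sel s) *m block_sel s = 1%:M.
Proof.
rewrite adj_sel; apply: sel_iso; exact: leq_trans (offset_total ns s) hm.
Qed.

Lemma block_sel_orth s t : s != t -> adj (block_sel s) *m block_sel t = 0.
Proof.
by rewrite adj_sel; exact: sel_frame_orth.
Qed.

Lemma block_sel_diag s :
  block_sel s *m adj (block_sel s) = diag_mx (\row_k (in_block s k)%:R).
Proof. by rewrite adj_sel; exact: sel_diag. Qed.

Lemma sum_diag_mx (T : pzRingType) (P : pred 'I_r) (f : 'I_r -> 'I_n -> T) :
  \sum_(s | P s) diag_mx (\row_k f s k) = diag_mx (\row_k \sum_(s | P s) f s k).
Proof.
rewrite -linear_sum; congr diag_mx; apply/rowP => k; rewrite summxE mxE.
by apply: eq_bigr => s _; rewrite mxE.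
Qed.

Lemma UpsilonE (l : 'I_r.+1) : Upsilon C n ns l =
  rC (2 ^+ (r - l.+1)) *:
    \sum_(s < r) flag_sign s l *: (block_sel s *m adj (block_sel s)).
Proof.
rewrite /Upsilon rmorphXn rmorph_nat; congr (_ *: _).
rewrite (eq_bigr (fun s : 'I_r => diag_mx (\row_(k < n) (flag_sign s l * (in_block s k)%:R)))); last first.
  move=> s _; rewrite block_sel_diag; apply/matrixP => i j; rewrite !mxE.
  exact: mulrnAr.
rewrite (sum_diag_mx xpredT (fun (s : 'I_r) k => flag_sign s l * (in_block s k)%:R)).
congr diag_mx; apply/rowP => k; rewrite !mxE big_mkcond; apply: eq_bigr => s _.
rewrite -/(offset ns s) offsetS -/(in_block s k) /flag_sign.
by case: (in_block s k); rewrite ?mulr1 ?mulr0.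
Qed.

Lemma map_Upsilon (T T' : pzRingType) (f : {rmorphism T -> T'}) l :
  map_mx f (Upsilon T n ns l) = Upsilon T' n ns l.
Proof.
rewrite /Upsilon map_mxZ rmorphXn rmorph_nat map_diag_mx; congr (_ *: diag_mx _).
apply/rowP => k; rewrite !mxE rmorph_sum; apply: eq_bigr => s _.
by case: ifP => _; [exact: rmorphN1|case: ifP => _; rewrite ?rmorph1 ?rmorph0].
Qed.

Lemma Lambda_SO_model (l : 'I_r.+1) : 1 *: Lambda_SO R n ns l =
  SO_model R n ('i%C *: (rC (2 ^+ (r - l.+1)) *:
    \sum_(s < r) flag_sign s l *: (block_sel s *m adj (block_sel s)))).
Proof.
rewrite scale1r -UpsilonE -(map_Upsilon (real_complex R)) /= /um_SO.
by rewrite U_SOi.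
Qed.

Lemma Lambda_Sp_model (l : 'I_r.+1) : 'i%C *: Lambda_Sp R n ns l =
  Sp_model R n ('i%C *: (rC (2 ^+ (r - l.+1)) *:
    \sum_(s < r) flag_sign s l *: (block_sel s *m adj (block_sel s)))).
Proof.
rewrite -UpsilonE /= /um_Sp conj_sumi //; first exact: cj_i.
exact: (map_Upsilon (cj CS)).
Qed.

Lemma in_block_sum (j : nat) (k : 'I_n) :
  (\sum_(s < r | (s < j)%N) in_block s k = (k < offset ns j))%N.
Proof.
elim: j => [|j IH]; first by rewrite /offset !big_pred0.
have [rj|jr] := leqP r j.
  have E (s : 'I_r) : (s < j.+1)%N = (s < j)%N.
    by rewrite ltnS (leq_trans (ltn_ord s) rj) ltnW // (leq_trans (ltn_ord s)).
  by rewrite /offset !(eq_bigl _ _ E) IH.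
pose s := Ordinal jr.
have oS : offset ns j.+1 = (offset ns s + ns s)%N by rewrite -offsetS.
have E (t : 'I_r) : ((t < j.+1) && (t != s))%N = (t < j)%N.
  by rewrite ltnS ltn_neqAle andbC.
rewrite (bigD1 s) /= ?ltnS // (eq_bigl _ _ E) IH oS /in_block.
have -> : offset ns j = offset ns s by [].
by case: leqP; case: ltnP => //; lia.
Qed.

Lemma dim_sumE (l : 'I_r.+1) : dim_sum ns l = offset ns l.+1.
Proof. by []. Qed.

(** The blocks up to l together form one block, of size [dim_sum ns l]. *)
Lemma flag_sel (l : 'I_r.+1) (s : 'I_1) :
  sel C n (dim_sum ns l) (offset (fun _ : 'I_1 => dim_sum ns l) s) *m
    adj (sel C n (dim_sum ns l) (offset (fun _ : 'I_1 => dim_sum ns l) s)) =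
  \sum_(t < r | (t <= l)%N) block_sel t *m adj (block_sel t).
Proof.
have -> : offset (fun _ : 'I_1 => dim_sum ns l) s = 0%N.
  by rewrite ord1 /offset big_pred0.
rewrite adj_sel sel_diag; under eq_bigr do rewrite block_sel_diag.
rewrite (sum_diag_mx _ (fun s k => (in_block s k)%:R)); congr diag_mx; apply/rowP => k.
rewrite !mxE -natr_sum add0n /= dim_sumE -in_block_sum.
by [].
Qed.

Lemma dim_sum_le (l : 'I_r.+1) : (\sum_(s < 1) dim_sum ns l <= n)%N.
Proof.
rewrite big_ord1; apply: leq_trans hm.
by rewrite /dim_sum [leqRHS](bigID (fun s : 'I_r => (s <= l)%N)) leq_addr.
Qed.

Lemma commutant_flag (K : numFieldType) (S : scalars R K) p (F : compact_form S p)
    (U : unitary_model F n) (l : 'I_r.+1) :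
  commutant U (fun s : 'I_1 => sel C n (dim_sum ns l) (offset (fun _ : 'I_1 => dim_sum ns l) s)) =
  [set g | grp F g /\ g *m U ('i%C *: \sum_(s < r | (s <= l)%N) block_sel s *m adj (block_sel s)) =
     U ('i%C *: \sum_(s < r | (s <= l)%N) block_sel s *m adj (block_sel s)) *m g].
Proof.
apply/seteqP; split=> g [Gg gc]; split=> //.
  by have := gc ord0; rewrite flag_sel.
by move=> s; rewrite flag_sel.
Qed.

End Blocks.

Theorem proposition6 (R : realType) (n r : nat) (ns : 'I_r -> nat)
    (hn : (1 <= n)%N) (hr : (1 <= r)%N) (hns : forall s, (1 <= ns s)%N)
    (hm : (\sum_s ns s <= n)%N) :
  (let inc : R -> R := idfun in
   let G := @SO R (n * 2 + 1) in
   let H := @SO_sub R n r ns in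
   let L := @Lambda_SO R n r ns in
   (forall l, quot_is_orbit inc G (@OGr_stab R n (dim_sum ns l)) (L l)) /\
   exists phi : set 'M[R]_(n * 2 + 1) -> 'I_r.+1 -> 'M[R]_(n * 2 + 1),
     [/\ embedding inc G H phi,
         phi @` quot G H `<=` orbit_prod G L,
         isotropic inc 1 G (phi @` quot G H)
       & phi @` quot G H = [set x | orbit_prod G L x /\ moment 1 x = 0]]) /\
  (let inc : R -> R[i] := real_complex R in
   let G := @Sp R n in
   let H := @Sp_sub R n r ns in
   let L := @Lambda_Sp R n r ns in
   (forall l, quot_is_orbit inc G (@SGr_stab R n (dim_sum ns l)) (L l)) /\
   exists phi : set 'M[R[i]]_(n * 2) -> 'I_r.+1 -> 'M[R[i]]_(n * 2),
     [/\ embedding inc G H phi,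
         phi @` quot G H `<=` orbit_prod G L,
         isotropic inc 'i%C G (phi @` quot G H)
       & phi @` quot G H = [set x | orbit_prod G L x /\ moment 'i%C x = 0]]).
Proof.
have iso := block_sel_iso R hm; have orth := @block_sel_orth R n r ns.
split=> inc G H L.
  split=> [l|]; last first.
    exact: (model_embedding iso orth (oner_neq0 _) (@Lambda_SO_model R n r ns)
      (SO_sub_commutant R hm)).
  apply: (model_quot_is_orbit iso orth (oner_neq0 _) (@Lambda_SO_model R n r ns)
    (@block_sel_diag R n r ns)).
  rewrite -(commutant_flag hm (SO_model R n)).
  exact: (SO_sub_commutant R (dim_sum_le hm l)).
have i0 : 'i%C != 0 :> R[i] by exact: neq0Ci.
rewrite /G SpE; split=> [l|]; last first.
  exact: (model_embedding iso orth i0 (@Lambda_Sp_model R n r ns) (Sp_sub_commutant R hm)).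
apply: (model_quot_is_orbit iso orth i0 (@Lambda_Sp_model R n r ns)
  (@block_sel_diag R n r ns)).
rewrite -(commutant_flag hm (Sp_model R n)).
exact: (Sp_sub_commutant R (dim_sum_le hm l)).
Qed.
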